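(* Let $Q$ be a bipartite quiver with source vertices $v_1,\dots,v_n$ and sink vertices $w_1,\dots,w_m$, let $\mathbf d\in\mathbb N^{Q_0}$ be a dimension vector of $Q$, and let $\mathbf p=(p_1,\dots,p_m)$ be an $m$-tuple of positive rational numbers such that $\sum_{i=1}^n\mathbf d(v_i)=\sum_{j=1}^mp_j\mathbf d(w_j)$. Let $\omega$ be the least common denominator of $p_1,\dots,p_m$. (1) Let $V\in\operatorname{rep}(Q,\mathbf d)$. Then $\operatorname{BL}_Q(V,\mathbf p)<\infty$ if and only if $V$ is $\mathbf p$-semi-stable. (2) Let $(V,\mathbf p)$ be feasible with $V\in\operatorname{rep}(Q,\mathbf d)$, and let $$\mathcal{BL}_{\mathbf p}(V):=\{A\in\operatorname{GL}(\mathbf d) : (A\cdot V,\mathbf p)\text{ is a geometric BL quiver datum}\}.$$ Then $\mathcal{BL}_{\mathbf p}(V)\ne\emptyset$ if and only if $V$ is $\mathbf p$-polystable. (3) Let $(V,\mathbf p)$ be feasible with $V\in\operatorname{rep}(Q,\mathbf d)$. Then there exists a $\mathbf p$-polystable representation $\widetilde V\in\operatorname{rep}(Q,\mathbf d)$ such that $\widetilde V\in\overline{\operatorname{GL}(\mathbf d)_{\mathbf p}V}$. Furthermore, for any such $\widetilde V$, $$\operatorname{BL}_Q(V,\mathbf p)=\operatorname{BL}_Q(\widetilde V,\mathbf p)=|\chi_{\mathbf p}(A)|^{-\frac1\omega}\qquad\text{for all }A\in\mathcal{BL}_{\mathbf p}(\widetilde V).$$ (4) Let $V\in\operatorname{rep}(Q,\mathbf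 d)$ be such that $$V(a)=\begin{pmatrix}V_1(a)&X(a)\\0&V_2(a)\end{pmatrix}\quad\text{for all }a\in Q_1,$$ where $V_i\in\operatorname{rep}(Q,\mathbf d_i)$, $i\in\{1,2\}$, are representations of $Q$ (so $\mathbf d=\mathbf d_1+\mathbf d_2$) and $X(a)\in\mathbb R^{\mathbf d_1(ha)\times\mathbf d_2(ta)}$ for every $a\in Q_1$. If $\mathbf p$ and $\mathbf{dim}\,V_1=\mathbf d_1$ are orthogonal, i.e. $\sum_{i=1}^n\mathbf d_1(v_i)=\sum_{j=1}^mp_j\mathbf d_1(w_j)$, then $$\operatorname{BL}_Q(V,\mathbf p)=\operatorname{BL}_Q(V_1,\mathbf p)\cdot\operatorname{BL}_Q(V_2,\mathbf p).$$ (5) A feasible quiver datum $(V,\mathbf p)$ with $V\in\operatorname{rep}(Q,\mathbf d)$ is gaussian-extremisable if and only if $V$ is $\mathbf p$-polystable. If this is the case, the gaussian extremisers of $(V,\mathbf p)$ are exactly the $m$-tuples of matrices $(A(w_j)^T\cdot A(w_j))_{j\in[m]}$ with $A\in\mathcal{BL}_{\mathbf p}(V)$. (6) If a feasible quiver datum $(V,\mathbf p)$ with $V\in\operatorname{rep}(Q,\mathbf d)$ has unique gaussian extremisers (up to scaling), then $V$ is $\mathbf p$-stable. Conversely, if $V\in\operatorname{rep}(Q,\mathbf d)$ is $\mathbf p$-stable and $\operatorname{End}_Q(V)=\mathbb R$, then $(V,\mathbf p)$ has unique gaussian extremisers (up to scaling).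
   Context: A quiver $Q=(Q_0,Q_1,t,h)$ has finite sets $Q_0$ of vertices and $Q_1$ of arrows, and tail and head maps $t,h:Q_1\to Q_0$; quivers are assumed connected. $Q$ is bipartite if $Q_0$ is the disjoint union of $Q_0^+=\{v_1,\dots,v_n\}$ and $Q_0^-=\{w_1,\dots,w_m\}$ and every arrow goes from $Q_0^+$ to $Q_0^-$. $\mathcal A_{i,j}$ is the set of arrows from $v_i$ to $w_j$. $\mathbb N=\{0,1,\dots\}$ and $[L]=\{1,\dots,L\}$. A (real) representation $V$ of $Q$ consists of finite-dimensional real vector spaces $V(x)$, $x\in Q_0$, and linear maps $V(a):V(ta)\to V(ha)$, $a\in Q_1$; $\mathbf{dim}\,V=(\dim_{\mathbb R}V(x))_{x\in Q_0}$. A subrepresentation $V'\le V$ is given by subspaces $V'(x)\le V(x)$ with $V(a)(V'(ta))\subseteq V'(ha)$ for all $a$, with the restricted maps. $\operatorname{End}_Q(V)$ is the space of families of linear maps $\phi(x):V(x)\to V(x)$ with $\phi(ha)V(a)=V(a)\phi(ta)$ for all $a$; $\operatorname{End}_Q(V)=\mathbb R$ means it consists only of the families $(\lambda\,\mathrm{id}_{V(x)})_{x}$, $\lambda\in\mathbb R$. $\operatorname{rep}(Q,\mathbf d)=\prod_{a\in Q_1}\mathbb R^{\mathbf d(ha)\times\mathbf d(ta)}$. The group $\operatorname{GL}(\mathbf d)=\prod_{x\in Q_0}\operatorname{GL}(\mathbf d(x),\mathbb R)$ acts on it by $(A\cdot V)(a)=A(ha)V(a)A(ta)^{-1}$. The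 character $\chi_{\mathbf p}:\operatorname{GL}(\mathbf d)\to\mathbb R^\times$ is $$\chi_{\mathbf p}(A)=\prod_{i=1}^n\det(A(v_i))^{\omega}\cdot\prod_{j=1}^m\det(A(w_j))^{-\omega p_j},$$ and $\operatorname{GL}(\mathbf d)_{\mathbf p}=\ker\chi_{\mathbf p}$. Closures are taken in the Euclidean topology. A representation $V$ with $\sum_i\dim V(v_i)=\sum_jp_j\dim V(w_j)$ is $\mathbf p$-semi-stable if $\sum_{i=1}^n\dim V'(v_i)\le\sum_{j=1}^mp_j\dim V'(w_j)$ for all subrepresentations $V'\le V$, and $\mathbf p$-stable if this inequality is strict for all subrepresentations $0\neq V'\lneq V$. A representation is $\mathbf p$-polystable if it is (isomorphic to) a finite direct sum of $\mathbf p$-stable representations. Let $\mathcal S^+_d$ be the set of $d\times d$ symmetric positive definite real matrices. The Brascamp-Lieb constant is $$\operatorname{BL}_Q(V,\mathbf p)=\sup\left\{\left(\frac{\prod_{j=1}^m\det(Y_j)^{p_j}}{\prod_{i=1}^n\det\Big(\sum_{j=1}^mp_j\sum_{a\in\mathcal A_{i,j}}V(a)^TY_jV(a)\Big)}\right)^{1/2} : Y_j\in\mathcal S^+_{\mathbf d(w_j)},\ j\in[m]\right\},$$ with the convention $\frac10=\infty$ (and similarly for $V_1,V_2$ with dimension vectors $\mathbf d_1,\mathbf d_2$). $(V,\mathbf p)$ is feasible if $\operatorname{BL}_Q(V,\mathbf p)<\infty$. A feasible $(V,\mathbf p)$ is gaussian-extremisable if the supremum is attained at some $(Y_1,\dots,Y_m)$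 with $Y_j\in\mathcal S^+_{\mathbf d(w_j)}$; any such tuple is a gaussian extremiser. ''Unique gaussian extremisers (up to scaling)'' means that gaussian extremisers exist and any two of them $Y,Y'$ satisfy $Y'=cY$ (i.e. $Y'_j=cY_j$ for all $j$) for some scalar $c>0$. $(V,\mathbf p)$ is a geometric BL quiver datum if $$\sum_{j=1}^mp_j\sum_{a\in\mathcal A_{i,j}}V(a)^TV(a)=\mathbf I_{\mathbf d(v_i)}\ \ \forall i\in[n],\qquad\sum_{i=1}^n\sum_{a\in\mathcal A_{i,j}}V(a)V(a)^T=\mathbf I_{\mathbf d(w_j)}\ \ \forall j\in[m].$$ *)

(* Defs.v *)
From mathcomp Require Import all_boot all_order all_algebra.
From mathcomp Require Import all_classical all_reals all_analysis.
Import Order.TTheory GRing.Theory Num.Theory numFieldNormedType.Exports.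

Set Implicit Arguments.
Unset Strict Implicit.
Unset Printing Implicit Defensive.

Local Open Scope classical_set_scope.
Local Open Scope ring_scope.

(* Quivers and their real representations over a realType R. *)

Record quiver := Quiver {
  vertex : finType;
  arrow : finType;
  tl : arrow -> vertex;
  hd : arrow -> vertex }.

Definition adjacent (Q : quiver) : rel (vertex Q) := fun x y =>
  [exists a : arrow Q,
    ((tl a == x) && (hd a == y)) || ((tl a == y) && (hd a == x))].

Definition quiver_connected (Q : quiver) : Prop :=
  forall x y : vertex Q, connect (@adjacent Q) x y.

Definition dimvec (Q : quiver) := vertex Q -> nat.

Definition rep (R : realType) (Q : quiver) (d : dimvec Q) : Type :=
  forall a : arrow Q, 'M[R]_(d (hd a), d (tl a)).

(* Matrices act on column vectors. *)
Definition subrep (R : realType) (Q : quiver) (d : dimvec Q) (V : rep R d)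
    (U : forall x : vertex Q, {vspace 'cV[R]_(d x)}) : Prop :=
  forall (a : arrow Q) (u : 'cV[R]_(d (tl a))),
    u \in U (tl a) -> V a *m u \in U (hd a).

Definition End_scalar (R : realType) (Q : quiver) (d : dimvec Q)
    (V : rep R d) : Prop :=
  forall phi : forall x : vertex Q, 'M[R]_(d x),
    (forall a, phi (hd a) *m V a = V a *m phi (tl a)) ->
    exists lambda : R, forall x, phi x = lambda%:M.

Definition rep_iso (R : realType) (Q : quiver) (d d' : dimvec Q)
    (V : rep R d) (V' : rep R d') : Prop :=
  exists (f : forall x : vertex Q, 'M[R]_(d' x, d x))
         (g : forall x : vertex Q, 'M[R]_(d x, d' x)),
    [/\ forall x, g x *m f x = 1%:M,
        forall x, f x *m g x = 1%:M
      & forall a, f (hd a) *m V a = V' a *m f (tl a)].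

(* conform_mx is only a dependent-type cast: in the branch i = j the blocks
   have the same dimensions, so that block (i, i) is W i a. *)
Definition direct_sum (R : realType) (Q : quiver) (k : nat)
    (e : 'I_k -> dimvec Q) (W : forall i, rep R (e i)) :
    rep R (fun x => \sum_(i < k) e i x)%N :=
  fun a => \mxblock_(i < k, j < k)
    (if i == j then conform_mx 0 (W i a) else 0).

Definition GL (R : realType) (Q : quiver) (d : dimvec Q) :
    set (forall x : vertex Q, 'M[R]_(d x)) :=
  [set A | forall x, A x \in unitmx].

Definition act (R : realType) (Q : quiver) (d : dimvec Q)
    (A : forall x : vertex Q, 'M[R]_(d x)) (V : rep R d) : rep R d :=
  fun a => A (hd a) *m V a *m invmx (A (tl a)).

(* The Euclidean topology of rep(Q, d), as a product of matrix spaces. *)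
Definition rep_closure (R : realType) (Q : quiver) (d : dimvec Q)
    (S : set (rep R d)) : set (rep R d) :=
  @closure (prod_topology
    (fun a : arrow Q => 'M[R]_(d (hd a), d (tl a)))) S.

(* The bipartite quiver with sources v_i = inl i, sinks w_j = inr j, and
   arr i j as the set of arrows from v_i to w_j. *)
Definition bipartite (n m : nat) (arr : 'I_n -> 'I_m -> finType) : quiver :=
  @Quiver ('I_n + 'I_m)%type {ij : 'I_n * 'I_m & arr ij.1 ij.2}
    (fun a => inl (tag a).1) (fun a => inr (tag a).2).

Definition arrow_of (n m : nat) (arr : 'I_n -> 'I_m -> finType)
    (i : 'I_n) (j : 'I_m) (a : arr i j) : arrow (bipartite arr) :=
  @Tagged _ (i, j) (fun ij => arr ij.1 ij.2) a.

Section Bipartite.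
Variables (R : realType) (n m : nat) (arr : 'I_n -> 'I_m -> finType).
Notation Q := (bipartite arr).
Notation v i := (inl i : vertex Q).
Notation w j := (inr j : vertex Q).
Implicit Types (p : 'I_m -> rat) (d : dimvec Q).

Definition entry d (V : rep R d) (i : 'I_n) (j : 'I_m) (a : arr i j) :
  'M[R]_(d (w j), d (v i)) := V (arrow_of a).

Definition orthogonal_dim p d : Prop :=
  \sum_(i < n) (d (v i))%:R = \sum_(j < m) p j * (d (w j))%:R.

Definition semistable p d (V : rep R d) : Prop :=
  orthogonal_dim p d /\
  forall U : forall x : vertex Q, {vspace 'cV[R]_(d x)}, subrep V U ->
    \sum_(i < n) (\dim (U (v i)))%:R
      <= \sum_(j < m) p j * (\dim (U (w j)))%:R.

Definition stable p d (V : rep R d) : Prop :=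
  orthogonal_dim p d /\
  forall U : forall x : vertex Q, {vspace 'cV[R]_(d x)}, subrep V U ->
    (exists x, U x != 0%VS) -> (exists x, U x != fullv) ->
    \sum_(i < n) (\dim (U (v i)))%:R
      < \sum_(j < m) p j * (\dim (U (w j)))%:R.

Definition polystable p d (V : rep R d) : Prop :=
  exists (k : nat) (e : 'I_k -> dimvec Q) (W : forall i, rep R (e i)),
    (forall i, stable p (W i)) /\ rep_iso V (direct_sum W).

Definition lcden p : nat := \big[lcmn/1%N]_(j < m) `|denq (p j)|%N.

(* numq is taken of the integer omega * p_j. *)
Definition chi p d (A : forall x : vertex Q, 'M[R]_(d x)) : R :=
  \prod_(i < n) \det (A (v i)) ^+ lcden p
  * \prod_(j < m) \det (A (w j)) ^ (- numq ((lcden p)%:R * p j)).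

Definition GLp p d : set (forall x : vertex Q, 'M[R]_(d x)) :=
  [set A | GL A /\ chi p A = 1].

Definition posdef k (Y : 'M[R]_k) : Prop :=
  Y^T = Y /\ forall u : 'cV[R]_k, u != 0 -> 0 < (u^T *m Y *m u) 0 0.

Definition BL_num p d (Y : forall j : 'I_m, 'M[R]_(d (w j))) : R :=
  \prod_(j < m) (\det (Y j)) `^ (ratr (p j)).

Definition BL_den p d (V : rep R d) (Y : forall j : 'I_m, 'M[R]_(d (w j))) : R :=
  \prod_(i < n) \det (\sum_(j < m) ratr (p j) *:
    \sum_(a : arr i j) (entry V a)^T *m Y j *m entry V a).

Definition BL_val p d (V : rep R d) (Y : forall j : 'I_m, 'M[R]_(d (w j))) :
    \bar R :=
  if BL_den p V Y == 0 then +oo%E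
  else (Num.sqrt (BL_num p Y / BL_den p V Y))%:E.

Definition BL p d (V : rep R d) : \bar R :=
  ereal_sup [set BL_val p V Y | Y in [set Y | forall j, posdef (Y j)]].

Definition feasible p d (V : rep R d) : Prop := (BL p V < +oo)%E.

Definition gaussian_extremiser p d (V : rep R d)
    (Y : forall j : 'I_m, 'M[R]_(d (w j))) : Prop :=
  [/\ feasible p V, forall j, posdef (Y j) & BL_val p V Y = BL p V].

Definition gaussian_extremisable p d (V : rep R d) : Prop :=
  exists Y, gaussian_extremiser p V Y.

Definition unique_gaussian_extremisers p d (V : rep R d) : Prop :=
  gaussian_extremisable p V /\
  forall Y Y', gaussian_extremiser p V Y -> gaussian_extremiser p V Y' ->
    exists2 c : R, 0 < c & forall j, Y' j = c *: Y j.

Definition geometric p d (V : rep R d) : Prop :=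
  (forall i : 'I_n, \sum_(j < m) ratr (p j) *:
     \sum_(a : arr i j) (entry V a)^T *m entry V a = 1%:M) /\
  (forall j : 'I_m, \sum_(i < n)
     \sum_(a : arr i j) entry V a *m (entry V a)^T = 1%:M).

Definition BLset p d (V : rep R d) : set (forall x : vertex Q, 'M[R]_(d x)) :=
  [set A | GL A /\ geometric p (act A V)].

End Bipartite.
Arguments GLp {R n m arr} p d _.

(* Main.v *)
(* For a tuple H of positive definite matrices put
     Phi_V(H) = \sum_a w_a tr (V(a)^T H_(ha) V(a) H_(ta)^-1) + \sum_x theta_x ln det H_x,
   with theta = 1 on sources, theta = - p_j on sinks and w_a = p_(ha).  Eliminating the
   source matrices shows that BL(V, p) <= b iff Phi_V >= \sum_i d(v_i) - 2 ln b
   everywhere.  Writing H_x = K_x^T e^(y_x) K_x with K_x orthogonal turns Phi_V into a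
   sum of exponentials with nonnegative weights plus a linear form in y, so it is convex
   along these rays: its critical points are minima, and A^T A is critical iff A.V is
   geometric.  If V is stable, Phi_V grows along all rays, uniformly by compactness of
   the set of frames and unit directions, so a minimum exists.  A subrepresentation of
   weighted dimension 0 makes V block triangular, and completing the square splits
   inf Phi_V into the sum of the infima of the two blocks; the infimum is attained only
   if the off-diagonal block can be removed.  Induction on the dimension then gives the
   semistable and polystable cases.  For the closure statement, inf Phi is invariant
   under ker chi, upper semicontinuous as an infimum of continuous functions, and lower
   semicontinuous at geometric data. *)

(* The weight p_(ha) is chosen so that the source and sink components of the critical equation of
   Phi_V are exactly the two families of equations of a geometric datum, the sink ones multiplied by
   p_j. Minimality at a critical point then needs no calculus: there the linear form in y equals
   minus the weighted sum of the exponents, so 1 + x <= e^x applies term by term, and its equality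
   case shows that a second minimiser commutes with the representation. Noncompactness in y shapes
   the rest. Weighted dimension 0 makes a common shift of all logarithms harmless, so minimisers are
   sought among logarithms of sum 0. The coefficients of the exponentials depend on the frame and
   may vanish, so growth is measured by a continuous quantity that stability makes positive on unit
   directions. In the lower semicontinuity statement no bound on y is available; there (1 - e) e^x -
   x >= 1 + ln(1 - e), valid for all x, does the work. *)
Require Import Defs.
From mathcomp Require Import all_boot all_order perm all_algebra.
From mathcomp Require Import all_classical all_reals all_analysis.
From mathcomp Require Import ring lra.
Import Order.TTheory GRing.Theory Num.Theory numFieldNormedType.Exports.
Set Implicit Arguments.
Unset Strict Implicit.
Unset Printing Implicit Defensive.
Local Open Scope classical_set_scope.
Local Open Scope ring_scope.

(** * Symmetric and positive definite matrices *)

(** A small t of sign opposite to [b] lets the linear term outweigh the quadratic one. This replaces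
    differentiation at extrema, both for the Rayleigh quotient and for sums of exponentials. *)
Lemma first_order_condition (R : realFieldType) (e b c : R) : 0 < e ->
  (forall t, `|t| <= e -> 0 <= t * b + t ^+ 2 * c) -> b = 0.
Proof.
move=> e0 H; apply/eqP; apply: contraT => b0.
have nb0 : 0 < `|b| by rewrite normr_gt0.
(* The test value is t = - s b, where the expression equals b^2 s (s c - 1). The first bound on [s]
   keeps |t| <= e, the second makes s c < 1. *)
pose s := Num.min (e / `|b|) ((`|c| + 1)^-1 / 2).
have c1 : 0 < `|c| + 1 by rewrite ltr_wpDl.
have s0 : 0 < s by rewrite lt_min !divr_gt0 // invr_gt0.
have se : s <= e / `|b| by rewrite ge_min lexx.
have sc : s <= (`|c| + 1)^-1 / 2 by rewrite ge_min lexx orbT.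
have {}sc : s * (`|c| + 1) <= 2^-1.
  by rewrite -ler_pdivlMr // [X in _ <= X]mulrC.
have /H : `|- (s * b)| <= e by rewrite normrN normrM gtr0_norm // -ler_pdivlMr.
have -> : - (s * b) * b + (- (s * b)) ^+ 2 * c = b ^+ 2 * s * (s * c - 1) by ring.
rewrite pmulr_rge0; last by rewrite mulr_gt0 // exprn_even_gt0.
have := ler_norm c => hc.
have : s * c <= s * `|c| by rewrite ler_pM2l.
by rewrite mulrDr mulr1 in sc; move: s0; lra.
Qed.

Lemma continuous_sumr (R : realType) (T : topologicalType) (I : Type)
    (r : seq I) (P : pred I) (f : I -> T -> R) :
  (forall i, P i -> continuous (f i)) ->
  continuous (fun x => \sum_(i <- r | P i) f i x).
Proof. by apply: continuous_big => z; exact: add_continuous. Qed.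

Lemma continuous_mulr (R : realType) (T : topologicalType) (f g : T -> R) :
  continuous f -> continuous g -> continuous (fun x => f x * g x).
Proof. by move=> cf cg x; apply: cvgM; [exact: cf|exact: cg]. Qed.

Lemma continuous_addr (R : realType) (T : topologicalType) (f g : T -> R) :
  continuous f -> continuous g -> continuous (fun x => f x + g x).
Proof. by move=> cf cg x; apply: cvgD; [exact: cf|exact: cg]. Qed.

Section RealMatrices.
Variable R : realType.

Lemma dot_ge0 n (u : 'rV[R]_n) : 0 <= (u *m u^T) 0 0.
Proof. by rewrite !mxE sumr_ge0 // => i _; rewrite !mxE -expr2 sqr_ge0. Qed.

Lemma dot_eq0 n (u : 'rV[R]_n) : (u *m u^T) 0 0 = 0 -> u = 0.
Proof.
rewrite !mxE => /eqP; rewrite psumr_eq0; last first.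
  by move=> i _; rewrite !mxE -expr2 sqr_ge0.
move=> /allP h; apply/rowP => i; have := h i (mem_index_enum _).
by rewrite !mxE -expr2 sqrf_eq0 => /eqP.
Qed.

(** The quadratic form attains its maximum on the compact unit sphere; homogeneity of degree two
    extends the bound to all vectors. *)
Lemma rayleigh_max n (M : 'M[R]_n.+1) : exists2 u : 'rV[R]_n.+1,
  (u *m u^T) 0 0 = 1 &
  forall v : 'rV[R]_n.+1, (v *m M *m v^T) 0 0 <= (u *m M *m u^T) 0 0 * (v *m v^T) 0 0.
Proof.
have cont (N : 'M[R]_n.+1) : continuous (fun u : 'rV[R]_n.+1 => (u *m N *m u^T) 0 0).
  have -> : (fun u : 'rV[R]_n.+1 => (u *m N *m u^T) 0 0) =
      (fun u : 'rV[R]_n.+1 => \sum_j \sum_i u 0 i * N i j * u 0 j).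
    apply/funext => u; rewrite mxE; apply: eq_bigr => j _.
    by rewrite !mxE mulr_suml.
  apply: continuous_sumr => j _; apply: continuous_sumr => i _.
  apply: continuous_mulr; last exact: coord_continuous.
  by apply: continuous_mulr; [exact: coord_continuous|exact: cst_continuous].
pose S := [set u : 'rV[R]_n.+1 | (u *m u^T) 0 0 = 1].
have Scl : closed S.
  have -> : S = (fun u : 'rV[R]_n.+1 => (u *m 1%:M *m u^T) 0 0) @^-1` [set 1].
    by apply/funext => u /=; rewrite /S /= mulmx1.
  by apply: preimage_closed; [move=> u _; exact: cont|exact: closed_eq].
have Sb : bounded_set S.
  exists 1; split => // x x1 u /= Su; rewrite /Num.norm/= mx_normrE.
  apply: (le_trans _ (ltW x1)); apply/bigmax_leP; split => // -[i j] _ /=.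
  rewrite ord1 -[leRHS]sqrtr1 -Su -sqrtr_sqr ler_wsqrtr // !mxE (bigD1 j) //= mxE -expr2.
  by rewrite lerDl sumr_ge0 // => k _; rewrite mxE -expr2 sqr_ge0.
have S0 : S !=set0.
  exists (delta_mx 0 0); rewrite /S /= mxE big_ord_recl big1 ?addr0 => [|i _];
    by rewrite !mxE ?eqxx ?mulr1 ?mul0r.
have cM : {within S, continuous (fun u : 'rV[R]_n.+1 => (u *m M *m u^T) 0 0)}.
  exact/continuous_subspaceT/cont.
have [u uS umax] := EVT_max_rV S0 (bounded_closed_compact Sb Scl) cM.
exists u; first by move: uS; rewrite inE.
move=> v; have [v0|v0] := eqVneq v 0.
  by rewrite v0 !mul0mx !mxE mulr0.
have vv : 0 < (v *m v^T) 0 0.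
  rewrite lt_neqAle dot_ge0 andbT; apply: contra_neq v0 => h; exact: dot_eq0.
set s := (v *m v^T) 0 0 in vv *.
have scale (N : 'M[R]_n.+1) (c : R) :
    ((c *: v) *m N *m (c *: v)^T) 0 0 = c ^+ 2 * (v *m N *m v^T) 0 0.
  by rewrite linearZ /= -!scalemxAl -scalemxAr !mxE; ring.
have inS : (Num.sqrt s)^-1 *: v \in S.
  rewrite inE /S /= -[X in X *m _]mulmx1 scale mulmx1 -/s exprVn sqr_sqrtr ?(ltW vv) //.
  by rewrite mulVf // gt_eqF.
have := umax _ inS; rewrite scale exprVn sqr_sqrtr ?(ltW vv) //.
by rewrite ler_pdivrMl // [X in _ <= X]mulrC.
Qed.

(** A maximiser of the Rayleigh quotient works: its first variation in each direction v vanishes,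
    and letting v run through the basis vectors gives the eigenvalue equation. *)
Lemma symmetric_eigenvector n (M : 'M[R]_n.+1) : M^T = M ->
  exists (u : 'rV[R]_n.+1) (a : R), (u *m u^T) 0 0 = 1 /\ u *m M = a *: u.
Proof.
move=> Msym; have [u u1 umax] := rayleigh_max M.
set a := (u *m M *m u^T) 0 0 in umax; exists u, a; split => //.
have bil (N : 'M[R]_n.+1) (v : 'rV_n.+1) t : N^T = N ->
    ((u + t *: v) *m N *m (u + t *: v)^T) 0 0 =
    (u *m N *m u^T) 0 0 + t * ((u *m N *m v^T) 0 0 *+ 2) + t ^+ 2 * (v *m N *m v^T) 0 0.
  move=> Nsym; have sym1 : (v *m N *m u^T) 0 0 = (u *m N *m v^T) 0 0.
    have -> : v *m N *m u^T = (u *m N *m v^T)^T by rewrite !trmx_mul trmxK Nsym mulmxA.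
    by rewrite mxE.
  rewrite linearD linearZ /= mulmxDl !mulmxDr !mulmxDl -!scalemxAl -!scalemxAr.
  have addE (A B : 'M[R]_1) : (A + B) 0 0 = A 0 0 + B 0 0 by rewrite mxE.
  have sclE (c : R) (B : 'M[R]_1) : (c *: B) 0 0 = c * B 0 0 by rewrite mxE.
  rewrite !(addE, sclE) sym1; ring.
have key (v : 'rV_n.+1) : (u *m M *m v^T) 0 0 = a * (u *m v^T) 0 0.
  apply/eqP; rewrite -subr_eq0; apply/eqP.
  set c := (u *m M *m v^T) 0 0; set e := (u *m v^T) 0 0.
  suff : (a * e - c) *+ 2 = 0 by move/eqP; rewrite mulrn_eq0 /= subr_eq0 => /eqP ->; rewrite subrr.
  apply: (@first_order_condition _ 1 _ (a * (v *m v^T) 0 0 - (v *m M *m v^T) 0 0)) => // t _.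
  have := bil 1%:M v t (trmx1 _ _); rewrite !mulmx1 u1 -/e => bil1.
  have := umax (u + t *: v); rewrite bil // bil1 -/a -/c -subr_ge0.
  by congr (0 <= _); ring.
apply/rowP => j; have := key (delta_mx 0 j).
by rewrite trmx_delta -!colE !mxE.
Qed.

(** The reflection along e - u exchanges the first basis vector e and u; if the two coincide, the
    identity serves. *)
Lemma householder n (u : 'rV[R]_n.+1) : (u *m u^T) 0 0 = 1 ->
  exists K : 'M[R]_n.+1, K *m K^T = 1%:M /\ row 0 K = u.
Proof.
move=> u1; pose e : 'rV[R]_n.+1 := delta_mx 0 0; pose v : 'rV[R]_n.+1 := e - u.
have [v0|v0] := eqVneq v 0.
  exists 1%:M; rewrite trmx1 mulmx1 row1; split => //.
  by move/eqP: v0; rewrite subr_eq0 => /eqP.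
have e1 : (e *m e^T) 0 0 = 1 by rewrite trmx_delta mul_delta_mx mxE !eqxx.
have eu : (e *m u^T) 0 0 = u 0 0 by rewrite -rowE !mxE.
have ue : (u *m e^T) 0 0 = u 0 0 by rewrite trmx_delta -colE !mxE.
have vv : (v *m v^T) 0 0 = 2 * (1 - u 0 0).
  rewrite linearB /= mulmxBl !mulmxBr.
  move: e1 eu ue u1; rewrite !mxE => -> -> -> ->; ring.
have ev : (e *m v^T) 0 0 = 1 - u 0 0.
  by rewrite linearB /= mulmxBr; move: e1 eu; rewrite !mxE => -> ->.
have vv0 : (v *m v^T) 0 0 != 0 by apply: contra_neq v0; exact: dot_eq0.
set s : R := (v *m v^T) 0 0 in vv vv0.
have vvE : v *m v^T = s%:M by rewrite [LHS]mx11_scalar.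
have vdef : u = e - v by rewrite subKr.
clearbody v.
pose K := 1%:M - (2 / s) *: (v^T *m v).
have KT : K^T = K.
  by rewrite /K linearB /= trmx1 linearZ /= trmx_mul trmxK.
exists K; split.
  have AA : (v^T *m v) *m (v^T *m v) = s *: (v^T *m v).
    by rewrite mulmxA -(mulmxA v^T) vvE mul_mx_scalar -scalemxAl.
  rewrite KT /K mulmxBl mul1mx mulmxBr mulmx1 -scalemxAr -scalemxAl AA.
  rewrite !scalerA -scalerBl -addrA -opprD -scalerDl.
  by rewrite (_ : 2 / s + (2 / s - 2 / s * (2 / s) * s) = 0) ?scale0r ?subr0 //; field.
rewrite rowE -/e /K mulmxBr mulmx1 -scalemxAr mulmxA [e *m v^T]mx11_scalar ev.
rewrite mul_scalar_mx scalerA.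
have -> : 2 / s * (1 - u 0 0) = 1.
  by move: vv0; rewrite vv => h; field; apply: contra_neq h => ->; rewrite mulr0.
by rewrite scale1r vdef.
Qed.

(** Deflation: in a frame whose first row is an eigenvector, symmetry splits off a block of size 1,
    and induction treats the other block. *)
Lemma symmetric_spectral n (M : 'M[R]_n) : M^T = M ->
  exists (k : 'M[R]_n) (y : 'rV[R]_n), k *m k^T = 1%:M /\ M = k^T *m diag_mx y *m k.
Proof.
elim: n M => [|n IH] M Msym.
  by exists 1%:M, 0; split; apply/matrixP => -[].
have [u [a [u1 uM]]] := symmetric_eigenvector Msym.
have [K [KK Ku]] := householder u1.
have KK' : K^T *m K = 1%:M by exact: mulmx1C.
pose N : 'M[R]_(1 + n) := K *m M *m K^T.
have NT : N^T = N by rewrite /N !trmx_mul trmxK Msym mulmxA.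
have N0 : row 0 N = a *: delta_mx 0 0.
  by rewrite /N !row_mul Ku uM -scalemxAl -Ku -row_mul KK row1.
have Nur : ursubmx N = 0.
  apply/rowP => j; rewrite !mxE /=; move/rowP: N0 => /(_ (rshift 1 j)).
  rewrite !mxE /= (_ : lshift n 0 = 0); last exact/val_inj.
  by move=> ->; rewrite mulr0.
have Ndl : dlsubmx N = 0 by rewrite -[N]NT -[LHS]trmxK trmx_dlsub trmxK Nur trmx0.
have [|k [y [kk Nk]]] := IH (drsubmx N); first by rewrite trmx_drsub NT.
pose K1 : 'M[R]_(1 + n) := block_mx 1%:M 0 0 k.
have K1T : K1^T = block_mx 1%:M 0 0 k^T by rewrite tr_block_mx trmx1 !trmx0.
have K11 : K1 *m K1^T = 1%:M.
  by rewrite K1T mulmx_block !(mulmx0,mul0mx,mulmx1,addr0,add0r) kk -scalar_mx_block.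
have NE : N = K1^T *m diag_mx (row_mx (ulsubmx N) y) *m K1.
  rewrite -[LHS]submxK Nur Ndl Nk K1T.
  rewrite (_ : diag_mx _ = block_mx (ulsubmx N) 0 0 (diag_mx y)).
    by rewrite !mulmx_block !(mulmx0,mul0mx,mulmx1,mul1mx,addr0,add0r).
  rewrite diag_mx_row; congr block_mx.
  by rewrite [RHS]mx11_scalar; apply/matrixP => i j; rewrite !mxE !ord1.
exists (K1 *m K), (row_mx (ulsubmx N) y); split.
  by rewrite trmx_mul mulmxA -(mulmxA K1) KK mulmx1.
rewrite trmx_mul -!mulmxA (mulmxA (diag_mx _)) (mulmxA K1^T) (mulmxA K1^T) -NE.
by rewrite /N !mulmxA KK' mul1mx -!mulmxA KK' mulmx1.
Qed.

End RealMatrices.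

Section PositiveDefinite.
Variable R : realType.

Definition orthonormal k (K : 'M[R]_k) : Prop := K *m K^T = 1%:M.

Definition expdiag k (K : 'M[R]_k) (y : 'rV[R]_k) : 'M[R]_k :=
  K^T *m diag_mx (map_mx expR y) *m K.

Lemma orthonormal_trK k (K : 'M[R]_k) : orthonormal K -> K^T *m K = 1%:M.
Proof. exact: mulmx1C. Qed.

Lemma orthonormal_unit k (K : 'M[R]_k) : orthonormal K -> K \in unitmx.
Proof. by move=> /mulmx1_unit[]. Qed.

Lemma quad_diag k (y : 'rV[R]_k) (u : 'cV[R]_k) :
  (u^T *m diag_mx y *m u) 0 0 = \sum_i y 0 i * u i 0 ^+ 2.
Proof.
rewrite mxE; apply: eq_bigr => i _.
by rewrite mul_mx_diag !mxE; ring.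
Qed.

(** Positivity only needs [A] to be injective, hence a left inverse and rectangular shapes: this
    covers changes of basis as well as restriction to a diagonal block. *)
Lemma posdef_congr k l (H : 'M[R]_k) (A : 'M[R]_(k, l)) (B : 'M[R]_(l, k)) :
  posdef H -> B *m A = 1%:M -> posdef (A^T *m H *m A).
Proof.
move=> [Hsym Hpos] BA; split; first by rewrite !trmx_mul trmxK Hsym mulmxA.
move=> u u0; have := Hpos (A *m u); rewrite trmx_mul !mulmxA; apply.
apply: contra_neq u0 => Au; by rewrite -[u]mul1mx -BA -mulmxA Au mulmx0.
Qed.

Lemma posdef_diag k (y : 'rV[R]_k) : (forall i, 0 < y 0 i) -> posdef (diag_mx y).
Proof.
move=> y0; split; first by rewrite tr_diag_mx.
move=> u u0; rewrite quad_diag lt_neqAle.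
have sq i : 0 <= y 0 i * u i 0 ^+ 2 by rewrite mulr_ge0 ?sqr_ge0 // ltW.
rewrite sumr_ge0 // andbT; apply: contra_neq u0 => /esym/eqP.
rewrite psumr_eq0 // => /allP h; apply/colP => i; rewrite mxE.
have := h i (mem_index_enum _); rewrite mulf_eq0 gt_eqF //= sqrf_eq0.
by move=> /eqP.
Qed.

Lemma posdef1 k : posdef (1%:M : 'M[R]_k).
Proof.
rewrite -diag_const_mx; apply: posdef_diag => i; by rewrite mxE.
Qed.

Lemma posdef_expdiag k (K : 'M[R]_k) y : orthonormal K -> posdef (expdiag K y).
Proof.
move=> KK; apply: (@posdef_congr _ _ _ _ K^T); last exact: orthonormal_trK.
by apply: posdef_diag => i; rewrite mxE expR_gt0.
Qed.

Lemma posdef_expdiagP k (H : 'M[R]_k) : posdef H ->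
  exists (K : 'M[R]_k) (y : 'rV[R]_k), orthonormal K /\ H = expdiag K y.
Proof.
move=> [Hsym Hpos]; have [K [y [KK HE]]] := symmetric_spectral Hsym.
exists K, (map_mx (@ln R) y); split => //.
rewrite /expdiag -map_mx_comp HE; congr (_ *m diag_mx _ *m _).
apply/rowP => i; rewrite !mxE /= lnK // posrE.
(* The i-th eigenvalue is the value of the form at the i-th column of [K^T], hence positive, and its
   logarithm is legitimate. *)
have := Hpos (K^T *m delta_mx i 0); rewrite HE trmx_mul trmxK !mulmxA.
rewrite -(mulmxA _ K) KK mulmx1 -!mulmxA (mulmxA K) KK mul1mx mulmxA quad_diag.
rewrite (bigD1 i) //= big1 ?addr0 => [|j ji]; last first.
  by rewrite !mxE (negbTE ji) expr0n mulr0.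
rewrite !mxE !eqxx expr1n mulr1; apply.
apply/eqP => /(congr1 (mulmx K)); rewrite mulmxA KK mul1mx mulmx0 => /colP/(_ i).
by rewrite !mxE !eqxx => /eqP; rewrite oner_eq0.
Qed.

Lemma invmx_expdiag k (K : 'M[R]_k) y : orthonormal K ->
  expdiag K y *m expdiag K (- y) = 1%:M.
Proof.
move=> KK; rewrite /expdiag !mulmxA -(mulmxA _ K) KK mulmx1 -(mulmxA K^T).
rewrite mulmx_diag (_ : diag_mx _ = 1%:M) ?mulmx1 ?orthonormal_trK //.
rewrite -diag_const_mx; congr diag_mx; apply/rowP => i.
by rewrite !mxE -expRD subrr expR0.
Qed.

Lemma expdiag_unit k (K : 'M[R]_k) y : orthonormal K -> expdiag K y \in unitmx.
Proof. by move=> /(invmx_expdiag y)/mulmx1_unit[]. Qed.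

Lemma invmx_expdiagE k (K : 'M[R]_k) y : orthonormal K ->
  invmx (expdiag K y) = expdiag K (- y).
Proof.
move=> KK; rewrite -[LHS]mulmx1 -(invmx_expdiag y KK) mulKmx //.
exact: expdiag_unit.
Qed.

Lemma det_expdiag k (K : 'M[R]_k) y : orthonormal K ->
  \det (expdiag K y) = expR (\sum_i y 0 i).
Proof.
move=> KK; rewrite !det_mulmx det_tr mulrAC -{1}(det_tr K) -det_mulmx.
rewrite orthonormal_trK // det1 mul1r det_diag.
rewrite expR_sum; by apply: eq_bigr => i _; rewrite mxE.
Qed.

Lemma posdef_unit k (H : 'M[R]_k) : posdef H -> H \in unitmx.
Proof. by move=> /posdef_expdiagP[K [y [KK ->]]]; exact: expdiag_unit. Qed.

Lemma posdef_det_gt0 k (H : 'M[R]_k) : posdef H -> 0 < \det H.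
Proof.
by move=> /posdef_expdiagP[K [y [KK ->]]]; rewrite det_expdiag // expR_gt0.
Qed.

Lemma posdef_inv k (H : 'M[R]_k) : posdef H -> posdef (invmx H).
Proof.
move=> /posdef_expdiagP[K [y [KK ->]]]; rewrite invmx_expdiagE //.
exact: posdef_expdiag.
Qed.

Lemma posdef_gram k (A : 'M[R]_k) : A \in unitmx -> posdef (A^T *m A).
Proof.
move=> Au; rewrite -[A^T]mulmx1.
by apply: (@posdef_congr _ _ _ _ (invmx A)); [exact: posdef1|exact: mulVmx].
Qed.

Lemma posdef_gramP k (H : 'M[R]_k) : posdef H ->
  exists2 A : 'M[R]_k, A \in unitmx & H = A^T *m A.
Proof.
move=> /posdef_expdiagP[K [y [KK ->]]].
pose D : 'M[R]_k := diag_mx (map_mx (fun x => expR (x / 2)) y).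
exists (D *m K).
  rewrite unitmx_mul (orthonormal_unit KK) andbT unitmxE unitfE det_diag.
  by apply/prodf_neq0 => i _; rewrite mxE gt_eqF ?expR_gt0.
rewrite trmx_mul tr_diag_mx !mulmxA -(mulmxA K^T) mulmx_diag.
congr (_ *m diag_mx _ *m _); apply/rowP => i.
by rewrite !mxE -expRD -splitr.
Qed.

Lemma tr_gram m n (B : 'M[R]_(m, n)) : \tr (B^T *m B) = \sum_i \sum_j B i j ^+ 2.
Proof.
rewrite exchange_big; apply: eq_bigr => j _; rewrite mxE.
by apply: eq_bigr => i _; rewrite mxE expr2.
Qed.

Lemma tr_gram_ge0 m n (B : 'M[R]_(m, n)) : 0 <= \tr (B^T *m B).
Proof. by rewrite tr_gram !sumr_ge0 // => i _; rewrite sumr_ge0 // => j _; rewrite sqr_ge0. Qed.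

Lemma tr_gram_eq0 m n (B : 'M[R]_(m, n)) : \tr (B^T *m B) = 0 -> B = 0.
Proof.
rewrite tr_gram => /eqP; rewrite psumr_eq0; last first.
  by move=> i _; rewrite sumr_ge0 // => j _; rewrite sqr_ge0.
move=> /allP h; apply/matrixP => i j; have := h i (mem_index_enum _).
rewrite /= psumr_eq0; last by move=> k _; rewrite sqr_ge0.
by move=> /allP /(_ j (mem_index_enum _)); rewrite /= sqrf_eq0 mxE => /eqP.
Qed.

Lemma tr_expdiag k (K : 'M[R]_k) y : orthonormal K ->
  \tr (expdiag K y) = \sum_i expR (y 0 i).
Proof.
move=> KK; rewrite mxtrace_mulC mulmxA KK mul1mx mxtrace_diag.
by apply: eq_bigr => i _; rewrite mxE.
Qed.

(** One instance of 1 + y <= e^y for each eigenvalue e^y. *)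
Lemma trace_ge_ln_det k (H : 'M[R]_k) : posdef H -> k%:R + ln (\det H) <= \tr H.
Proof.
move=> /posdef_expdiagP[K [y [KK ->]]].
rewrite tr_expdiag // det_expdiag // expRK.
rewrite -[k in k%:R]card_ord -sumr_const -big_split /=.
by apply: ler_sum => i _; exact: expR_ge1Dx.
Qed.

(** Gram factors of [H1] and of the inverse of [H2] turn the trace into a squared Frobenius norm,
    which is nonnegative and vanishes only for X = 0. *)
Lemma tr_posdef_form m n (H1 : 'M[R]_m) (H2 : 'M[R]_n) : posdef H1 -> posdef H2 ->
  exists A B, [/\ A \in unitmx, B \in unitmx &
   forall X : 'M[R]_(m, n), \tr (X^T *m H1 *m X *m invmx H2) =
     \tr ((A *m X *m B)^T *m (A *m X *m B))].
Proof.
move=> /posdef_gramP[A Au ->] /posdef_inv/posdef_gramP[B Bu ->].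
exists A, B^T; split => //; first by rewrite unitmx_tr.
move=> X; rewrite !trmx_mul trmxK mulmxA mxtrace_mulC !mulmxA.
by rewrite -!mulmxA mxtrace_mulC !mulmxA.
Qed.

Lemma tr_posdef_form_ge0 m n (H1 : 'M[R]_m) (H2 : 'M[R]_n) (X : 'M[R]_(m, n)) :
  posdef H1 -> posdef H2 -> 0 <= \tr (X^T *m H1 *m X *m invmx H2).
Proof.
move=> p1 p2; have [A [B [_ _ ->]]] := tr_posdef_form p1 p2; exact: tr_gram_ge0.
Qed.

Lemma tr_posdef_form_eq0 m n (H1 : 'M[R]_m) (H2 : 'M[R]_n) (X : 'M[R]_(m, n)) :
  posdef H1 -> posdef H2 -> \tr (X^T *m H1 *m X *m invmx H2) = 0 -> X = 0.
Proof.
move=> p1 p2; have [A [B [Au Bu ->]]] := tr_posdef_form p1 p2.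
move=> /tr_gram_eq0/(congr1 (fun Z => invmx A *m Z *m invmx B)).
by rewrite -!mulmxA mulKmx // mulmxV // mulmx1 mul0mx mulmx0.
Qed.

Lemma posdef_ulsubmx m n (H : 'M[R]_(m + n)) : posdef H -> posdef (ulsubmx H).
Proof.
move=> Hp; have := @posdef_congr _ _ _ (col_mx 1%:M 0) (row_mx 1%:M 0) Hp.
rewrite mul_row_col mulmx1 mulmx0 addr0 => /(_ erefl).
rewrite -{1}[H]submxK tr_col_mx trmx1 trmx0 mul_row_block mul_row_col.
by rewrite !(mul1mx, mul0mx, mulmx1, mulmx0, addr0).
Qed.

Lemma posdef_drsubmx m n (H : 'M[R]_(m + n)) : posdef H -> posdef (drsubmx H).
Proof.
move=> Hp; have := @posdef_congr _ _ _ (col_mx 0 1%:M) (row_mx 0 1%:M) Hp.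
rewrite mul_row_col mulmx1 mulmx0 add0r => /(_ erefl).
rewrite -{1}[H]submxK tr_col_mx trmx1 trmx0 mul_row_block mul_row_col.
by rewrite !(mul1mx, mul0mx, mulmx1, mulmx0, addr0, add0r).
Qed.

Lemma posdef_block m n (H1 : 'M[R]_m) (H2 : 'M[R]_n) :
  posdef H1 -> posdef H2 -> posdef (block_mx H1 0 0 H2).
Proof.
move=> [s1 p1] [s2 p2]; split; first by rewrite tr_block_mx s1 s2 !trmx0.
move=> u; rewrite -[u]vsubmxK; set a := usubmx u; set b := dsubmx u => ab0.
rewrite tr_col_mx mul_row_block mul_row_col !mulmx0 addr0 add0r mxE.
have ge0 k (H : 'M[R]_k) (z : 'cV_k) : (forall u : 'cV_k, u != 0 -> 0 < (u^T *m H *m u) 0 0) ->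
    0 <= (z^T *m H *m z) 0 0.
  by move=> h; have [->|z0] := eqVneq z 0; [rewrite mulmx0 mxE|apply: ltW; exact: h].
have [a0|a0] := eqVneq a 0; last by rewrite ltr_pwDl ?p1 ?ge0.
rewrite ltr_wpDl ?ge0 // p2 //; apply: contra_neq ab0 => ->.
by rewrite a0 col_mx0.
Qed.

Lemma unipotent_unit m n (K : 'M[R]_(m, n)) :
  (block_mx 1%:M K 0 1%:M \in unitmx) /\
  invmx (block_mx 1%:M K 0 1%:M) = block_mx 1%:M (- K) 0 1%:M.
Proof.
have E : block_mx 1%:M K 0 1%:M *m block_mx 1%:M (- K) 0 1%:M = 1%:M :> 'M[R]_(m + n).
  rewrite mulmx_block !(mulmx1, mul1mx, mulmx0, mul0mx, addr0, add0r).
  by rewrite addNr -scalar_mx_block.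
have [u _] := mulmx1_unit E; split => //.
by rewrite -[RHS](mulKmx u) E mulmx1.
Qed.

(** Block elimination: [K] is the inverse of the upper left block times the upper right one, which
    clears the off-diagonal blocks; the new lower right block is the Schur complement. *)
Lemma posdef_schur m n (H : 'M[R]_(m + n)) : posdef H ->
  exists (K : 'M[R]_(m, n)) (H1 : 'M[R]_m) (H2 : 'M[R]_n),
  [/\ posdef H1, posdef H2 & H = (block_mx 1%:M K 0 1%:M)^T *m
     block_mx H1 0 0 H2 *m block_mx 1%:M K 0 1%:M].
Proof.
move=> Hp; pose H1 := ulsubmx H; have p1 := posdef_ulsubmx Hp.
pose K := invmx H1 *m ursubmx H; pose U : 'M[R]_(m + n) := block_mx 1%:M K 0 1%:M.
have [Uu UV] := unipotent_unit K; rewrite -/U in Uu UV.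
pose G := (invmx U)^T *m H *m invmx U.
have Gp : posdef G by apply: (@posdef_congr _ _ _ _ U) => //; exact: mulmxV.
have HG : H = U^T *m G *m U.
  by rewrite /G !mulmxA -trmx_mul mulVmx // trmx1 mul1mx mulmxKV.
have Gul : ulsubmx G = H1.
  rewrite /G UV -[H]submxK tr_block_mx trmx1 trmx0 !mulmx_block block_mxKul.
  by rewrite !(mul1mx, mul0mx, mulmx1, mulmx0, addr0).
have Gur : ursubmx G = 0.
  rewrite /G UV -[H]submxK tr_block_mx trmx1 trmx0 !mulmx_block block_mxKur.
  rewrite !(mul1mx, mul0mx, mulmx1, mulmx0, addr0, add0r).
  by rewrite mulmxN /K mulmxA mulmxV ?mul1mx ?addNr // posdef_unit.
have Gdl : dlsubmx G = 0 by rewrite -[G](proj1 Gp) -trmx_ursub Gur trmx0.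
exists K, H1, (drsubmx G); split => //; first exact: posdef_drsubmx.
by rewrite [LHS]HG -{1}[G]submxK Gul Gur Gdl.
Qed.

End PositiveDefinite.

(** * The Kempf-Ness functional *)

Lemma dependent_choice_fun (T : Type) (U : T -> Type) (P : forall x, U x -> Prop) :
  (forall x, exists y, P x y) -> exists f, forall x, P x (f x).
Proof. by move=> h; exists (fun x => projT1 (cid (h x))) => x; exact: (projT2 (cid (h x))). Qed.

(** From e^(-u) >= 1 - u one gets e^u <= 1/(1 - u), and (1 + u + 2u^2)(1 - u) - 1 = u^2 (1 - 2u) is
    nonnegative in this range. *)
Lemma expR_le_quadratic (R : realType) (u : R) :
  `|u| <= 2^-1 -> expR u <= 1 + u + 2 * u ^+ 2.
Proof.
rewrite ler_norml => /andP[u1 u2].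
have h : 0 < 1 - u by lra.
rewrite -[expR u]invrK -expRN; apply: (@le_trans _ _ (1 - u)^-1).
  by rewrite lef_pV2 ?posrE ?expR_gt0 //; exact: expR_ge1Dx.
rewrite -[leLHS]mul1r ler_pdivrMr // -subr_ge0.
rewrite (_ : _ - 1 = u ^+ 2 * (1 - 2 * u)); last by ring.
by rewrite mulr_ge0 ?sqr_ge0 //; lra.
Qed.

(** The derivative vanishes at the minimum t = 0. [M] dominates every |x i|, so the quadratic bound
    on the exponential holds for |t| <= 1/(2M) and reduces the claim to [first_order_condition]. *)
Lemma exp_sum_first_order (R : realType) (I : finType) (q x : I -> R) (b : R) :
  (forall i, 0 <= q i) ->
  (forall t, \sum_i q i <= \sum_i q i * expR (t * x i) + t * b) ->
  \sum_i q i * x i + b = 0.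
Proof.
move=> q0 H; pose M := 1 + \sum_i `|x i|.
have M0 : 0 < M by rewrite ltr_pwDl // sumr_ge0.
have xM i : `|x i| <= M.
  by rewrite /M (bigD1 i) //= addrCA lerDl addr_ge0 // sumr_ge0.
apply: (@first_order_condition _ (2^-1 / M) _ (\sum_i q i * (2 * x i ^+ 2))).
  by rewrite divr_gt0.
move=> t tM; have := H t.
have : \sum_i q i * expR (t * x i) <=
    \sum_i q i + t * \sum_i q i * x i + t ^+ 2 * \sum_i q i * (2 * x i ^+ 2).
  rewrite !mulr_sumr -!big_split /=; apply: ler_sum => i _.
  rewrite (_ : _ + _ = q i * (1 + t * x i + 2 * (t * x i) ^+ 2)); last by ring.
  rewrite ler_wpM2l // expR_le_quadratic // normrM.
  have : `|t| * M <= 2^-1 by rewrite -ler_pdivlMr.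
  by apply: le_trans; rewrite ler_wpM2l.
by lra.
Qed.

Section KempfNess.
Variables (R : realType) (Q : quiver) (w : arrow Q -> R) (th : vertex Q -> R).
Hypothesis w_gt0 : forall a, 0 < w a.
Implicit Types d : dimvec Q.

(* Kempf-Ness functional: for H = A^T A it equals ||A.V||^2 plus the logarithm of a
   character of A, the squared norm being weighted by w. *)
Definition kn d (V : rep R d) (H : forall x : vertex Q, 'M[R]_(d x)) : R :=
  \sum_a w a * \tr ((V a)^T *m H (hd a) *m V a *m invmx (H (tl a)))
  + \sum_x th x * ln (\det (H x)).

Definition rep_norm d (V : rep R d) : R := \sum_a w a * \tr ((V a)^T *m V a).

Definition posdefs d (H : forall x : vertex Q, 'M[R]_(d x)) : Prop :=
  forall x, posdef (H x).

(** Logarithm of the squared absolute value of the character with real exponents [th]; squaring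
    accommodates determinants of either sign. *)
Definition log_char d (A : forall x : vertex Q, 'M[R]_(d x)) : R :=
  \sum_x th x * ln (\det (A x) ^+ 2).

(* Derivative of kn V at the identity in the symmetric direction S. *)
Definition moment d (V : rep R d) (S : forall x : vertex Q, 'M[R]_(d x)) : R :=
  \sum_a w a * (\tr ((V a)^T *m S (hd a) *m V a) - \tr ((V a)^T *m V a *m S (tl a)))
  + \sum_x th x * \tr (S x).

(** The zero locus of the moment map, tested against symmetric directions; for the bipartite weights
    it consists of the geometric data. *)
Definition moment_zero d (V : rep R d) : Prop :=
  forall S, (forall x, (S x)^T = S x) -> moment V S = 0.

Definition kn_min d (V : rep R d) (H : forall x : vertex Q, 'M[R]_(d x)) : Prop :=
  posdefs H /\ forall H', posdefs H' -> kn V H <= kn V H'.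

(** A single index type for the entries of all arrows makes the functional one finite sum of
    exponentials. *)
Definition matrix_entry d : finType :=
  {a : arrow Q & ('I_(d (hd a)) * 'I_(d (tl a)))%type}.

Definition slope d (y : forall x : vertex Q, 'rV[R]_(d x)) (z : matrix_entry d) : R :=
  y (hd (tag z)) 0 (tagged z).1 - y (tl (tag z)) 0 (tagged z).2.

Definition linear_part d (y : forall x : vertex Q, 'rV[R]_(d x)) : R :=
  \sum_x th x * \sum_i y x 0 i.

Definition entry_weight d (V : rep R d) (z : matrix_entry d) : R :=
  w (tag z) * V (tag z) (tagged z).1 (tagged z).2 ^+ 2.

Lemma sum_matrix_entry d (F : forall a, 'I_(d (hd a)) -> 'I_(d (tl a)) -> R) :
  \sum_a \sum_r \sum_s F a r s =
  \sum_(z : matrix_entry d) F (tag z) (tagged z).1 (tagged z).2.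
Proof.
under eq_bigr do rewrite pair_bigA /=.
by rewrite (sig_big_dep xpredT (fun _ => xpredT) (fun a rs => F a rs.1 rs.2)).
Qed.

Lemma entry_weight_ge0 d (V : rep R d) z : 0 <= entry_weight V z.
Proof. by rewrite mulr_ge0 ?sqr_ge0 // ltW. Qed.

Definition rotate d (K : forall x : vertex Q, 'M[R]_(d x)) (V : rep R d) : rep R d :=
  fun a => K (hd a) *m V a *m (K (tl a))^T.

Lemma kn1 d (V : rep R d) : kn V (fun=> 1%:M) = rep_norm V.
Proof.
rewrite /kn [X in _ + X]big1 ?addr0 => [|x _]; last by rewrite det1 ln1 mulr0.
by apply: eq_bigr => a _; rewrite invmx1 !mulmx1.
Qed.

Lemma posdefs_expdiagP d (H : forall x : vertex Q, 'M[R]_(d x)) : posdefs H ->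
  exists (K : forall x, 'M[R]_(d x)) (y : forall x, 'rV[R]_(d x)),
    (forall x, orthonormal (K x)) /\ H = fun x => expdiag (K x) (y x).
Proof.
move=> Hp; have h x := posdef_expdiagP (Hp x).
have [K hK] := dependent_choice_fun h; have [y hy] := dependent_choice_fun hK.
exists K, y; split => [x|]; first by have [] := hy x.
by apply/functional_extensionality_dep => x; have [] := hy x.
Qed.

Lemma posdefs_gramP d (H : forall x : vertex Q, 'M[R]_(d x)) : posdefs H ->
  exists2 A : forall x, 'M[R]_(d x), GL A & H = fun x => (A x)^T *m A x.
Proof.
move=> Hp; have h x : exists A : 'M[R]_(d x), A \in unitmx /\ H x = A^T *m A.
  by have [A] := posdef_gramP (Hp x); exists A.
have [A hA] := dependent_choice_fun h.
exists A => [x|]; first by have [] := hA x.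
by apply/functional_extensionality_dep => x; have [] := hA x.
Qed.

Lemma tr_weighted_gram m n (D : 'rV[R]_m) (E : 'rV[R]_n) (B : 'M[R]_(m, n)) :
  \tr (B^T *m diag_mx D *m B *m diag_mx E) =
  \sum_r \sum_s B r s ^+ 2 * (D 0 r * E 0 s).
Proof.
rewrite exchange_big; apply: eq_bigr => s _; rewrite mul_mx_diag !mxE mulr_suml.
apply: eq_bigr => r _; rewrite mul_mx_diag !mxE; ring.
Qed.

Section Rotated.
Variables (d : dimvec Q) (V : rep R d).
Variables (K : forall x : vertex Q, 'M[R]_(d x)) (y : forall x : vertex Q, 'rV[R]_(d x)).
Hypothesis KK : forall x, orthonormal (K x).

Lemma rotateK a : V a = (K (hd a))^T *m rotate K V a *m K (tl a).
Proof.
rewrite /rotate !mulmxA orthonormal_trK // mul1mx -mulmxA.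
by rewrite orthonormal_trK // mulmx1.
Qed.

Lemma tr_rotate a (D E : forall x, 'M[R]_(d x)) :
  \tr ((V a)^T *m ((K (hd a))^T *m D (hd a) *m K (hd a)) *m V a *m
    ((K (tl a))^T *m E (tl a) *m K (tl a))) =
  \tr ((rotate K V a)^T *m D (hd a) *m rotate K V a *m E (tl a)).
Proof.
rewrite /rotate !trmx_mul trmxK.
rewrite -!mulmxA [RHS]mxtrace_mulC -!mulmxA.
do !congr mxtrace; by rewrite !mulmxA.
Qed.

Lemma kn_expdiag : kn V (fun x => expdiag (K x) (y x)) =
  \sum_z entry_weight (rotate K V) z * expR (slope y z) + linear_part y.
Proof.
congr (_ + _); last first.
  by apply: eq_bigr => x _; rewrite det_expdiag // expRK.
rewrite -(sum_matrix_entry (fun a r s => w a * rotate K V a r s ^+ 2 *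
  expR (y (hd a) 0 r - y (tl a) 0 s))); apply: eq_bigr => a _.
rewrite invmx_expdiagE //.
rewrite (tr_rotate a (fun x => diag_mx (map_mx expR (y x)))
                     (fun x => diag_mx (map_mx expR (- y x)))).
rewrite tr_weighted_gram mulr_sumr; apply: eq_bigr => r _; rewrite mulr_sumr.
by apply: eq_bigr => s _; rewrite !mxE expRD mulrA.
Qed.

Lemma moment_diag : moment V (fun x => (K x)^T *m diag_mx (y x) *m K x) =
  \sum_z entry_weight (rotate K V) z * slope y z + linear_part y.
Proof.
congr (_ + _); last first.
  by apply: eq_bigr => x _; rewrite mxtrace_mulC mulmxA KK mul1mx mxtrace_diag.
rewrite -(sum_matrix_entry (fun a r s => w a * rotate K V a r s ^+ 2 *
  (y (hd a) 0 r - y (tl a) 0 s))); apply: eq_bigr => a _.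
have h1 := tr_rotate a (fun x => diag_mx (y x)) (fun x => 1%:M).
have h2 := tr_rotate a (fun x => 1%:M) (fun x => diag_mx (y x)).
rewrite !mulmx1 !orthonormal_trK // !mulmx1 in h1 h2; rewrite h1 h2.
rewrite -(mulmx1 ((rotate K V a)^T *m _ *m _)) -[X in _ *m X]diag_const_mx.
rewrite -[X in _ - \tr (X *m _ *m _)]mulmx1 -[X in _ - \tr (_ *m X *m _ *m _)]diag_const_mx.
rewrite !tr_weighted_gram -sumrB mulr_sumr; apply: eq_bigr => r _.
rewrite -sumrB mulr_sumr; apply: eq_bigr => s _.
by rewrite !mxE; ring.
Qed.

Lemma rep_norm_rotate : rep_norm V = \sum_z entry_weight (rotate K V) z.
Proof.
rewrite -(sum_matrix_entry (fun a r s => w a * rotate K V a r s ^+ 2)).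
apply: eq_bigr => a _; have := tr_rotate a (fun x => 1%:M) (fun x => 1%:M).
rewrite !mulmx1 !orthonormal_trK // !mulmx1 => ->.
by rewrite tr_gram mulr_sumr; apply: eq_bigr => r _; rewrite mulr_sumr.
Qed.

End Rotated.

Lemma moment_zero_slope d (V : rep R d) K y : moment_zero V ->
  (forall x, orthonormal (K x)) ->
  linear_part y = - \sum_z entry_weight (rotate K V) z * slope y z.
Proof.
move=> V0 KK; have := V0 (fun x => (K x)^T *m diag_mx (y x) *m K x).
rewrite moment_diag // => /(_ _)/wrap[x|/eqP].
  by rewrite !trmx_mul trmxK tr_diag_mx mulmxA.
by rewrite addrC addr_eq0 => /eqP.
Qed.

(** Once the linear part is traded for minus the weighted slopes, the claim is e^s - s >= 1, entry
    by entry. *)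
Lemma moment_zero_kn_ge d (V : rep R d) H :
  moment_zero V -> posdefs H -> rep_norm V <= kn V H.
Proof.
move=> V0 /posdefs_expdiagP[K [y [KK ->]]].
rewrite kn_expdiag // (moment_zero_slope _ V0 KK) (rep_norm_rotate V KK).
rewrite -sumrB; apply: ler_sum => z _; rewrite -mulrBr ler_peMr //.
  exact: entry_weight_ge0.
by rewrite lerBrDr expR_ge1Dx.
Qed.

(** Diagonalising the symmetric direction gives a frame and a ray of logarithms; along that ray the
    functional is a sum of exponentials with a minimum at t = 0. *)
Lemma kn_ge_moment_zero d (V : rep R d) :
  (forall H, posdefs H -> rep_norm V <= kn V H) -> moment_zero V.
Proof.
move=> Vmin S Ssym; have h x := symmetric_spectral (Ssym x).
have [K hK] := dependent_choice_fun h; have [y hy] := dependent_choice_fun hK.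
have KK x : orthonormal (K x) by have [] := hy x.
have -> : S = fun x => (K x)^T *m diag_mx (y x) *m K x.
  by apply/functional_extensionality_dep => x; have [] := hy x.
rewrite moment_diag //; apply: exp_sum_first_order => [z|t].
  exact: entry_weight_ge0.
rewrite -(rep_norm_rotate V KK).
have /Vmin : posdefs (fun x => expdiag (K x) (t *: y x)).
  by move=> x; exact: posdef_expdiag.
rewrite kn_expdiag //; congr (_ <= _ + _).
  by apply: eq_bigr => z _; congr (_ * expR _); rewrite /slope !mxE mulrBr.
rewrite mulr_sumr; apply: eq_bigr => x _; rewrite [RHS]mulrCA [in RHS]mulr_sumr; congr (_ * _).
by apply: eq_bigr => i _; rewrite mxE.
Qed.

(** Equality in e^s - s >= 1 forces s = 0 wherever the weight is nonzero. So in the eigenframe of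
    [H] nonzero entries of [V] only join equal eigenvalues, which is the intertwining relation. *)
Lemma kn_eq_norm_commute d (V : rep R d) H : moment_zero V -> posdefs H ->
  kn V H = rep_norm V -> forall a, H (hd a) *m V a = V a *m H (tl a).
Proof.
move=> V0 /posdefs_expdiagP[K [y [KK ->]]].
rewrite kn_expdiag // (moment_zero_slope _ V0 KK) (rep_norm_rotate V KK).
pose F z := entry_weight (rotate K V) z * (expR (slope y z) - slope y z - 1).
have F0 z : 0 <= F z.
  rewrite mulr_ge0 ?entry_weight_ge0 //.
  by rewrite -addrA -opprD subr_ge0 addrC expR_ge1Dx.
move/eqP; rewrite -subr_eq0 -!sumrB => sF.
have {}sF : \sum_z F z == 0.
  by rewrite -[X in _ == X](eqP sF); apply/eqP; apply: eq_bigr => z _; rewrite /F; ring.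
have Fz (a : arrow Q) (r : 'I_(d (hd a))) (s : 'I_(d (tl a))) :
    F (Tagged (fun a => ('I_(d (hd a)) * 'I_(d (tl a)))%type) (r, s)) = 0 :> R.
  move: sF; rewrite psumr_eq0 // => /allP/(_ (Tagged _ (r, s)) (mem_index_enum _)).
  by move=> /eqP.
move=> a; rewrite (rotateK V KK a) /expdiag.
have {}Fz := Fz a; rewrite /F /entry_weight /slope /= in Fz.
move: (rotate K V a) Fz => B Fz.
rewrite -!mulmxA (mulmxA (K (hd a))) KK mul1mx.
rewrite (mulmxA (K (tl a))) KK mul1mx; congr (_ *m _); rewrite !mulmxA; congr (_ *m _).
apply/matrixP => r s; rewrite mul_diag_mx mul_mx_diag !mxE.
have /eqP := Fz r s; rewrite mulf_eq0 mulf_eq0 gt_eqF //= sqrf_eq0.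
move=> /orP[/eqP ->|]; first by rewrite mulr0 mul0r.
have [e|ne] := eqVneq (y (hd a) 0 r - y (tl a) 0 s) 0.
  by move/eqP: e; rewrite subr_eq0 => /eqP ->; rewrite mulrC.
have := expR_gt1Dx ne; rewrite -subr_gt0 => h /eqP e.
by move: h; rewrite opprD addrA addrAC e ltxx.
Qed.

End KempfNess.

Lemma invmx_mul (R : comUnitRingType) n (A B : 'M[R]_n) :
  A \in unitmx -> B \in unitmx -> invmx (A *m B) = invmx B *m invmx A.
Proof.
move=> Au Bu; have ABu : A *m B \in unitmx by rewrite unitmx_mul Au.
by rewrite -[RHS](mulKmx ABu) [A *m B *m _]mulmxA mulmxK // mulmxV // mulmx1.
Qed.

(** * Change of basis and transport of minimisers *)

Section Action.
Variables (R : realType) (Q : quiver) (w : arrow Q -> R) (th : vertex Q -> R).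
Hypothesis w_gt0 : forall a, 0 < w a.
Implicit Types d : dimvec Q.
Local Notation kn := (kn w th).
Local Notation rep_norm := (rep_norm w).
Local Notation log_char := (log_char th).
Local Notation moment_zero := (moment_zero w th).
Local Notation kn_min := (kn_min w th).

Lemma act_comp d (A B : forall x : vertex Q, 'M[R]_(d x)) (V : rep R d) :
  GL A -> GL B -> act A (act B V) = act (fun x => A x *m B x) V.
Proof.
move=> Au Bu; apply/functional_extensionality_dep => a; rewrite /act.
by rewrite invmx_mul ?Au ?Bu // !mulmxA.
Qed.

Lemma act1 d (V : rep R d) : act (fun=> 1%:M) V = V.
Proof.
by apply/functional_extensionality_dep => a; rewrite /act invmx1 mulmx1 mul1mx.
Qed.

Lemma GL_mul d (A B : forall x : vertex Q, 'M[R]_(d x)) :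
  GL A -> GL B -> GL (fun x => A x *m B x).
Proof. by move=> Au Bu x; rewrite unitmx_mul Au Bu. Qed.

Lemma GL_inv d (A : forall x : vertex Q, 'M[R]_(d x)) :
  GL A -> GL (fun x => invmx (A x)).
Proof. by move=> Au x; rewrite unitmx_inv. Qed.

Lemma actK d (A : forall x : vertex Q, 'M[R]_(d x)) (V : rep R d) : GL A ->
  act (fun x => invmx (A x)) (act A V) = V.
Proof.
move=> Au; rewrite act_comp //; last exact: GL_inv.
rewrite -[RHS]act1; congr act; apply/functional_extensionality_dep => x.
by rewrite mulVmx.
Qed.

Lemma actKV d (A : forall x : vertex Q, 'M[R]_(d x)) (V : rep R d) : GL A ->
  act A (act (fun x => invmx (A x)) V) = V.
Proof.
move=> Au; rewrite act_comp //; last exact: GL_inv.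
rewrite -[RHS]act1; congr act; apply/functional_extensionality_dep => x.
by rewrite mulmxV.
Qed.

Lemma posdefs1 d : posdefs (fun x : vertex Q => 1%:M : 'M[R]_(d x)).
Proof. by move=> x; exact: posdef1. Qed.

Lemma posdefs_congr d (A H : forall x : vertex Q, 'M[R]_(d x)) :
  GL A -> posdefs H -> posdefs (fun x => (A x)^T *m H x *m A x).
Proof.
by move=> Au Hp x; apply: (posdef_congr (Hp x)); apply: mulVmx; exact: Au.
Qed.

Lemma posdefs_gram d (A : forall x : vertex Q, 'M[R]_(d x)) :
  GL A -> posdefs (fun x => (A x)^T *m A x).
Proof. by move=> Au x; apply: posdef_gram; exact: Au. Qed.

(** Equivariance: moving [A] from the forms to the representation costs only a constant, so
    minimisers travel along the orbit. *)
Lemma kn_congr d (A : forall x : vertex Q, 'M[R]_(d x)) (V : rep R d) H :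
  GL A -> posdefs H ->
  kn V (fun x => (A x)^T *m H x *m A x) = kn (act A V) H + log_char A.
Proof.
move=> Au Hp; have Hu x : H x \in unitmx by exact: posdef_unit.
rewrite /kn -addrA; congr (_ + _); last first.
  rewrite -big_split; apply: eq_bigr => x _ /=; rewrite -mulrDr; congr (_ * _).
  have Ad : \det (A x) != 0 by rewrite -unitfE -unitmxE; exact: Au.
  rewrite !det_mulmx det_tr mulrAC -lnM ?posrE ?posdef_det_gt0 //.
    by congr ln; ring.
  by rewrite exprn_even_gt0.
apply: eq_bigr => a _; congr (_ * _); rewrite /act.
have AuT x : (A x)^T \in unitmx by rewrite unitmx_tr; exact: Au.
rewrite !invmx_mul ?unitmx_mul ?AuT ?Hu ?Au //=.
by rewrite !trmx_mul trmx_inv !mulmxA [LHS]mxtrace_mulC !mulmxA.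
Qed.

Lemma kn_gram d (A : forall x : vertex Q, 'M[R]_(d x)) (V : rep R d) :
  GL A -> kn V (fun x => (A x)^T *m A x) = rep_norm (act A V) + log_char A.
Proof.
move=> Au; rewrite -(kn1 w th) -kn_congr //; last exact: posdefs1.
by congr kn; apply/functional_extensionality_dep => x; rewrite mulmx1.
Qed.

Lemma congr_posdefs d (A H : forall x : vertex Q, 'M[R]_(d x)) :
  GL A -> posdefs H -> exists2 H', posdefs H' & H = fun x => (A x)^T *m H' x *m A x.
Proof.
move=> Au Hp; exists (fun x => (invmx (A x))^T *m H x *m invmx (A x)).
  by apply: posdefs_congr => //; exact: GL_inv.
apply/functional_extensionality_dep => x.
by rewrite !mulmxA -trmx_mul mulVmx ?Au // trmx1 mul1mx mulmxKV.
Qed.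

Lemma kn_min_gram d (A : forall x : vertex Q, 'M[R]_(d x)) (V : rep R d) :
  GL A -> kn_min V (fun x => (A x)^T *m A x) <-> moment_zero (act A V).
Proof.
move=> Au; split=> [[_ Vmin]|V0].
  apply: kn_ge_moment_zero => // H Hp.
  rewrite -(lerD2r (log_char A)) -kn_gram // -kn_congr //.
  by apply: Vmin; exact: posdefs_congr.
split=> [|H Hp]; first exact: posdefs_gram.
have [H' Hp' ->] := congr_posdefs Au Hp.
by rewrite kn_gram // kn_congr // lerD2r; exact: moment_zero_kn_ge.
Qed.

Lemma kn_min_congr d (A : forall x : vertex Q, 'M[R]_(d x)) (V : rep R d) H :
  GL A -> kn_min (act A V) H -> kn_min V (fun x => (A x)^T *m H x *m A x).
Proof.
move=> Au [Hp Hmin]; split; first exact: posdefs_congr.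
move=> H' /(congr_posdefs Au)[G Gp ->].
by rewrite !kn_congr // lerD2r; exact: Hmin.
Qed.

Lemma kn_min_ex d (V : rep R d) : (exists H, kn_min V H) <->
  exists2 A, GL A & moment_zero (act A V).
Proof.
split=> [[H Hmin]|[A Au V0]].
  have [A Au HA] := posdefs_gramP (proj1 Hmin).
  by exists A => //; apply/kn_min_gram => //; rewrite -HA.
by exists (fun x => (A x)^T *m A x); apply/kn_min_gram.
Qed.

(** A Gram factor [A] of [H] moves the first minimiser to the identity. The second becomes a family
    [G] of equal value, which commutes with A.V; conjugated back by [A] it is an endomorphism of
    [V], hence scalar. *)
Lemma kn_min_unique d (V : rep R d) H H' : End_scalar V ->
  kn_min V H -> kn_min V H' -> exists2 c : R, 0 < c & forall x, H' x = c *: H x.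
Proof.
move=> VEnd Hmin Hmin'; have [A Au HA] := posdefs_gramP (proj1 Hmin).
have V0 : moment_zero (act A V) by apply/kn_min_gram => //; rewrite -HA.
have [G Gp HG] := congr_posdefs Au (proj1 Hmin').
have knE : kn V H = kn V H'.
  apply/eqP; rewrite eq_le (proj2 Hmin _ (proj1 Hmin')).
  by rewrite (proj2 Hmin' _ (proj1 Hmin)).
rewrite HA HG kn_gram // kn_congr // in knE; move/addIr/esym in knE.
have GV := kn_eq_norm_commute w_gt0 V0 Gp knE.
have [|c cE] := VEnd (fun x => invmx (A x) *m G x *m A x).
  move=> a; have := GV a; rewrite /act.
  move/(congr1 (fun M => invmx (A (hd a)) *m M *m A (tl a))).
  rewrite !mulmxA mulmxKV ?Au // mulVmx ?Au // mul1mx => ->.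
  by [].
have Gc x : G x = c%:M.
  have := congr1 (fun M => A x *m M *m invmx (A x)) (cE x).
  rewrite !mulmxA mulmxV ?Au // mul1mx mulmxK ?Au // => ->.
  by rewrite mul_mx_scalar -scalemxAl mulmxV ?Au // scalemx1.
have HcH x : H' x = c *: H x.
  by rewrite HG HA Gc mul_mx_scalar -scalemxAl.
(* A vertex of positive dimension forces c > 0 because [G] is positive definite there; otherwise all
   matrices are empty and 1 serves. *)
have [[x dx]|d0] := pselect (exists x, (0 < d x)%N).
  exists c => //; have := proj2 (Gp x) (delta_mx (Ordinal dx) 0).
  rewrite Gc mul_mx_scalar -scalemxAl trmx_delta mul_delta_mx !mxE !eqxx mulr1.
  by apply; apply/eqP => /colP/(_ (Ordinal dx))/eqP; rewrite !mxE !eqxx oner_eq0.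
exists 1 => // x; rewrite scale1r; apply/matrixP => i.
by case: d0; exists x; apply: leq_trans (ltn_ord i).
Qed.

End Action.

(** * Block triangular representations *)

Section Blocks.
Variables (R : realType) (Q : quiver) (w : arrow Q -> R) (th : vertex Q -> R).
Hypothesis w_gt0 : forall a, 0 < w a.
Local Notation kn := (kn w th).
Local Notation kn_min := (kn_min w th).

Definition dim_sum (d1 d2 : dimvec Q) : dimvec Q := fun x => (d1 x + d2 x)%N.

Definition weighted_dim (d : dimvec Q) : R := \sum_x th x * (d x)%:R.

Variables d1 d2 : dimvec Q.

Definition block_rep (V1 : rep R d1) (X : forall a, 'M[R]_(d1 (hd a), d2 (tl a))) (V2 : rep R d2) :
    rep R (dim_sum d1 d2) := fun a => block_mx (V1 a) (X a) 0 (V2 a).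

Definition block_diags (H1 : forall x, 'M[R]_(d1 x)) (H2 : forall x, 'M[R]_(d2 x))
    (x : vertex Q) : 'M[R]_(dim_sum d1 d2 x) := block_mx (H1 x) 0 0 (H2 x).

Definition unipotents (K : forall x, 'M[R]_(d1 x, d2 x)) (x : vertex Q) :
    'M[R]_(dim_sum d1 d2 x) := block_mx 1%:M (K x) 0 1%:M.

(** Weighted squared norm of the off-diagonal block in the metrics [H1] and [H2]; it is the only
    interaction between the two blocks. *)
Definition cross_term (X : forall a, 'M[R]_(d1 (hd a), d2 (tl a)))
    (H1 : forall x, 'M[R]_(d1 x)) (H2 : forall x, 'M[R]_(d2 x)) : R :=
  \sum_a w a * \tr ((X a)^T *m H1 (hd a) *m X a *m invmx (H2 (tl a))).

Lemma posdefs_block H1 H2 : posdefs H1 -> posdefs H2 -> posdefs (block_diags H1 H2).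
Proof. by move=> p1 p2 x; exact: posdef_block. Qed.

Lemma GL_unipotents K : GL (unipotents K).
Proof. by move=> x; exact: (proj1 (unipotent_unit _)). Qed.

Lemma GL_block (A1 : forall x, 'M[R]_(d1 x)) (A2 : forall x, 'M[R]_(d2 x)) :
  GL A1 -> GL A2 -> GL (block_diags A1 A2).
Proof.
by move=> u1 u2 x; rewrite unitmxE det_ublock unitrM -!unitmxE u1 u2.
Qed.

(** The off-diagonal block moves by a coboundary K V2 - V1 K; making it zero amounts to splitting
    the extension of [V2] by [V1]. *)
Lemma act_unipotents K V1 X V2 : act (unipotents K) (block_rep V1 X V2) =
  block_rep V1 (fun a => X a + K (hd a) *m V2 a - V1 a *m K (tl a)) V2.
Proof.
apply/functional_extensionality_dep => a; rewrite /act /block_rep /unipotents.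
rewrite (proj2 (unipotent_unit _)) !mulmx_block.
rewrite !(mul1mx, mulmx1, mul0mx, mulmx0, add0r, addr0) mulmxN.
by rewrite [_ + (X a + _)]addrC.
Qed.

Lemma act_block A1 A2 V1 X V2 : GL A1 -> GL A2 ->
  act (block_diags A1 A2) (block_rep V1 X V2) =
  block_rep (act A1 V1) (fun a => A1 (hd a) *m X a *m invmx (A2 (tl a))) (act A2 V2).
Proof.
move=> u1 u2; apply/functional_extensionality_dep => a.
rewrite /act /block_rep /block_diags invmx_block_diag; last exact: (GL_block u1 u2).
by rewrite !mulmx_block !(mul0mx, mulmx0, add0r, addr0).
Qed.

Lemma log_char_unipotents K : log_char th (unipotents K) = 0.
Proof.
rewrite /log_char big1 // => x _.
by rewrite /unipotents det_ublock !det1 mulr1 expr1n ln1 mulr0.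
Qed.

Lemma kn_block V1 X V2 H1 H2 : posdefs H1 -> posdefs H2 ->
  kn (block_rep V1 X V2) (block_diags H1 H2) = kn V1 H1 + kn V2 H2 + cross_term X H1 H2.
Proof.
move=> p1 p2; rewrite /kn /cross_term addrACA [RHS]addrAC; congr (_ + _); last first.
  rewrite -big_split; apply: eq_bigr => x _ /=; rewrite -mulrDr /block_diags.
  by rewrite det_ublock lnM ?posrE ?posdef_det_gt0.
rewrite -!big_split; apply: eq_bigr => a _; rewrite /= -!mulrDr; congr (_ * _).
rewrite /block_rep /block_diags tr_block_mx invmx_block_diag; last first.
  exact/posdef_unit/posdef_block.
rewrite !mulmx_block !(mul0mx, mulmx0, add0r, addr0) trmx0.
rewrite !(mul0mx, mulmx0, add0r, addr0).
by rewrite mxtrace_block mulmxDl mxtraceD addrAC addrA.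
Qed.

Lemma cross_term_ge0 X H1 H2 : posdefs H1 -> posdefs H2 -> 0 <= cross_term X H1 H2.
Proof.
move=> p1 p2; rewrite sumr_ge0 // => a _.
by rewrite mulr_ge0 // ?tr_posdef_form_ge0 // ltW.
Qed.

Lemma cross_term_eq0 X H1 H2 : posdefs H1 -> posdefs H2 ->
  cross_term X H1 H2 = 0 -> forall a, X a = 0.
Proof.
move=> p1 p2 /eqP; rewrite psumr_eq0 => [/allP h a|a _]; last first.
  by rewrite mulr_ge0 // ?tr_posdef_form_ge0 // ltW.
have := h a (mem_index_enum _); rewrite mulf_eq0 gt_eqF //= => /eqP.
exact: tr_posdef_form_eq0.
Qed.

Lemma posdefs_schur (H : forall x, 'M[R]_(dim_sum d1 d2 x)) : posdefs H ->
  exists K H1 H2, [/\ posdefs H1, posdefs H2 & H = fun x =>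
    (unipotents K x)^T *m block_diags H1 H2 x *m unipotents K x].
Proof.
move=> Hp; have h x := posdef_schur (Hp x).
have [K hK] := dependent_choice_fun h; have [H1 hH1] := dependent_choice_fun hK.
have [H2 hH2] := dependent_choice_fun hH1.
exists K, H1, H2; split => [x|x|]; [by have [] := hH2 x|by have [] := hH2 x|].
by apply/functional_extensionality_dep => x; have [_ _ ->] := hH2 x.
Qed.

(** The completed square. By [posdefs_schur] every positive definite family has this shape, so the
    functional is always the sum of those of the blocks plus a nonnegative term. *)
Lemma kn_block_unipotent K V1 X V2 H1 H2 : posdefs H1 -> posdefs H2 ->
  kn (block_rep V1 X V2) (fun x =>
    (unipotents K x)^T *m block_diags H1 H2 x *m unipotents K x) =
  kn V1 H1 + kn V2 H2 +
    cross_term (fun a => X a + K (hd a) *m V2 a - V1 a *m K (tl a)) H1 H2.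
Proof.
move=> p1 p2; rewrite kn_congr //; [|exact: GL_unipotents|exact: posdefs_block].
by rewrite act_unipotents kn_block // log_char_unipotents addr0.
Qed.

Lemma ln_det_scale d (H : forall x : vertex Q, 'M[R]_(d x)) (t : R) : 0 < t -> posdefs H ->
  \sum_x th x * ln (\det (t *: H x)) =
  \sum_x th x * ln (\det (H x)) + ln t * weighted_dim d.
Proof.
move=> t0 Hp; rewrite mulr_sumr -big_split; apply: eq_bigr => x _.
rewrite detZ lnM ?posrE ?exprn_gt0 ?posdef_det_gt0 // lnXn //= -mulr_natr; ring.
Qed.

Lemma posdefs_scale d (H : forall x : vertex Q, 'M[R]_(d x)) (t : R) :
  0 < t -> posdefs H -> posdefs (fun x => t *: H x).
Proof.
move=> t0 Hp x; have [s pos] := Hp x; split; first by rewrite linearZ /= s.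
by move=> u u0; rewrite -scalemxAr -scalemxAl mxE mulr_gt0 ?pos.
Qed.

(** As t tends to 0 the cross term disappears. This is free if the first block has weighted
    dimension 0, and drives the functional to minus infinity if that dimension is positive. *)
Lemma kn_block_scale V1 X V2 H1 H2 (t : R) : 0 < t -> posdefs H1 -> posdefs H2 ->
  kn (block_rep V1 X V2) (block_diags (fun x => t *: H1 x) H2) =
  kn V1 H1 + kn V2 H2 + t * cross_term X H1 H2 + ln t * weighted_dim d1.
Proof.
move=> t0 p1 p2; rewrite kn_block //; last exact: posdefs_scale.
have -> : kn V1 (fun x => t *: H1 x) = kn V1 H1 + ln t * weighted_dim d1.
  rewrite /kn ln_det_scale // addrA; congr (_ + _ + _); apply: eq_bigr => a _.
  rewrite invmxZ; last by apply: posdef_unit; exact: posdefs_scale.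
  by rewrite -!scalemxAr -!scalemxAl scalerA mulVf ?scale1r // gt_eqF.
have -> : cross_term X (fun x => t *: H1 x) H2 = t * cross_term X H1 H2.
  rewrite mulr_sumr; apply: eq_bigr => a _.
  by rewrite -scalemxAr -!scalemxAl linearZ /=; ring.
ring.
Qed.

End Blocks.

(** * Existence of minima for stable representations *)

(** Summation by parts: raising the lowest level of [v] to the next one changes the sum by the gap
    times the total weight of a sublevel set, which is negative. The induction is on the number of
    indices above the bottom level. *)
Lemma abel_positive (R : realFieldType) (I : finType) (th v : I -> R) :
  \sum_i th i = 0 ->
  (forall c, (exists i, v i <= c) -> (exists i, c < v i) ->
     \sum_(i | v i <= c) th i < 0) ->
  (exists i j, v i < v j) -> 0 < \sum_i th i * v i.
Proof.
move=> th0; suff gen (n : nat) (m : R) : forall v : I -> R, (#|[set i | (m < v i)%R]%SET| <= n)%N ->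
    (forall i, m <= v i) ->
    (forall c, (exists i, v i <= c) -> (exists i, c < v i) ->
     \sum_(i | v i <= c) th i < 0) ->
    0 <= \sum_i th i * v i /\
    ((exists i, v i = m) -> (exists j, m < v j) -> 0 < \sum_i th i * v i).
  move=> H [i [j ij]].
  have [k _ kmin] := @Order.TotalTheory.arg_minP _ R I i xpredT v isT.
  have [_ ->//] := gen #|[set i | v k < v i]%SET| (v k) v (leqnn _) (fun i => kmin i isT) H.
    by exists k.
  by exists j; apply: le_lt_trans ij; exact: kmin.
elim: n m => [|n IH] m {}v vn vm H.
  have vE i : v i = m.
    apply/eqP; rewrite eq_le vm andbT leNgt; apply/negP => mi.
    by move: vn; rewrite leqn0 cards_eq0 => /eqP/setP/(_ i); rewrite !inE mi.
  under eq_bigr do rewrite vE.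
  rewrite -mulr_suml th0 mul0r; split=> // _ [j]; by rewrite vE ltxx.
have [[k mk]|none] := pselect (exists k, m < v k); last first.
  apply: (IH m v _ vm H).
  rewrite (_ : [set _ | _]%SET = finset.set0) ?cards0 //; apply/setP => i; rewrite !inE.
  by apply/negP => mi; apply: none; exists i.
have [k' mk' kmin] := @Order.TotalTheory.arg_minP _ R I k (fun i => m < v i) v mk.
(* [m'] is the smallest value above [m], so [v'] merges the lowest level into the next one and its
   sublevel sets are among those of [v]. *)
pose m' := v k'; pose v' i := Num.max (v i) m'.
have vv' i : v' i = v i + (if v i <= m then m' - m else 0).
  rewrite /v'; case: ifP => vim.
    have -> : v i = m by apply/eqP; rewrite eq_le vim vm.
    by rewrite max_r ?ltW // addrC subrK.
  rewrite addr0 max_l // /m'; apply: kmin; by rewrite ltNge vim.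
have sumE : \sum_i th i * v i = \sum_i th i * v' i - (m' - m) * \sum_(i | v i <= m) th i.
  rewrite [X in _ - _ * X]big_mkcond mulr_sumr -sumrB; apply: eq_bigr => i _.
  by rewrite vv'; case: ifP => _; ring.
have [|i|c [i ic] [j jc]|v'0 _] := IH m' v'.
- have : [set i | m' < v' i]%SET \proper [set i | m < v i]%SET.
    apply/properP; split.
      apply/fintype.subsetP => i; rewrite !inE /v' lt_max ltxx orbF => h.
      by apply: lt_trans h; exact: mk'.
    by exists k'; rewrite !inE // /v' maxxx ltxx.
  by move/proper_card => h; rewrite -ltnS; apply: leq_trans vn.
- by rewrite /v' le_max lexx orbT.
- move: ic; rewrite /v' ge_max => /andP[ic mc].
  rewrite (eq_bigl (fun i => v i <= c)); last by move=> l; rewrite /v' ge_max mc andbT.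
  apply: H; first by exists i.
  move: jc; rewrite /v' lt_max [c < m']ltNge mc orbF => jc; by exists j.
have m'm : 0 < m' - m by rewrite subr_gt0.
have [[i im]|none] := pselect (exists i, v i <= m).
  have neg : \sum_(i | v i <= m) th i < 0 by apply: H; [exists i|exists k].
  have pos : 0 < - ((m' - m) * \sum_(i | v i <= m) th i).
    by rewrite oppr_gt0 pmulr_rlt0.
  by split=> [|_ _]; rewrite sumE; [rewrite addr_ge0 // ltW|rewrite ltr_wpDl].
rewrite sumE [X in _ - _ * X]big1 ?mulr0 ?subr0 => [|i im]; last first.
  by case: none; exists i.
by split=> // -[i iv]; case: none; exists i; rewrite iv.
Qed.

Section CompactBox.
Variables (R : realType) (Z : finType).

(** A finite product of lines, where Tychonoff gives compact boxes; the frames and logarithms of all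
    vertices are later stored as one point of such a space. *)
Definition coord_space := prod_topology (fun _ : Z => R : topologicalType).

Lemma coord_space_continuous (z : Z) : continuous (fun f : coord_space => f z : R).
Proof. exact: (@proj_continuous Z (fun _ => R : topologicalType) z). Qed.

Lemma compact_box (E : set coord_space) (B : R) : closed E ->
  compact (E `&` [set f | forall z, `|f z| <= B]).
Proof.
move=> Ecl; have cb := @tychonoff Z (fun _ => R : topologicalType)
  (fun _ => `[- B, B]%classic) (fun _ => @segment_compact R _ _).
apply: subclosed_compact cb _.
  apply: closedI => //.
  rewrite (_ : [set f | _] =
      \bigcap_(z in [set: Z]) ((fun f : coord_space => f z : R) @^-1` `[- B, B])).
    apply: closed_bigI => z _; apply: preimage_closed.
      by move=> f _; exact: coord_space_continuous.
    exact: itv_closed.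
  apply/seteqP; split=> f h z.
    by move=> _; rewrite /= in_itv /= -ler_norml; exact: h.
  by have := h z I; rewrite /= in_itv /= -ler_norml.
move=> f [_ fB] z /=; rewrite in_itv /= -ler_norml; exact: fB.
Qed.

Lemma closed_equations (I : Type) (g : I -> coord_space -> R) (c : I -> R) :
  (forall i, continuous (g i)) -> closed [set f | forall i, g i f = c i].
Proof.
move=> gc; rewrite (_ : [set f | _] = \bigcap_(i in [set: I]) (g i @^-1` [set c i])).
  apply: closed_bigI => i _; apply: preimage_closed.
    by move=> f _; exact: gc.
  exact: closed_eq.
by apply/seteqP; split=> f h i; [move=> _; exact: h|exact: (h i Logic.I)].
Qed.

Lemma compact_min (E : set coord_space) (g : coord_space -> R) :
  compact E -> continuous g -> E !=set0 -> exists2 f, E f & forall h, E h -> g f <= g h.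
Proof.
move=> Ec gc E0; have [f fE fmin] := compact_EVT_min E0 Ec (continuous_subspaceT gc).
exists f; first by rewrite inE in fE.
by move=> h hE; apply: fmin; rewrite inE.
Qed.

End CompactBox.

Lemma eq_continuousr (R : realType) (T : topologicalType) (f g : T -> R) :
  continuous f -> (forall x, g x = f x) -> continuous g.
Proof. by move=> cf /funext ->. Qed.

Lemma continuous_subr (R : realType) (T : topologicalType) (f g : T -> R) :
  continuous f -> continuous g -> continuous (fun x => f x - g x).
Proof. by move=> cf cg x; apply: cvgB; [exact: cf|exact: cg]. Qed.

Section Stability.
Variables (R : realType) (Q : quiver) (w : arrow Q -> R) (th : vertex Q -> R).
Hypothesis w_gt0 : forall a, 0 < w a.
Implicit Types d : dimvec Q.
Local Notation kn := (kn w th).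
Local Notation rep_norm := (rep_norm w).
Local Notation kn_min := (kn_min w th).
Local Notation linear_part := (linear_part th).
Local Notation entry_weight := (entry_weight w).

(* Subrepresentations are encoded by families of idempotents with invariant
   images, so that dimensions become traces. *)
Definition invariant_idempotents d (V : rep R d)
    (P : forall x : vertex Q, 'M[R]_(d x)) : Prop :=
  (forall x, P x *m P x = P x) /\
  (forall a, P (hd a) *m V a *m P (tl a) = V a *m P (tl a)).

Definition weighted_trace d (P : forall x : vertex Q, 'M[R]_(d x)) : R :=
  \sum_x th x * \tr (P x).

Definition theta_semistable d (V : rep R d) : Prop :=
  weighted_dim th d = 0 /\
  forall P, invariant_idempotents V P -> weighted_trace P <= 0.

Definition theta_stable d (V : rep R d) : Prop :=
  weighted_dim th d = 0 /\
  forall P, invariant_idempotents V P -> (exists x, P x != 0) ->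
    (exists x, P x != 1%:M) -> weighted_trace P < 0.

Definition coordinate d : finType := {x : vertex Q & 'I_(d x)}.

Lemma linear_part_coord d (y : forall x : vertex Q, 'rV[R]_(d x)) :
  linear_part y = \sum_(z : coordinate d) th (tag z) * y (tag z) 0 (tagged z).
Proof.
rewrite -(sig_big_dep xpredT (fun _ => xpredT) (fun x i => th x * y x 0 i)).
by apply: eq_bigr => x _; rewrite mulr_sumr.
Qed.

Lemma weighted_dim_coord d : weighted_dim th d = \sum_(z : coordinate d) th (tag z).
Proof.
rewrite -(sig_big_dep xpredT (fun _ => xpredT) (fun x (i : 'I_(d x)) => th x)).
by apply: eq_bigr => x _; rewrite mulr_natr -{1}(card_ord (d x)) -sumr_const.
Qed.

(* The sublevel sets of y span subrepresentations; stability bounds their weighted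
   dimensions and summation by parts gives the sign of the linear part. *)
Lemma stable_linear_part_gt0 d (V : rep R d) K y : theta_stable V ->
  (forall x, orthonormal (K x)) ->
  (forall z, entry_weight (rotate K V) z != 0 -> slope y z <= 0) ->
  (exists z z' : coordinate d, y (tag z) 0 (tagged z) < y (tag z') 0 (tagged z')) ->
  0 < linear_part y.
Proof.
move=> [d0 Vst] KK slope_le ncst; rewrite linear_part_coord.
apply: (@abel_positive _ (coordinate d) (fun z => th (tag z))
    (fun z => y (tag z) 0 (tagged z))) => [|c [z zc] [z' cz']|//]; first by rewrite -weighted_dim_coord.
pose D x : 'M[R]_(d x) := diag_mx (\row_i (y x 0 i <= c)%R%:R).
have DD x : D x *m D x = D x.
  rewrite mulmx_diag; congr diag_mx; apply/rowP => i; rewrite !mxE.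
  by rewrite -natrM mulnb andbb.
pose P x := (K x)^T *m D x *m K x.
have P_K x : K x *m P x *m (K x)^T = D x.
  by rewrite /P !mulmxA KK mul1mx -mulmxA KK mulmx1.
have PV : invariant_idempotents V P.
  split=> [x|a].
    by rewrite /P !mulmxA -(mulmxA _ (K x)) KK mulmx1 -(mulmxA _ (D x) (D x)) DD.
  (* A nonzero entry (r, s) has y r <= y s, so a column at level at most [c] meets only rows at
     level at most [c]. *)
  have DBD : D (hd a) *m rotate K V a *m D (tl a) = rotate K V a *m D (tl a).
    apply/matrixP => r s; rewrite !mul_mx_diag mul_diag_mx.
    have := slope_le (Tagged (fun a => ('I_(d (hd a)) * 'I_(d (tl a)))%type) (r, s)).
    rewrite /entry_weight /slope /=; move: (rotate K V a) => B.
    rewrite !mxE mulf_eq0 gt_eqF //= sqrf_eq0 subr_le0.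
    have [->|B0] := eqVneq (B r s) 0; first by rewrite mulr0 !mul0r.
    move=> /(_ isT) yrs; case: (leP (y (tl a) 0 s) c) => [h|_]; last by rewrite mulr0n !mulr0.
    by rewrite (le_trans yrs h) mulr1n mul1r.
  rewrite (rotateK V KK a) /P; move: (rotate K V a) DBD => B DBD.
  rewrite !mulmxA -(mulmxA _ (K (hd a))) KK mulmx1.
  rewrite -(mulmxA _ (K (tl a))) KK mulmx1 -(mulmxA _ (K (tl a))) KK mulmx1.
  by rewrite -(mulmxA _ (D (hd a))) -(mulmxA _ _ (D (tl a))) DBD !mulmxA.
have {Vst} := Vst P PV; rewrite (_ : weighted_trace P =
    \sum_(z : coordinate d | y (tag z) 0 (tagged z) <= c) th (tag z)).
  apply.
    exists (tag z); apply/eqP => P0; have := P_K (tag z).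
    rewrite P0 mulmx0 mul0mx => /matrixP/(_ (tagged z) (tagged z))/eqP.
    by rewrite !mxE zc eqxx eq_sym oner_eq0.
  exists (tag z'); apply/eqP => P1; have := P_K (tag z').
  rewrite P1 mulmx1 KK => /matrixP/(_ (tagged z') (tagged z'))/eqP.
  by rewrite !mxE leNgt cz' eqxx oner_eq0.
rewrite -(sig_big_dep xpredT (fun x i => y x 0 i <= c) (fun x i => th x)).
apply: eq_bigr => x _; rewrite mxtrace_mulC mulmxA KK mul1mx mxtrace_diag.
rewrite [RHS]big_mkcond mulr_sumr; apply: eq_bigr => i _; rewrite mxE.
by case: (y x 0 i <= c); rewrite ?mulr1 ?mulr0.
Qed.

Section FrameParameters.
Variables (d : dimvec Q) (V : rep R d).

Definition param : finType :=
  ({x : vertex Q & ('I_(d x) * 'I_(d x))%type} + coordinate d)%type.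
Local Notation space := (coord_space R param).

Definition frame_of (f : space) (x : vertex Q) : 'M[R]_(d x) :=
  \matrix_(r, s) f (inl (Tagged (fun x => ('I_(d x) * 'I_(d x))%type) (r, s))).

Definition logs_of (f : space) (x : vertex Q) : 'rV[R]_(d x) :=
  \row_i f (inr (Tagged (fun x => 'I_(d x)) i)).

Definition param_of (K : forall x, 'M[R]_(d x)) (y : forall x, 'rV[R]_(d x)) : space :=
  fun z => match z with
    | inl t => K (tag t) (tagged t).1 (tagged t).2
    | inr t => y (tag t) 0 (tagged t)
    end.

Lemma frame_of_param K y : frame_of (param_of K y) = K.
Proof. by apply/functional_extensionality_dep => x; apply/matrixP => r s; rewrite !mxE. Qed.

Lemma logs_of_param K y : logs_of (param_of K y) = y.
Proof. by apply/functional_extensionality_dep => x; apply/rowP => i; rewrite !mxE. Qed.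

Lemma frame_continuous x r s : continuous (fun f : space => frame_of f x r s).
Proof.
by apply: (eq_continuousr (@coord_space_continuous _ _ _)) => f; rewrite mxE.
Qed.

Lemma logs_continuous x i : continuous (fun f : space => logs_of f x 0 i).
Proof.
by apply: (eq_continuousr (@coord_space_continuous _ _ _)) => f; rewrite mxE.
Qed.

Lemma rotate_continuous a r s :
  continuous (fun f : space => rotate (frame_of f) V a r s).
Proof.
apply: (@eq_continuousr _ _ (fun f : space => \sum_j (\sum_i
    frame_of f (hd a) r i * V a i j) * frame_of f (tl a) s j)) => [|f]; last first.
  rewrite /rotate mxE; apply: eq_bigr => j _.
  by rewrite mxE [_^T _ _]mxE.
apply: continuous_sumr => j _; apply: continuous_mulr; last exact: frame_continuous.
apply: continuous_sumr => i _.
by apply: continuous_mulr; [exact: frame_continuous|exact: cst_continuous].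
Qed.

Lemma entry_weight_continuous z :
  continuous (fun f : space => entry_weight (rotate (frame_of f) V) z).
Proof.
have cB := @rotate_continuous (tag z) (tagged z).1 (tagged z).2.
apply: continuous_mulr; first exact: cst_continuous.
by apply: (eq_continuousr (continuous_mulr cB cB)) => f; rewrite expr2.
Qed.

Lemma slope_continuous z : continuous (fun f : space => slope (logs_of f) z).
Proof.
by apply: continuous_subr; exact: logs_continuous.
Qed.

Lemma linear_part_continuous : continuous (fun f : space => linear_part (logs_of f)).
Proof.
apply: continuous_sumr => x _; apply: continuous_mulr; first exact: cst_continuous.
by apply: continuous_sumr => i _; exact: logs_continuous.
Qed.

Lemma kn_continuous : continuous (fun f : space =>
  \sum_z entry_weight (rotate (frame_of f) V) z * expR (slope (logs_of f) z)
    + linear_part (logs_of f)).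
Proof.
apply: continuous_addr; last exact: linear_part_continuous.
apply: continuous_sumr => z _; apply: continuous_mulr.
  exact: entry_weight_continuous.
move=> f; apply: (@continuous_comp _ _ _ (fun f => slope (logs_of f) z) (@expR R)).
  exact: slope_continuous.
exact: continuous_expR.
Qed.

Lemma closed_orthonormal : closed [set f : space | forall x, orthonormal (frame_of f x)].
Proof.
rewrite (_ : [set f | _] = [set f : space | forall t : {x : vertex Q & ('I_(d x) * 'I_(d x))%type},
   \sum_j frame_of f (tag t) (tagged t).1 j * frame_of f (tag t) (tagged t).2 j =
     ((tagged t).1 == (tagged t).2)%:R]).
  apply: closed_equations => t; apply: continuous_sumr => j _.
  by apply: continuous_mulr; exact: frame_continuous.
apply/seteqP; split=> f /= h.
  move=> [x [r s]] /=; have /matrixP/(_ r s) := h x; rewrite [RHS]mxE => <-.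
  by rewrite [RHS]mxE; apply: eq_bigr => j _; rewrite [_^T _ _]mxE.
move=> x; apply/matrixP => r s; rewrite [RHS]mxE.
rewrite -(h (Tagged (fun x => ('I_(d x) * 'I_(d x))%type) (r, s))) /=.
by rewrite [LHS]mxE; apply: eq_bigr => j _; rewrite [_^T _ _]mxE.
Qed.

Lemma orthonormal_entry_le1 n (K : 'M[R]_n) r s : orthonormal K -> `|K r s| <= 1.
Proof.
move=> /matrixP/(_ r r); rewrite [RHS]mxE eqxx mulr1n mxE (bigD1 s) //= mxE -expr2 => e.
rewrite -[leRHS]sqrtr1 -sqrtr_sqr ler_wsqrtr // -e lerDl sumr_ge0 // => j _.
by rewrite mxE -expr2 sqr_ge0.
Qed.

End FrameParameters.
End Stability.

Section StableMinimum.
Variables (R : realType) (Q : quiver) (w : arrow Q -> R) (th : vertex Q -> R).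
Hypothesis w_gt0 : forall a, 0 < w a.
Local Notation kn := (kn w th).
Local Notation rep_norm := (rep_norm w).
Local Notation kn_min := (kn_min w th).
Local Notation linear_part := (linear_part th).
Local Notation entry_weight := (entry_weight w).
Variables (d : dimvec Q) (V : rep R d).
Local Notation space := (coord_space R (param d)).

(** The positive part, in a form whose continuity is that of the absolute value. *)
Definition pospart (x : R) : R := (x + `|x|) / 2.

Lemma pospart_ge0 x : 0 <= pospart x.
Proof. by rewrite divr_ge0 // -lerBlDl sub0r -normrN ler_norm. Qed.

Lemma pospart_eq0 x : pospart x = 0 -> x <= 0.
Proof. by rewrite /pospart => h; have := normr_ge0 x; lra. Qed.

Lemma pospart_pos x : 0 < pospart x -> pospart x = x.
Proof.
rewrite /pospart; case: (ger0P x) => x0 h; first by lra.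
by move: h; lra.
Qed.

Lemma pospartM t x : 0 <= t -> pospart (t * x) = t * pospart x.
Proof. by move=> t0; rewrite /pospart normrM ger0_norm //; ring. Qed.

Lemma pospart_continuous (T : topologicalType) (f : T -> R) :
  continuous f -> continuous (fun x => pospart (f x)).
Proof.
move=> cf; apply: continuous_mulr; last exact: cst_continuous.
apply: continuous_addr => // x.
by apply: (@continuous_comp _ _ _ f (fun y : R => `|y|)); [exact: cf|exact: norm_continuous].
Qed.

Lemma expR_ge_pospart_sq x : pospart x ^+ 2 / 2 <= expR x.
Proof.
have [p0|p0] := eqVneq (pospart x) 0.
  by rewrite p0 expr0n mul0r expR_ge0.
have {}p0 : 0 < pospart x by rewrite lt_neqAle eq_sym p0 pospart_ge0.
rewrite pospart_pos //; have x0 : 0 <= x by rewrite -[x]pospart_pos // ltW.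
by apply: le_trans (expR_ge1Dxn 1 x0); rewrite lerDr.
Qed.

Definition coord_sum (y : forall x : vertex Q, 'rV[R]_(d x)) : R :=
  \sum_(z : coordinate d) y (tag z) 0 (tagged z).

Definition coord_sqsum (y : forall x : vertex Q, 'rV[R]_(d x)) : R :=
  \sum_(z : coordinate d) y (tag z) 0 (tagged z) ^+ 2.

(* Vanishes exactly when no term of kn V grows along the ray of logarithms through f. *)
Definition instability (f : space) : R :=
  pospart (linear_part (logs_of f)) +
  \sum_z entry_weight (rotate (frame_of f) V) z * pospart (slope (logs_of f) z) ^+ 2.

Lemma instability_continuous : continuous instability.
Proof.
apply: continuous_addr; first exact/pospart_continuous/linear_part_continuous.
apply: continuous_sumr => z _; apply: continuous_mulr.
  exact: entry_weight_continuous.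
have cp := pospart_continuous (@slope_continuous _ _ d z).
by apply: (eq_continuousr (continuous_mulr cp cp)) => f; rewrite expr2.
Qed.

Lemma coord_sum_continuous : continuous (fun f : space => coord_sum (logs_of f)).
Proof. by apply: continuous_sumr => z _; exact: logs_continuous. Qed.

Lemma coord_sqsum_continuous : continuous (fun f : space => coord_sqsum (logs_of f)).
Proof.
apply: continuous_sumr => z _.
apply: (eq_continuousr (continuous_mulr (@logs_continuous _ _ d _ _)
  (@logs_continuous _ _ d _ _))) => f; exact: expr2.
Qed.

(** Sum 0 removes the flat direction of common shifts, and square sum 1 selects one point on each
    ray of logarithms. *)
Definition unit_params : set space := [set f | (forall x, orthonormal (frame_of f x)) /\
  coord_sum (logs_of f) = 0 /\ coord_sqsum (logs_of f) = 1].

Lemma coord_le_sqsum y (z : coordinate d) B : 0 <= B -> coord_sqsum y <= B ^+ 2 ->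
  `|y (tag z) 0 (tagged z)| <= B.
Proof.
move=> B0 yB; rewrite -(ger0_norm B0) -ler_sqr ?nnegrE // !real_normK ?num_real //.
apply: le_trans yB; rewrite /coord_sqsum (bigD1 z) //= lerDl sumr_ge0 // => i _.
exact: sqr_ge0.
Qed.

Lemma param_bounded (f : space) B : 1 <= B -> (forall x, orthonormal (frame_of f x)) ->
  (forall z : coordinate d, `|logs_of f (tag z) 0 (tagged z)| <= B) ->
  forall z, `|f z| <= B.
Proof.
move=> B1 KK yB [[x [r s]]|[x i]].
  have := orthonormal_entry_le1 r s (KK x); rewrite mxE => h; exact: le_trans h B1.
have := yB (Tagged (fun x => 'I_(d x)) i); by rewrite mxE.
Qed.

Lemma compact_unit_params : compact unit_params.
Proof.
rewrite (_ : unit_params = unit_params `&` [set f | forall z, `|f z| <= 1]).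
  apply: compact_box.
  rewrite (_ : unit_params = [set f : space | forall x, orthonormal (frame_of f x)] `&`
    ((fun f : space => coord_sum (logs_of f)) @^-1` [set 0] `&`
     (fun f : space => coord_sqsum (logs_of f)) @^-1` [set 1])) //.
  apply: closedI; first exact: closed_orthonormal.
  by apply: closedI; apply: preimage_closed; try exact: closed_eq; move=> f _;
    [exact: coord_sum_continuous|exact: coord_sqsum_continuous].
apply/seteqP; split=> [f|f []//]; move=> h; split=> //; case: h => KK [_ s1].
apply: param_bounded => // z; apply: coord_le_sqsum => //.
by rewrite s1 expr1n.
Qed.

Hypothesis Vst : theta_stable th V.

(** If it vanished, every slope with nonzero weight and the linear part would be nonpositive.
    Stability then makes all logarithms equal, sum 0 makes them vanish, and the square sum cannot be
    1. *)
Lemma instability_gt0 f : unit_params f -> 0 < instability f.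
Proof.
move=> [KK [s0 s1]]; rewrite lt_neqAle; apply/andP; split; last first.
  rewrite addr_ge0 ?pospart_ge0 // sumr_ge0 // => z _.
  by rewrite mulr_ge0 ?entry_weight_ge0 ?sqr_ge0.
rewrite eq_sym; apply/eqP => /eqP; rewrite paddr_eq0 ?pospart_ge0 //; last first.
  by rewrite sumr_ge0 // => z _; rewrite mulr_ge0 ?entry_weight_ge0 ?sqr_ge0.
move=> /andP[/eqP/pospart_eq0 L0].
rewrite psumr_eq0 => [/allP S0|z _]; last by rewrite mulr_ge0 ?entry_weight_ge0 ?sqr_ge0.
have := L0; apply/negP; rewrite -ltNge; apply: (stable_linear_part_gt0 w_gt0 Vst KK).
  move=> z q0; have := S0 z (mem_index_enum _).
  by rewrite mulf_eq0 (negbTE q0) /= sqrf_eq0 => /eqP/pospart_eq0.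
pose u (z : coordinate d) := logs_of f (tag z) 0 (tagged z).
apply: contrapT => cst.
have ucst z z' : u z = u z'.
  by apply/eqP; rewrite eq_le !leNgt; apply/andP; split; apply/negP => h; apply: cst;
    [exists z', z|exists z, z'].
have u0 z : u z = 0.
  apply/eqP; move/eqP: s0; rewrite /coord_sum (eq_bigr (fun=> u z)); last first.
    by move=> z' _; exact: ucst.
  rewrite sumr_const mulrn_eq0 => /orP[|//].
  by rewrite -leqn0 leqNgt => /negP[]; apply/card_gt0P; exists z.
have := oner_neq0 R; rewrite -s1 /coord_sqsum big1 ?eqxx // => z _.
by rewrite [X in X ^+ 2](u0 z) expr0n.
Qed.

Lemma instability_bound : exists2 e : R, 0 < e &
  forall f, unit_params f -> e <= instability f.
Proof.
have [ne|none] := pselect (unit_params !=set0); last first.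
  by exists 1 => // f fu; case: none; exists f.
have [f fu fmin] := compact_min compact_unit_params instability_continuous ne.
by exists (instability f) => //; exact: instability_gt0.
Qed.

Lemma linear_part_le y : coord_sqsum y <= 1 ->
  `|linear_part y| <= \sum_(z : coordinate d) `|th (tag z)|.
Proof.
move=> s1; rewrite linear_part_coord; apply: le_trans (ler_norm_sum _ _ _) _.
apply: ler_sum => z _; rewrite normrM ler_piMr //.
by apply: coord_le_sqsum; rewrite ?expr1n.
Qed.

Lemma rep_norm_ge0 : 0 <= rep_norm V.
Proof. by rewrite sumr_ge0 // => a _; rewrite mulr_ge0 ?tr_gram_ge0 // ltW. Qed.

(** Write y = t u with u a unit direction of instability at least [e]. Either the linear part of u
    is at least e/2 and contributes linearly in t, or the exponentials contribute at least t^2 e/4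
    and outweigh a linear loss of at most t B. *)
Lemma kn_coercive : exists2 T : R, 0 < T & forall K y, (forall x, orthonormal (K x)) ->
  coord_sum y = 0 -> T ^+ 2 <= coord_sqsum y ->
  rep_norm V <= kn V (fun x => expdiag (K x) (y x)).
Proof.
have [e e0 he] := instability_bound.
pose B := \sum_(z : coordinate d) `|th (tag z)|; pose N := rep_norm V.
have B0 : 0 <= B by rewrite sumr_ge0.
have N0 : 0 <= N := rep_norm_ge0.
(* For t >= T this gives e t >= 4 (B + N + 1), enough in both cases, and the final 1 ensures t >=
   1. *)
exists (4 / e * (B + N + 1) + 1) => [|K y KK s0 yT].
  by rewrite ltr_wpDl // mulr_ge0 ?addr_ge0 // divr_ge0 // ltW.
set T := 4 / e * _ + 1 in yT.
have TP : 0 <= T by rewrite addr_ge0 // mulr_ge0 ?addr_ge0 // divr_ge0 // ltW.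
pose t := Num.sqrt (coord_sqsum y).
have tT : T <= t by rewrite -(ger0_norm TP) -sqrtr_sqr ler_wsqrtr.
have t1 : 1 <= t.
  by apply: le_trans tT; rewrite lerDr mulr_ge0 ?addr_ge0 // divr_ge0 // ltW.
have t0 : 0 < t by apply: lt_le_trans t1.
have tsq : t ^+ 2 = coord_sqsum y.
  by rewrite sqr_sqrtr // sumr_ge0 // => z _; rewrite sqr_ge0.
pose u x := t^-1 *: y x.
have yu x i : y x 0 i = t * u x 0 i by rewrite mxE mulVKf // gt_eqF.
have usq : coord_sqsum u = 1.
  have -> : coord_sqsum u = (t ^+ 2)^-1 * coord_sqsum y.
    by rewrite mulr_sumr; apply: eq_bigr => z _; rewrite mxE exprMn exprVn.
  by rewrite -tsq mulVf // expf_neq0 // gt_eqF.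
have us : coord_sum u = 0.
  rewrite -[RHS](mulr0 t^-1) -s0 mulr_sumr.
  by apply: eq_bigr => z _; rewrite mxE.
have uP : unit_params (param_of K u).
  by split=> [x|]; rewrite ?frame_of_param ?logs_of_param.
have := he _ uP; rewrite /instability frame_of_param logs_of_param.
set L := linear_part u; set S := \sum_z _ => LS.
have LB : `|L| <= B by apply: linear_part_le; rewrite usq.
have slopeE z : slope y z = t * slope u z by rewrite /slope !yu mulrBr.
have linE : linear_part y = t * L.
  rewrite /L !linear_part_coord mulr_sumr; apply: eq_bigr => z _.
  by rewrite yu; ring.
have expS : t ^+ 2 * S / 2 <=
    \sum_z entry_weight (rotate K V) z * expR (slope y z).
  rewrite mulr_sumr mulr_suml; apply: ler_sum => z _.
  rewrite (_ : _ / 2 = entry_weight (rotate K V) z * (pospart (slope y z) ^+ 2 / 2)).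
    by rewrite ler_wpM2l ?entry_weight_ge0 // expR_ge_pospart_sq.
  by rewrite slopeE pospartM ?ltW //; ring.
have S0 : 0 <= S.
  by rewrite sumr_ge0 // => z _; rewrite mulr_ge0 ?entry_weight_ge0 ?sqr_ge0.
rewrite kn_expdiag // linE -/N.
have et : 4 * (B + N + 1) <= e * t.
  have : e * T <= e * t by rewrite ler_pM2l.
  apply: le_trans; rewrite (_ : e * T = 4 * (B + N + 1) + e); last first.
    by rewrite /T; field; rewrite gt_eqF.
  by rewrite lerDl ltW.
have [L2|L2] := lerP (e / 2) (pospart L).
  have Lp : pospart L = L by apply: pospart_pos; apply: lt_le_trans L2; rewrite divr_gt0.
  rewrite Lp in L2.
  apply: (@le_trans _ _ (t * L)); last by rewrite lerDr; apply: le_trans expS; nra.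
  have : t * (e / 2) <= t * L by rewrite ler_pM2l.
  lra.
have S2 : e / 2 <= S by lra.
have tS : t ^+ 2 * (e / 2) <= t ^+ 2 * S by rewrite ler_pM2l // exprn_gt0.
have tL : - (t * B) <= t * L.
  by rewrite -mulrN ler_pM2l //; move: LB; rewrite ler_norml => /andP[].
have : t * (4 * (B + N + 1)) <= t * (e * t) by rewrite ler_pM2l.
have : 1 * N <= t * N by rewrite ler_wpM2r.
rewrite !mulrDr !mulr1 expr2 in tS *.
nra.
Qed.

(** Slopes are differences, and the linear part changes by [c] times the weighted dimension, which
    is 0. *)
Lemma shift_logs (K : forall x, 'M[R]_(d x)) y c : (forall x, orthonormal (K x)) ->
  kn V (fun x => expdiag (K x) (y x)) =
  kn V (fun x => expdiag (K x) (\row_i (y x 0 i - c))).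
Proof.
move=> KK; rewrite !kn_expdiag //; congr (_ + _).
  apply: eq_bigr => z _; congr (_ * expR _); rewrite /slope !mxE; ring.
rewrite !linear_part_coord; under [RHS]eq_bigr do rewrite mxE mulrBr.
by rewrite sumrB -mulr_suml -weighted_dim_coord (proj1 Vst) mul0r subr0.
Qed.

(** After the logarithms are normalised to sum 0, families outside radius [T] do no better than the
    identity, which lies in the box; a minimum over the compact box is therefore global. *)
Lemma stable_kn_min : exists H, kn_min V H.
Proof.
have [T T0 hT] := kn_coercive.
pose B := Num.max 1 T.
pose E := [set f : space | forall x, orthonormal (frame_of f x)] `&`
  ((fun f : space => coord_sum (logs_of f)) @^-1` [set 0]).
have Ecl : closed E.
  apply: closedI; first exact: closed_orthonormal.
  by apply: preimage_closed; [move=> f _; exact: coord_sum_continuous|exact: closed_eq].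
pose f1 : space := param_of (fun=> 1%:M) (fun=> 0).
have f1E : (E `&` [set f | forall z, `|f z| <= B]) f1.
  have h x : orthonormal (frame_of f1 x).
    by rewrite frame_of_param /orthonormal trmx1 mulmx1.
  split; first split=> //.
    by rewrite /preimage /= logs_of_param /coord_sum big1 // => z _; rewrite mxE.
  apply: param_bounded => //; first by rewrite le_max lexx.
  by move=> z; rewrite logs_of_param mxE normr0 le_max ler01.
have [f [[fK _] _] fmin] := compact_min (compact_box Ecl) (@kn_continuous _ _ w th d V)
  (ex_intro _ f1 f1E).
exists (fun x => expdiag (frame_of f x) (logs_of f x)); split.
  by move=> x; exact: posdef_expdiag.
move=> H /posdefs_expdiagP[K [y [KK ->]]].
(* The mean of the logarithms, whose subtraction normalises the sum to 0; without coordinates every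
   sum is empty anyway. *)
pose c := coord_sum y / #|coordinate d|%:R.
pose y' x : 'rV[R]_(d x) := \row_i (y x 0 i - c).
rewrite (shift_logs y c KK) -/y' [leLHS]kn_expdiag //.
have sy' : coord_sum y' = 0.
  have [n0|n0] := eqVneq #|coordinate d| 0%N.
    by rewrite /coord_sum big1 // => z; have := card0_eq n0 z; rewrite inE.
  rewrite /coord_sum (eq_bigr (fun z : coordinate d => y (tag z) 0 (tagged z) - c)).
    by rewrite sumrB sumr_const -mulr_natr divfK ?subrr // pnatr_eq0.
  by move=> z _; rewrite mxE.
have [h|h] := lerP (T ^+ 2) (coord_sqsum y').
  apply: le_trans (hT K y' KK sy' h); rewrite -(kn1 w th).
  have -> : kn V (fun=> 1%:M) = kn V (fun x => expdiag 1%:M (0 : 'rV[R]_(d x))).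
    congr kn; apply/functional_extensionality_dep => x; rewrite /expdiag trmx1 mul1mx mulmx1.
    by rewrite -diag_const_mx; congr diag_mx; apply/rowP => i; rewrite !mxE expR0.
  rewrite kn_expdiag; last by move=> x; rewrite /orthonormal trmx1 mulmx1.
  by have := fmin _ f1E; rewrite frame_of_param logs_of_param.
rewrite kn_expdiag //.
have /fmin : (E `&` [set f | forall z, `|f z| <= B]) (param_of K y').
  have KK' x : orthonormal (frame_of (param_of K y') x) by rewrite frame_of_param.
  split; first by split=> //; rewrite /preimage /= logs_of_param.
  apply: param_bounded => //; first by rewrite le_max lexx.
  move=> z; rewrite logs_of_param; apply: (@le_trans _ _ T); last by rewrite le_max lexx orbT.
  by apply: coord_le_sqsum; exact: ltW.
by rewrite frame_of_param logs_of_param.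
Qed.

End StableMinimum.

(** * Semistability and degenerations *)

Section BlockDecomposition.
Variable R : realType.

(** In the rank factorisation, cancelling the full-rank factors from P P = P leaves the identity for
    the reversed product. *)
Lemma idempotent_factor n (P : 'M[R]_n) : P *m P = P ->
  exists (f : 'M[R]_(n, \rank P)) (h : 'M[R]_(\rank P, n)),
    f *m h = P /\ h *m f = 1%:M.
Proof.
move=> PP; exists (col_base P), (row_base P); split; first exact: mulmx_base.
apply: (row_free_inj (row_base_free P)); apply: (row_full_inj (col_base_full P)).
rewrite /= mul1mx -(mulmxA (row_base P)) mulmxA.
by rewrite mulmx_base.
Qed.

Lemma rank_idempotent n (P : 'M[R]_n) : P *m P = P -> (\rank P)%:R = \tr P.
Proof.
move=> /idempotent_factor[f [h [fh hf]]].
by rewrite -[in RHS]fh mxtrace_mulC hf mxtrace1.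
Qed.

Variable Q : quiver.
Implicit Types d : dimvec Q.

(** A basis adapted to the image and kernel of [P]: invariance of the image kills the lower left
    block. The equality of [d] with the sum of dimensions is only propositional, hence the
    rectangular [g] and [g']. *)
Lemma idempotent_block d (V : rep R d) P : invariant_idempotents V P ->
  exists (d1 d2 : dimvec Q) (g : forall x, 'M[R]_(dim_sum d1 d2 x, d x))
    (g' : forall x, 'M[R]_(d x, dim_sum d1 d2 x)) V1 X V2,
  [/\ forall x, d x = dim_sum d1 d2 x,
      forall x, (d1 x)%:R = \tr (P x) :> R,
      forall x, g x *m g' x = 1%:M,
      forall x, P x = g' x *m block_mx 1%:M 0 0 0 *m g x
    & forall a, g (hd a) *m V a *m g' (tl a) = block_rep V1 X V2 a].
Proof.
move=> [PP PV].
have QQ x : (1%:M - P x) *m (1%:M - P x) = 1%:M - P x.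
  by rewrite mulmxBr mulmx1 mulmxBl mul1mx PP subrr subr0.
have [f1 /dependent_choice_fun[h1 fh1]] :=
  dependent_choice_fun (fun x => idempotent_factor (PP x)).
have [f2 /dependent_choice_fun[h2 fh2]] :=
  dependent_choice_fun (fun x => idempotent_factor (QQ x)).
pose g x : 'M[R]_(dim_sum (fun x => \rank (P x)) (fun x => \rank (1%:M - P x)) x, d x)
  := col_mx (h1 x) (h2 x).
pose g' x : 'M[R]_(d x, dim_sum (fun x => \rank (P x)) (fun x => \rank (1%:M - P x)) x)
  := row_mx (f1 x) (f2 x).
have hf12 x : h1 x *m f2 x = 0.
  have [E1 E2] := fh1 x; have [E3 E4] := fh2 x.
  rewrite -[h1 x]mul1mx -E2 -[f2 x]mulmx1 -E4 !mulmxA -(mulmxA (h1 x)) E1.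
  by rewrite -(mulmxA _ (f2 x)) E3 -(mulmxA (h1 x)) mulmxBr mulmx1 PP subrr mulmx0 mul0mx.
have hf21 x : h2 x *m f1 x = 0.
  have [E1 E2] := fh1 x; have [E3 E4] := fh2 x.
  rewrite -[h2 x]mul1mx -E4 -[f1 x]mulmx1 -E2 !mulmxA -(mulmxA (h2 x)) E3.
  by rewrite -(mulmxA _ (f1 x)) E1 -(mulmxA (h2 x)) mulmxBl mul1mx PP subrr mulmx0 mul0mx.
have gg' x : g x *m g' x = 1%:M.
  rewrite mul_col_row hf12 hf21 (proj2 (fh1 x)) (proj2 (fh2 x)).
  by rewrite -scalar_mx_block.
have g'g x : g' x *m g x = 1%:M.
  by rewrite mul_row_col (proj1 (fh1 x)) (proj1 (fh2 x)) addrC subrK.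
exists (fun x => \rank (P x)), (fun x => \rank (1%:M - P x)), g, g'.
exists (fun a => h1 (hd a) *m V a *m f1 (tl a)).
exists (fun a => h1 (hd a) *m V a *m f2 (tl a)).
exists (fun a => h2 (hd a) *m V a *m f2 (tl a)); split=> [x|x|//|x|a].
- by apply/eqP; rewrite eqn_leq (mulmx1_min (gg' x)) (mulmx1_min (g'g x)).
- exact: rank_idempotent.
- rewrite /g /g' mul_row_block mul_row_col !mulmx0 !addr0 mulmx1 mul0mx addr0.
  by rewrite (proj1 (fh1 x)).
rewrite /g /g' /block_rep mul_col_mx mul_col_row; congr block_mx.
have [E1 E2] := fh1 (tl a); have [E3 E4] := fh2 (hd a).
have -> : h2 (hd a) = h2 (hd a) *m (1%:M - P (hd a)).
  by have := congr1 (mulmx (h2 (hd a))) E3; rewrite mulmxA E4 mul1mx.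
have -> : f1 (tl a) = P (tl a) *m f1 (tl a).
  by have := congr1 (mulmx^~ (f1 (tl a))) E1; rewrite -mulmxA E2 mulmx1.
rewrite -!mulmxA (mulmxA (V a)) mulmxBl mul1mx (mulmxA (P _)) (mulmxA (P _)) PV.
by rewrite subrr mulmx0.
Qed.

End BlockDecomposition.

Section SemistableBound.
Variables (R : realType) (Q : quiver) (w : arrow Q -> R) (th : vertex Q -> R).
Hypothesis w_gt0 : forall a, 0 < w a.
Implicit Types d : dimvec Q.
Local Notation kn := (kn w th).
Local Notation kn_min := (kn_min w th).

Definition kn_bounded d (V : rep R d) : Prop :=
  exists c, forall H, posdefs H -> c <= kn V H.

Lemma weighted_dim_sum d1 d2 : weighted_dim th (dim_sum d1 d2) =
  weighted_dim th d1 + weighted_dim th d2 :> R.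
Proof. by rewrite -big_split; apply: eq_bigr => x _; rewrite natrD mulrDr. Qed.

Lemma weighted_trace_dim d1 d (P : forall x : vertex Q, 'M[R]_(d x)) :
  (forall x, (d1 x)%:R = \tr (P x)) -> weighted_trace th P = weighted_dim th d1.
Proof. by move=> h; apply: eq_bigr => x _; rewrite h. Qed.

Lemma kn_bounded_act d (A : forall x, 'M[R]_(d x)) (V : rep R d) : GL A ->
  kn_bounded V -> kn_bounded (act A V).
Proof.
move=> Au [c Vc]; exists (c - log_char th A) => H Hp.
by rewrite lerBlDr -kn_congr //; apply: Vc; exact: posdefs_congr.
Qed.

Lemma kn_bounded_block d1 d2 (V1 : rep R d1) X (V2 : rep R d2) :
  kn_bounded V1 -> kn_bounded V2 -> kn_bounded (block_rep V1 X V2).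
Proof.
move=> [c1 h1] [c2 h2]; exists (c1 + c2) => H /posdefs_schur[K [H1 [H2 [p1 p2 ->]]]].
rewrite kn_block_unipotent //; apply: le_trans (_ : kn V1 H1 + kn V2 H2 <= _).
  by rewrite lerD ?h1 ?h2.
by rewrite lerDl cross_term_ge0.
Qed.

Lemma kn_bounded_block_dim d1 d2 (V1 : rep R d1) X (V2 : rep R d2) :
  kn_bounded (block_rep V1 X V2) -> weighted_dim th d1 <= 0.
Proof.
move=> [c hc]; rewrite leNgt; apply/negP => th0.
set D := weighted_dim th d1 in th0 *.
pose A := kn V1 (fun=> 1%:M) + kn V2 (fun=> 1%:M).
pose C := cross_term w X (fun=> 1%:M) (fun=> 1%:M).
have C0 : 0 <= C by apply: cross_term_ge0 => // x; exact: posdef1.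
(* With this exponent s D = - |A + C - c| - 1, so the functional falls below the supposed bound
   [c]. *)
pose s := - ((`|A + C - c| + 1) / D).
have s0 : s <= 0 by rewrite oppr_le0 divr_ge0 ?addr_ge0 // ltW.
have /hc : posdefs (block_diags (fun x => expR s *: 1%:M) (fun=> 1%:M)
    : forall x, 'M[R]_(dim_sum d1 d2 x)).
  apply: posdefs_block; last by move=> x; exact: posdef1.
  apply: (@posdefs_scale _ _ d1 (fun=> 1%:M) _ (expR_gt0 s)) => x; exact: posdef1.
rewrite kn_block_scale ?expR_gt0 //; [|by move=> x; exact: posdef1..].
rewrite expRK -/A -/C -/D /s mulNr divfK ?gt_eqF //.
have : expR s * C <= C by rewrite ler_piMl // -expR0 ler_expR.
have := ler_norm (A + C - c); rewrite /s; lra.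
Qed.

Lemma kn_bounded_semistable d (V : rep R d) : weighted_dim th d = 0 ->
  kn_bounded V -> theta_semistable th V.
Proof.
move=> d0 Vb; split=> // P /idempotent_block[d1 [d2 [g [g' [V1 [X [V2 [e dP gg' _ gV]]]]]]]].
have {e}E : d = dim_sum d1 d2 by apply/funext.
subst d; rewrite (weighted_trace_dim dP).
have gu : GL g by move=> x; have [] := mulmx1_unit (gg' x).
apply: (@kn_bounded_block_dim d1 d2 V1 X V2).
have <- : act g V = block_rep V1 X V2; last exact: kn_bounded_act.
apply/functional_extensionality_dep => a; rewrite -gV /act; congr (_ *m _).
by rewrite -[LHS]mulmx1 -(gg' (tl a)) mulKmx //; exact: gu.
Qed.

Lemma invariant_idempotents_act d (A : forall x, 'M[R]_(d x)) (V : rep R d) P : GL A ->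
  invariant_idempotents (act A V) P ->
  let P' := fun x => invmx (A x) *m P x *m A x in
  invariant_idempotents V P' /\ weighted_trace th P = weighted_trace th P'.
Proof.
move=> Au [PP PV] P'; split; last first.
  apply: eq_bigr => x _.
  by rewrite [in RHS]mxtrace_mulC mulmxA (mulmxV (Au x)) mul1mx.
split=> [x|a].
  by rewrite /P' !mulmxA mulmxK ?Au // -(mulmxA _ (P x) (P x)) PP.
have := PV a; rewrite /P' /act => /(congr1 (fun M => invmx (A (hd a)) *m M *m A (tl a))).
rewrite !mulmxA mulVmx ?Au // mul1mx => <-.
by [].
Qed.

Lemma theta_semistable_act d (A : forall x, 'M[R]_(d x)) (V : rep R d) : GL A ->
  theta_semistable th V -> theta_semistable th (act A V).
Proof.
move=> Au [d0 Vss]; split=> // P /(invariant_idempotents_act Au)[P'V ->].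
exact: Vss.
Qed.

Lemma theta_stable_act d (A : forall x, 'M[R]_(d x)) (V : rep R d) : GL A ->
  theta_stable th V -> theta_stable th (act A V).
Proof.
move=> Au [d0 Vst]; split=> // P /(invariant_idempotents_act Au)[P'V ->] [x Px] [y Py].
apply: Vst => //; [exists x; apply: contra_neq Px|exists y; apply: contra_neq Py].
  move=> /(congr1 (fun M => A x *m M *m invmx (A x))).
  by rewrite !mulmxA mulmxV ?Au // mul1mx mulmxK ?Au // mulmx0 mul0mx.
move=> /(congr1 (fun M => A y *m M *m invmx (A y))).
by rewrite !mulmxA mulmxV ?Au // mul1mx mulmxK ?Au // mulmx1 mulmxV ?Au.
Qed.

(** A subrepresentation of the first block is one of the whole; one of the second block is enlarged
    by the full first block, which adds weight 0. *)
Lemma theta_semistable_block d1 d2 (V1 : rep R d1) X (V2 : rep R d2) :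
  weighted_dim th d1 = 0 -> theta_semistable th (block_rep V1 X V2) ->
  theta_semistable th V1 /\ theta_semistable th V2.
Proof.
move=> d10 [d0 Vss]; have d20 : weighted_dim th d2 = 0.
  by move: d0; rewrite weighted_dim_sum d10 add0r.
split; split=> // P [PP PV].
  have -> : weighted_trace th P = weighted_trace th (block_diags P (fun x => 0 : 'M[R]_(d2 x))).
    by apply: eq_bigr => x _; rewrite /block_diags mxtrace_block mxtrace0 addr0.
  apply: Vss; rewrite /block_diags /block_rep; split=> [x|a].
    by rewrite mulmx_block !(mulmx0, mul0mx, addr0) PP.
  by rewrite !mulmx_block !(mulmx0, mul0mx, addr0, add0r) PV.
have -> : weighted_trace th P = weighted_trace th (block_diags (fun x => 1%:M : 'M[R]_(d1 x)) P).
  rewrite -[LHS]add0r -d10 -big_split; apply: eq_bigr => x _ /=.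
  by rewrite /block_diags mxtrace_block mxtrace1 mulrDr.
apply: Vss; rewrite /block_diags /block_rep; split=> [x|a].
  by rewrite mulmx_block !(mulmx0, mul0mx, addr0, add0r, mulmx1) PP.
by rewrite !mulmx_block !(mulmx0, mul0mx, addr0, add0r, mulmx1, mul1mx) PV.
Qed.

(* A semistable representation that is not stable is, up to a change of basis,
   block triangular with two semistable diagonal blocks of smaller total dimension. *)
Lemma semistable_induction (Pr : forall d, rep R d -> Prop) :
  (forall d (V : rep R d), theta_stable th V -> Pr d V) ->
  (forall d (A : forall x, 'M[R]_(d x)) (V : rep R d), GL A -> Pr d (act A V) -> Pr d V) ->
  (forall d1 d2 (V1 : rep R d1) X (V2 : rep R d2), weighted_dim th d1 = 0 ->
     weighted_dim th d2 = 0 -> (exists x, 0 < d1 x)%N -> (exists x, 0 < d2 x)%N ->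
     theta_semistable th (block_rep V1 X V2) ->
     Pr d1 V1 -> Pr d2 V2 -> Pr (dim_sum d1 d2) (block_rep V1 X V2)) ->
  forall d (V : rep R d), theta_semistable th V -> Pr d V.
Proof.
move=> Pst Pact Pblk d V; have [n] := ubnP (\sum_x d x)%N.
elim: n d V => // n IH d V dn Vss.
have [Vst|Vnst] := pselect (theta_stable th V); first exact: Pst.
have [P [PV [Pn0 Pn1 P0]]] : exists P, invariant_idempotents V P /\
    [/\ exists x, P x != 0, exists x, P x != 1%:M & weighted_trace th P = 0].
  apply: contrapT => none; apply: Vnst; split; first by case: Vss.
  move=> P PV Pn0 Pn1; rewrite lt_neqAle (proj2 Vss) // andbT.
  by apply/eqP => P0; apply: none; exists P.
have [PP _] := PV.
have [d1 [d2 [g [g' [V1 [X [V2 [e dP gg' Pg gV]]]]]]]] := idempotent_block PV.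
have {e}E : d = dim_sum d1 d2 by apply/funext.
subst d; rewrite (weighted_trace_dim dP) in P0.
have gu : GL g by move=> x; have [] := mulmx1_unit (gg' x).
have gVE : act g V = block_rep V1 X V2.
  apply/functional_extensionality_dep => a; rewrite -gV /act; congr (_ *m _).
  by rewrite -[LHS]mulmx1 -(gg' (tl a)) mulKmx //; exact: gu.
have d20 : weighted_dim th d2 = 0.
  by move: (proj1 Vss); rewrite weighted_dim_sum P0 add0r.
have d1_gt0 : (exists x, 0 < d1 x)%N.
  have [x Px] := Pn0; exists x; rewrite lt0n; apply: contra_neq Px => d1x.
  have := dP x; rewrite d1x => /esym/eqP.
  by rewrite -rank_idempotent // pnatr_eq0 mxrank_eq0 => /eqP.
have d2_gt0 : (exists x, 0 < d2 x)%N.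
  have [x Px] := Pn1; exists x; rewrite lt0n; apply: contra_neq Px => d2x.
  have := dP x; rewrite -rank_idempotent // => /eqP; rewrite eqr_nat => /eqP rk.
  have : row_full (P x) by rewrite /row_full -rk /dim_sum d2x addn0.
  rewrite row_full_unit => Pu.
  by rewrite -[LHS](mulKmx Pu) PP mulVmx.
have Bss : theta_semistable th (block_rep V1 X V2).
  by rewrite -gVE; exact: theta_semistable_act.
have [ss1 ss2] := theta_semistable_block P0 Bss.
have sumE : (\sum_x dim_sum d1 d2 x = \sum_x d1 x + \sum_x d2 x)%N by rewrite -big_split.
have pos (c : dimvec Q) : (exists x, 0 < c x)%N -> (0 < \sum_x c x)%N.
  by move=> [x cx]; rewrite (bigD1 x) //= addn_gt0 cx.
move: dn; rewrite sumE ltnS => dn; have p1 := pos _ d1_gt0; have p2 := pos _ d2_gt0.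
apply: (Pact _ g) => //; rewrite gVE; apply: Pblk => //; apply: IH => //.
  by apply: leq_trans dn; rewrite -[leqLHS]addn1 leq_add2l.
by apply: leq_trans dn; rewrite -[leqLHS]add1n leq_add2r.
Qed.

Lemma theta_semistable_bounded d (V : rep R d) : theta_semistable th V -> kn_bounded V.
Proof.
apply: semistable_induction => [e W|e A W Au Wb|d1 d2 V1 X V2 _ _ _ _ _].
- by move=> /(stable_kn_min w_gt0)[H [_ Hmin]]; exists (kn W H).
- by rewrite -(actK W Au); apply: kn_bounded_act => //; exact: GL_inv.
exact: kn_bounded_block.
Qed.

End SemistableBound.

(** * Lower semicontinuity, and degenerations inside the kernel of the character *)

Section Degeneration.
Variables (R : realType) (Q : quiver) (w : arrow Q -> R) (th : vertex Q -> R).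
Hypothesis w_gt0 : forall a, 0 < w a.
Implicit Types d : dimvec Q.
Local Notation kn := (kn w th).
Local Notation rep_norm := (rep_norm w).
Local Notation kn_min := (kn_min w th).
Local Notation linear_part := (linear_part th).
Local Notation entry_weight := (entry_weight w).

Definition rep_close d (e : R) (V W : rep R d) : Prop :=
  forall a r s, `|W a r s - V a r s| < e.

Lemma conj_entry_bound m n k l (L : 'M[R]_(m, n)) (M : 'M[R]_(n, k)) (N : 'M[R]_(k, l)) e :
  (forall i j, `|M i j| <= e) ->
  forall r s, `|(L *m M *m N) r s| <= (\sum_i `|L r i|) * (\sum_j `|N j s|) * e.
Proof.
move=> Me r s; rewrite mxE; apply: le_trans (ler_norm_sum _ _ _) _.
rewrite mulrAC mulr_sumr; apply: ler_sum => j _; rewrite normrM ler_wpM2r //.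
rewrite mxE mulr_suml; apply: le_trans (ler_norm_sum _ _ _) _.
by apply: ler_sum => i _; rewrite normrM ler_wpM2l.
Qed.

Lemma mxBE m n (A B : 'M[R]_(m, n)) i j : (A - B) i j = A i j - B i j.
Proof. by rewrite !mxE. Qed.

Lemma act_close d (A : forall x : vertex Q, 'M[R]_(d x)) :
  exists2 C : R, 0 < C & forall e (V W : rep R d), rep_close e V W ->
    rep_close (C * e) (act A V) (act A W).
Proof.
pose c (z : matrix_entry d) := (\sum_i `|A (hd (tag z)) (tagged z).1 i|) *
  (\sum_j `|invmx (A (tl (tag z))) j (tagged z).2|).
have c0 z : 0 <= c z by rewrite mulr_ge0 // sumr_ge0.
exists (1 + \sum_z c z) => [|e V W VW a r s].
  by rewrite ltr_wpDr ?sumr_ge0.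
have e0 : 0 < e by apply: le_lt_trans (VW a r s).
rewrite /act.
have -> : (A (hd a) *m W a *m invmx (A (tl a))) r s -
    (A (hd a) *m V a *m invmx (A (tl a))) r s =
    (A (hd a) *m (W a - V a) *m invmx (A (tl a))) r s.
  by rewrite mulmxBr mulmxBl mxBE.
have hM i j : `|(W a - V a) i j| <= e by rewrite !mxE ltW.
apply: le_lt_trans (conj_entry_bound _ _ hM r s) _.
rewrite ltr_pM2r //; pose z : matrix_entry d := Tagged _ (r, s).
rewrite -/(c z) (bigD1 z) //= addrCA ltrDl ltr_wpDr // sumr_ge0 // => *; exact: c0.
Qed.

(** Absorb 1 - e into the exponent and use 1 + u <= e^u. The bound is uniform in x, so a relative
    error in the weights is harmless although the slopes are unbounded. *)
Lemma exp_weight_ge (e x : R) : e < 1 -> 1 + ln (1 - e) <= (1 - e) * expR x - x.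
Proof.
move=> e1; have h : 0 < 1 - e by rewrite subr_gt0.
rewrite -{2}(lnK (h : 1 - e \is Num.pos)) -expRD.
have := expR_ge1Dx (ln (1 - e) + x); lra.
Qed.

(* In a frame near a given one, each weight of W is at least (1 - e) times that of V;
   frames form a compact set, so one delta serves all of them. *)
Lemma kn_lower_semicontinuous d (V : rep R d) (e : R) : moment_zero w th V ->
  0 < e -> e < 1 -> exists2 delta : R, 0 < delta &
    forall W, rep_close delta V W -> forall H, posdefs H ->
      rep_norm V * (1 + ln (1 - e)) <= kn W H.
Proof.
move=> V0 e0 e1.
pose K := [set f : coord_space R (param d) | forall x, orthonormal (frame_of f x)] `&`
  [set f | forall z, `|f z| <= 1].
have Kc : compact K by apply: compact_box; exact: closed_orthonormal.
pose Pr (delta : R) (f : coord_space R (param d)) := forall W, rep_close delta V W ->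
  forall y, rep_norm V * (1 + ln (1 - e)) <=
    \sum_z entry_weight (rotate (frame_of f) W) z * expR (slope y z) + linear_part y.
suff hF : \forall delta \near 0^'+, K `<=` Pr delta.
  have pos : \forall delta \near 0^'+, (0 < delta) /\ (K `<=` Pr delta).
    exact: (filterI (nbhs_right_gt _) hF).
  have [delta [d0 KPr]] := @filter_ex R (0^'+) _ _ pos.
  exists delta => // W VW H /posdefs_expdiagP[k [y [kk ->]]].
  rewrite kn_expdiag //; have := KPr (param_of k (fun=> 0)).
  rewrite /Pr frame_of_param; apply => //.
  have fk x : orthonormal (frame_of (param_of k (fun=> 0)) x) by rewrite frame_of_param.
  split=> //; apply: param_bounded => // z.
  by rewrite logs_of_param mxE normr0 ler01.
(* Compactness in its near-covering form: it is enough to treat frames near a fixed [f0] together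
   with [delta] near 0. *)
have /compact_near_coveringP/near_covering_withinP cov := Kc.
apply: cov => f0 [K0 _].
pose rho (f : coord_space R (param d)) (W : rep R d) (z : matrix_entry d) :=
  rotate (frame_of f) W (tag z) (tagged z).1 (tagged z).2.
(* The total error stays below 2 eta, which leaves the factor 1 - e/2 on a nonzero entry, and (1 -
   e/2)^2 >= 1 - e. A zero entry needs no tolerance since its weight is 0. *)
pose eta z := if rho f0 V z == 0 then 1 else `|rho f0 V z| * e / 4.
have eta0 z : 0 < eta z.
  rewrite /eta; case: eqVneq => // nz; rewrite divr_gt0 // mulr_gt0 // normr_gt0 //.
(* Entries of an orthonormal frame are at most 1 in absolute value, so rotation enlarges an
   entrywise error at most by this factor. *)
pose M (z : matrix_entry d) : R := (d (hd (tag z)))%:R * (d (tl (tag z)))%:R.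
have near_frame : \forall f \near f0, forall z, `|rho f0 V z - rho f V z| < eta z.
  have FF : Filter (nbhs f0) := nbhs_filter f0.
  apply: (@filter_forall _ (matrix_entry d)
    (fun z f => `|rho f0 V z - rho f V z| < eta z) _ FF) => z.
  apply: cvgr_dist_lt => //.
  exact: (@rotate_continuous _ _ d V (tag z) (tagged z).1 (tagged z).2 f0).
have near_delta : \forall delta \near 0^'+, forall z, (M z + 1) * delta < eta z.
  apply: filter_forall => z.
  have Mz : 0 < M z + 1 by rewrite ltr_wpDl // mulr_ge0.
  near=> delta; rewrite mulrC -ltr_pdivlMr //.
  by near: delta; apply: nbhs_right_lt; rewrite divr_gt0.
near=> f delta => fK W VW y.
have hz z : `|rho f0 V z - rho f V z| < eta z /\ (M z + 1) * delta < eta z.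
  split; first by move: z; near: f; exact: near_frame.
  by move: z; near: delta; exact: near_delta.
have dp : 0 < delta by near: delta; exact: nbhs_right_gt.
have {}fK : forall x, orthonormal (frame_of f x) by case: fK.
have rhoW z : `|rho f W z - rho f V z| <= M z * delta.
  have -> : rho f W z - rho f V z = (frame_of f (hd (tag z)) *m (W (tag z) - V (tag z)) *m
      (frame_of f (tl (tag z)))^T) (tagged z).1 (tagged z).2.
    by rewrite /rho /rotate mulmxBr mulmxBl mxBE.
  have hM i j : `|(W (tag z) - V (tag z)) i j| <= delta.
    by rewrite mxBE ltW //; exact: VW.
  apply: le_trans (conj_entry_bound _ _ hM _ _) _; rewrite (ler_wpM2r (ltW dp)) //.
  rewrite /M; apply: ler_pM; rewrite ?sumr_ge0 //.
    rewrite -[X in X%:R]card_ord -sumr_const; apply: ler_sum => i _.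
    exact: orthonormal_entry_le1.
  rewrite -[X in X%:R]card_ord -sumr_const; apply: ler_sum => i _.
  by rewrite mxE; exact: orthonormal_entry_le1.
have weight_ge z : (1 - e) * entry_weight (rotate (frame_of f0) V) z <=
    entry_weight (rotate (frame_of f) W) z.
  rewrite /entry_weight -/(rho f0 V z) -/(rho f W z) mulrCA ler_pM2l //.
  have [hz1 hz2] := hz z; have hz3 := rhoW z.
  have close : `|rho f0 V z - rho f W z| < 2 * eta z.
    have -> : rho f0 V z - rho f W z = (rho f0 V z - rho f V z) - (rho f W z - rho f V z) by ring.
    apply: le_lt_trans (ler_normB _ _) _.
    have : (M z + 1) * delta = M z * delta + delta by ring.
    move: hz1 hz2 hz3 dp; lra.
  have [r0|r0] := eqVneq (rho f0 V z) 0.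
    by rewrite r0 expr0n mulr0 sqr_ge0.
  rewrite /eta (negbTE r0) in close.
  have n0 : 0 < `|rho f0 V z| by rewrite normr_gt0.
  rewrite -[rho f0 V z ^+ 2]real_normK ?num_real // -[rho f W z ^+ 2]real_normK ?num_real //.
  have : `|rho f0 V z| * (1 - e / 2) <= `|rho f W z|.
    have := lerB_dist (rho f0 V z) (rho f W z); lra.
  move=> h; apply: (@le_trans _ _ ((`|rho f0 V z| * (1 - e / 2)) ^+ 2)).
    rewrite exprMn mulrC ler_pM2l ?exprn_gt0 //; nra.
  by rewrite ler_sqr ?nnegrE // mulr_ge0 //; lra.
(* The linear part depends on [y] alone, so it may be expanded in the frame [f0] while the
   exponentials use [f]. *)
rewrite (moment_zero_slope y V0 K0) (rep_norm_rotate w V K0) mulr_suml.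
rewrite -sumrB; apply: ler_sum => z _.
apply: (@le_trans _ _ ((1 - e) * entry_weight (rotate (frame_of f0) V) z * expR (slope y z)
   - entry_weight (rotate (frame_of f0) V) z * slope y z)).
  rewrite [leRHS](_ : _ = entry_weight (rotate (frame_of f0) V) z *
    ((1 - e) * expR (slope y z) - slope y z)); last by ring.
  rewrite ler_wpM2l ?entry_weight_ge0 //; exact: exp_weight_ge.
by rewrite lerD2r ler_wpM2r ?expR_ge0.
Unshelve. all: by end_near. Qed.

Section Character.
Variable wt : vertex Q -> int.
Variable omega : R.
Hypothesis omega_gt0 : 0 < omega.
Hypothesis wtE : forall x, (wt x)%:~R = omega * th x.

Definition character d (A : forall x : vertex Q, 'M[R]_(d x)) : R :=
  \prod_x \det (A x) ^ wt x.

Lemma characterM d (A B : forall x : vertex Q, 'M[R]_(d x)) :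
  character (fun x => A x *m B x) = character A * character B.
Proof.
rewrite -big_split; apply: eq_bigr => x _ /=; by rewrite det_mulmx expfzMl.
Qed.

Lemma character1 d : character (fun x => 1%:M : 'M[R]_(d x)) = 1.
Proof. by rewrite /character big1 // => x _; rewrite det1 exp1rz. Qed.

Lemma character_conj d (A B : forall x : vertex Q, 'M[R]_(d x)) : GL A ->
  character (fun x => invmx (A x) *m B x *m A x) = character B.
Proof.
move=> Au; rewrite !characterM mulrAC -characterM.
rewrite (_ : (fun x => invmx (A x) *m A x) = fun x => 1%:M) ?character1 ?mul1r //.
by apply/functional_extensionality_dep => x; rewrite mulVmx // Au.
Qed.

Lemma character_block d1 d2 (A1 : forall x, 'M[R]_(d1 x)) (A2 : forall x, 'M[R]_(d2 x)) :
  character (block_diags A1 A2) = character A1 * character A2.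
Proof.
rewrite -big_split; apply: eq_bigr => x _ /=; rewrite /block_diags.
by rewrite det_ublock expfzMl.
Qed.

(** The power of [t] that comes out is [omega] times the weighted dimension, that is 0. *)
Lemma character_scale d (A : forall x : vertex Q, 'M[R]_(d x)) (t : R) : t != 0 ->
  weighted_dim th d = 0 -> character (fun x => t *: A x) = character A.
Proof.
move=> t0 d0; have wd0 : \sum_x (d x)%:Z * wt x = 0.
  apply/eqP; rewrite -(intr_eq0 R) rmorph_sum /=; apply/eqP.
  transitivity (omega * weighted_dim th d); last by rewrite d0 mulr0.
  rewrite mulr_sumr; apply: eq_bigr => x _.
  by rewrite rmorphM /= wtE; ring.
rewrite /character; under eq_bigr do rewrite detZ expfzMl exprnP.
rewrite big_split /=; have -> : \prod_x (t ^ (d x)%:Z) ^ wt x = 1.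
  under eq_bigr do rewrite exprz_exp.
  rewrite -(@big_morph _ _ (fun i => t ^ i) 1 *%R 0 +%R) ?wd0 ?expr0z //.
  by move=> i j; rewrite expfzDr.
by rewrite mul1r.
Qed.

(* In the block triangular case, diag(t, 1) with t -> 0 kills the off-diagonal block, and
   its character is 1 because the first block has weighted dimension 0. *)
Lemma semistable_degeneration d (V : rep R d) : theta_semistable th V ->
  exists V', (exists H, kn_min V' H) /\
   forall e : R, 0 < e -> exists A, [/\ GL A, character A = 1 & rep_close e V' (act A V)].
Proof.
apply: (semistable_induction (Pr := fun d V => exists V', (exists H, kn_min V' H) /\
   forall e : R, 0 < e -> exists A, [/\ GL A, character A = 1 & rep_close e V' (act A V)])).
- move=> {}d {}V Vst; exists V; split; first exact: stable_kn_min.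
  move=> e e0; exists (fun=> 1%:M); split; last by move=> a r s; rewrite act1 subrr normr0.
    by move=> x; exact: unitmx1.
  exact: character1.
- move=> {}d A {}V Au [V' [[H Hmin] V'cl]]; exists (act (fun x => invmx (A x)) V'); split.
    exists (fun x => (A x)^T *m H x *m A x); apply: kn_min_congr => //.
    by rewrite actKV.
  (* The degeneration of A.V is carried back by the inverse of [A], which enlarges distances by at
     most [C]; conjugating [B] by [A] keeps its character equal to 1. *)
  move=> e e0; have [C C0 hC] := act_close (fun x => invmx (A x)).
  have [B [Bu B1 BV]] := V'cl _ (divr_gt0 e0 C0).
  exists (fun x => invmx (A x) *m B x *m A x); split; last first.
  + have := hC _ _ _ BV; rewrite mulrCA divff ?gt_eqF // mulr1.
    have Aiu := GL_inv Au; rewrite [X in rep_close _ _ X -> _](_ : _ =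
      act (fun x => invmx (A x) *m B x *m A x) V) //.
    rewrite act_comp // act_comp //; last exact: GL_mul.
  + by rewrite character_conj.
  by move=> x; rewrite !unitmx_mul unitmx_inv !Au Bu.
move=> d1 d2 V1 X V2 d10 d20 _ _ _ [V1' [[H1 [p1 min1]] cl1]] [V2' [[H2 [p2 min2]] cl2]].
exists (block_rep V1' (fun=> 0) V2'); split.
  exists (block_diags H1 H2); split; first exact: posdefs_block.
  move=> H /posdefs_schur[K [G1 [G2 [q1 q2 ->]]]].
  rewrite kn_block_unipotent // kn_block //.
  rewrite [X in _ + X <= _](_ : _ = 0); last first.
    by rewrite /cross_term big1 // => a _; rewrite trmx0 !mul0mx mxtrace0 mulr0.
  by rewrite addr0 ler_wpDr ?cross_term_ge0 // lerD ?min1 ?min2.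
move=> e e0; have [A1 [u1 c1 h1]] := cl1 e e0; have [A2 [u2 c2 h2]] := cl2 e e0.
pose Y a := A1 (hd a) *m X a *m invmx (A2 (tl a)).
pose C := 1 + \sum_a \sum_r \sum_s `|Y a r s|.
have C0 : 0 < C.
  by rewrite ltr_pwDl // !sumr_ge0 // => a _; rewrite sumr_ge0 // => r _; rewrite sumr_ge0.
(* [C] exceeds every entry of the off-diagonal blocks [Y], so after scaling they are entrywise below
   [e]. *)
pose t := e / C; have t0 : 0 < t by rewrite divr_gt0.
have tu1 : GL (fun x => t *: A1 x) by move=> x; rewrite unitmxZ ?unitfE ?gt_eqF // u1.
exists (block_diags (fun x => t *: A1 x) A2); split.
- exact: GL_block.
- by rewrite character_block character_scale ?gt_eqF // c1 c2 mulr1.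
move=> a; rewrite act_block //.
have -> : act (fun x => t *: A1 x) V1 = act A1 V1.
  apply/functional_extensionality_dep => b; rewrite /act invmxZ ?tu1 //.
  by rewrite -scalemxAr -!scalemxAl scalerA mulVf ?scale1r // gt_eqF.
have small r s : `|(t *: A1 (hd a) *m X a *m invmx (A2 (tl a))) r s| < e.
  rewrite -!scalemxAl mxE -/(Y a) normrM gtr0_norm // /t -mulrA -[ltRHS]mulr1 ltr_pM2l //.
  rewrite mulrC ltr_pdivrMr // mul1r /C; apply: (@lt_le_trans _ _ (1 + `|Y a r s|)).
    by rewrite ltrDr.
  rewrite lerD2l (bigD1 a) //= ler_wpDr //; last first.
    by rewrite (bigD1 r) //= ler_wpDr ?sumr_ge0 // => [i _|];
      rewrite ?sumr_ge0 // (bigD1 s) //= lerDl sumr_ge0.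
  by rewrite sumr_ge0 // => b _; rewrite sumr_ge0 // => i _; rewrite sumr_ge0.
rewrite /block_rep => r s.
have [r' ->] : exists r' : 'I_(d1 (hd a)) + 'I_(d2 (hd a)), r = unsplit r'.
  by exists (fintype.split r); rewrite fintype.splitK.
have [s' ->] : exists s' : 'I_(d1 (tl a)) + 'I_(d2 (tl a)), s = unsplit s'.
  by exists (fintype.split s); rewrite fintype.splitK.
case: r' => i; case: s' => j /=.
- by rewrite !block_mxEul.
- by rewrite !block_mxEur [X in _ - X]mxE subr0.
- by rewrite !block_mxEdl !mxE subrr normr0.
by rewrite !block_mxEdr.
Qed.

End Character.
End Degeneration.

(** * Polystability *)

Section Polystability.
Variables (R : realType) (Q : quiver) (w : arrow Q -> R) (th : vertex Q -> R).
Hypothesis w_gt0 : forall a, 0 < w a.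
Implicit Types d : dimvec Q.
Local Notation kn := (kn w th).
Local Notation kn_min := (kn_min w th).
Local Notation moment_zero := (moment_zero w th).

(** Inclusions and projections replace block matrices here, and an arbitrary finite index type lets
    two decompositions be joined over a disjoint sum. *)
Definition stable_decomposition d (V : rep R d) (I : finType) (e : I -> dimvec Q)
    (W : forall i, rep R (e i)) : Prop :=
  exists (f : forall i x, 'M[R]_(d x, e i x)) (g : forall i x, 'M[R]_(e i x, d x)),
  [/\ forall i, theta_stable th (W i),
      forall i x, g i x *m f i x = 1%:M,
      forall i j x, i != j -> g i x *m f j x = 0,
      forall x, \sum_i f i x *m g i x = 1%:M
    & forall i a, V a *m f i (tl a) = f i (hd a) *m W i a].

Definition theta_polystable d (V : rep R d) : Prop :=
  exists (I : finType) (e : I -> dimvec Q) (W : forall i, rep R (e i)),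
    stable_decomposition V W.

Lemma kn_min_act d (A : forall x, 'M[R]_(d x)) (V : rep R d) : GL A ->
  (exists H, kn_min V H) -> exists H, kn_min (act A V) H.
Proof.
move=> Au [H Hmin]; eexists; apply: kn_min_congr; first exact: GL_inv.
by rewrite actK //; exact: Hmin.
Qed.

(** Halving the first block of the metric halves the cross term and changes nothing else, since the
    weighted dimension is 0. At a minimum the cross term is therefore 0: the extension splits and
    each block is minimal. *)
Lemma kn_min_block d1 d2 (V1 : rep R d1) X (V2 : rep R d2) H :
  weighted_dim th d1 = 0 -> kn_min (block_rep V1 X V2) H ->
  exists K H1 H2, [/\ kn_min V1 H1, kn_min V2 H2,
    H = fun x => (unipotents K x)^T *m block_diags H1 H2 x *m unipotents K x
    & forall a, X a + K (hd a) *m V2 a - V1 a *m K (tl a) = 0].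
Proof.
move=> d10 [Hp Hmin]; have [K [H1 [H2 [p1 p2 HE]]]] := posdefs_schur Hp.
rewrite HE in Hmin; set X' := fun a => X a + K (hd a) *m V2 a - V1 a *m K (tl a).
have upd G1 G2 : posdefs G1 -> posdefs G2 -> posdefs (fun x =>
    (unipotents K x)^T *m block_diags G1 G2 x *m unipotents K x).
  by move=> q1 q2; apply: posdefs_congr; [exact: GL_unipotents|exact: posdefs_block].
have C0 : cross_term w X' H1 H2 = 0.
  have half : 0 < 2^-1 :> R by rewrite invr_gt0.
  have ps := posdefs_scale half p1.
  have := Hmin _ (upd _ _ ps p2).
  rewrite kn_block_unipotent // kn_congr //; [|exact: GL_unipotents|exact: posdefs_block].
  rewrite act_unipotents kn_block_scale // log_char_unipotents d10.
  have := cross_term_ge0 w_gt0 X' p1 p2; rewrite /X'; lra.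
have X'0 a : X a + K (hd a) *m V2 a - V1 a *m K (tl a) = 0.
  exact: (cross_term_eq0 w_gt0 p1 p2 C0).
exists K, H1, H2; split=> //.
  split=> // G Gp; have := Hmin _ (upd _ _ Gp p2).
  rewrite !kn_block_unipotent // C0 addr0.
  rewrite [cross_term _ _ G _](_ : _ = 0) ?addr0 ?lerD2r //.
  by rewrite /cross_term big1 // => a _; rewrite X'0 trmx0 !mul0mx mxtrace0 mulr0.
split=> // G Gp; have := Hmin _ (upd _ _ p1 Gp).
rewrite !kn_block_unipotent // C0 addr0.
rewrite [cross_term _ _ _ G](_ : _ = 0) ?addr0 ?lerD2l //.
by rewrite /cross_term big1 // => a _; rewrite X'0 trmx0 !mul0mx mxtrace0 mulr0.
Qed.

Lemma theta_polystable_act d (A : forall x, 'M[R]_(d x)) (V : rep R d) : GL A ->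
  theta_polystable V -> theta_polystable (act A V).
Proof.
move=> Au [I [e [W [f [g [Wst gf1 gf0 fg VW]]]]]]; exists I, e, W.
exists (fun i x => A x *m f i x), (fun i x => g i x *m invmx (A x)).
split=> // [i x|i j x ij|x|i a].
- by rewrite mulmxA mulmxKV ?Au.
- by rewrite mulmxA mulmxKV ?Au // gf0.
- under eq_bigr do rewrite mulmxA -(mulmxA (A x)).
  by rewrite -mulmx_suml -mulmx_sumr fg mulmx1 mulmxV // Au.
by rewrite /act mulmxA mulmxKV ?Au // -mulmxA VW mulmxA.
Qed.

Lemma theta_polystable_block d1 d2 (V1 : rep R d1) (V2 : rep R d2) :
  theta_polystable V1 -> theta_polystable V2 ->
  theta_polystable (block_rep V1 (fun=> 0) V2).
Proof.
move=> [I1 [e1 [W1 [f1 [g1 [st1 gf1 gf01 fg1 VW1]]]]]].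
move=> [I2 [e2 [W2 [f2 [g2 [st2 gf2 gf02 fg2 VW2]]]]]].
pose e (i : I1 + I2) := match i with inl i => e1 i | inr i => e2 i end.
pose W (i : I1 + I2) : rep R (e i) := match i with inl i => W1 i | inr i => W2 i end.
pose f (i : I1 + I2) x : 'M[R]_(dim_sum d1 d2 x, e i x) :=
  match i with inl i => col_mx (f1 i x) 0 | inr i => col_mx 0 (f2 i x) end.
pose g (i : I1 + I2) x : 'M[R]_(e i x, dim_sum d1 d2 x) :=
  match i with inl i => row_mx (g1 i x) 0 | inr i => row_mx 0 (g2 i x) end.
exists (I1 + I2)%type, e, W, f, g; split.
- by case.
- by case=> i x; rewrite /f /g mul_row_col !mulmx0 ?addr0 ?add0r ?gf1 ?gf2.
- case=> i [] j x ij; rewrite /f /g mul_row_col !(mulmx0, mul0mx) ?addr0 ?add0r //.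
    by rewrite gf01.
  by rewrite gf02.
- move=> x; rewrite big_sumType /=.
  under eq_bigr do rewrite mul_col_row !(mulmx0, mul0mx).
  under [X in _ + X]eq_bigr do rewrite mul_col_row !(mulmx0, mul0mx).
  have -> : \sum_(i in I1) block_mx (f1 i x *m g1 i x) 0 0 (0 : 'M[R]_(d2 x)) =
      block_mx 1%:M 0 0 0.
    rewrite -fg1; apply/esym/(big_morph (fun M => block_mx M 0 0 0)).
      by move=> M N; rewrite add_block_mx !addr0.
    exact: block_mx_const.
  have -> : \sum_(i in I2) block_mx (0 : 'M[R]_(d1 x)) 0 0 (f2 i x *m g2 i x) =
      block_mx 0 0 0 1%:M.
    rewrite -fg2; apply/esym/(big_morph (fun M => block_mx 0 0 0 M)).
      by move=> M N; rewrite add_block_mx !addr0.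
    exact: block_mx_const.
  by rewrite add_block_mx !(addr0, add0r) -scalar_mx_block.
case=> i a; rewrite /f /W /block_rep mul_block_col mul_col_mx !(mulmx0, mul0mx) ?addr0 ?add0r.
  by rewrite VW1.
by rewrite VW2.
Qed.

(** A minimum bounds the functional, which gives semistability; in the inductive step it also splits
    the extension and passes to both blocks. *)
Lemma kn_min_polystable d (V : rep R d) : weighted_dim th d = 0 ->
  (exists H, kn_min V H) -> theta_polystable V.
Proof.
move=> d0 Vmin; have : theta_semistable th V.
  apply: (kn_bounded_semistable w_gt0 d0).
  by have [H [_ h]] := Vmin; exists (kn V H).
move: Vmin => /[swap]; move: d V {d0}.
apply: semistable_induction => [d V Vst _|d A V Au IH Vmin|d1 d2 V1 X V2 d10 d20 _ _ _ IH1 IH2 [H]].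
- exists unit, (fun=> d), (fun=> V), (fun _ _ => 1%:M), (fun _ _ => 1%:M).
  split=> [//|i x|i j x|x|i a]; rewrite ?mulmx1 ?mul1mx //.
  by rewrite big_const card_unit /= addr0.
- rewrite -(actK V Au); apply: theta_polystable_act; first exact: GL_inv.
  exact/IH/kn_min_act.
move=> /(kn_min_block d10)[K [H1 [H2 [min1 min2 _ X0]]]].
rewrite -(actK (block_rep V1 X V2) (GL_unipotents K)).
apply: theta_polystable_act; first exact/GL_inv/GL_unipotents.
rewrite act_unipotents; have -> : (fun a => X a + K (hd a) *m V2 a - V1 a *m K (tl a)) = (fun=> 0).
  exact/functional_extensionality_dep.
by apply: theta_polystable_block; [apply: IH1; exists H1|apply: IH2; exists H2].
Qed.

End Polystability.

Section PolystableMinimum.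
Variables (R : realType) (Q : quiver) (w : arrow Q -> R) (th : vertex Q -> R).
Hypothesis w_gt0 : forall a, 0 < w a.
Implicit Types d : dimvec Q.
Local Notation kn_min := (kn_min w th).
Local Notation moment_zero := (moment_zero w th).

Lemma sum_kronecker m n (I : finType) (F : I -> 'M[R]_(m, n)) (i : I) :
  (forall j, j != i -> F j = 0) -> \sum_j F j = F i.
Proof. by move=> F0; rewrite (bigD1 i) //= big1 ?addr0. Qed.

(** The [u i] exhibit [Y] as an orthogonal direct sum, so its moment at [S] is the sum of the
    moments of the summands at the compressions of [S]. *)
Lemma moment_zero_orthogonal_sum d (Y : rep R d) (I : finType) (e : I -> dimvec Q)
    (W : forall i, rep R (e i)) (u : forall i x, 'M[R]_(d x, e i x)) :
  (forall i x, (u i x)^T *m u i x = 1%:M) ->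
  (forall i j x, i != j -> (u i x)^T *m u j x = 0) ->
  (forall x, \sum_i u i x *m (u i x)^T = 1%:M) ->
  (forall i a, Y a *m u i (tl a) = u i (hd a) *m W i a) ->
  (forall i, moment_zero (W i)) -> moment_zero Y.
Proof.
move=> uu1 uu0 uuT YW W0 S Ssym.
have trE x (M : 'M[R]_(d x)) : \tr M = \sum_i \tr ((u i x)^T *m M *m u i x).
  rewrite -[in LHS](mulmx1 M) -uuT mulmx_sumr raddf_sum /=.
  by apply: eq_bigr => i _; rewrite mulmxA mxtrace_mulC mulmxA.
have uY i a : (u i (hd a))^T *m Y a = W i a *m (u i (tl a))^T.
  rewrite -[LHS]mulmx1 -uuT mulmx_sumr (@sum_kronecker _ _ _ _ i) => [|j ji].
    by rewrite !mulmxA -(mulmxA _ (Y a)) YW mulmxA uu1 mul1mx.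
  by rewrite !mulmxA -(mulmxA _ (Y a)) YW mulmxA uu0 1?eq_sym // !mul0mx.
pose Si i x := (u i x)^T *m S x *m u i x.
have Sisym i x : (Si i x)^T = Si i x by rewrite /Si !trmx_mul trmxK Ssym mulmxA.
suff -> : moment w th Y S = \sum_i moment w th (W i) (Si i).
  by rewrite big1 // => i _; exact: W0.
rewrite big_split /= exchange_big [X in _ = _ + X]exchange_big /=; congr (_ + _).
  apply: eq_bigr => a _; rewrite -mulr_sumr sumrB; congr (_ * (_ - _)).
    rewrite trE; apply: eq_bigr => i _; congr mxtrace.
    by rewrite -!mulmxA YW !mulmxA -trmx_mul YW trmx_mul.
  rewrite trE; apply: eq_bigr => i _; congr mxtrace.
  by rewrite !mulmxA -trmx_mul YW trmx_mul -(mulmxA _ _ (Y a)) uY /Si !mulmxA.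
by apply: eq_bigr => x _; rewrite -mulr_sumr trE.
Qed.

(** Each stable summand is made critical by some [B i]. The metric [H] makes the summands orthogonal
    and restricts to the Gram matrix of [B i] on each, so a Gram factor [A] of [H] turns A.V into an
    orthogonal sum of critical representations. *)
Lemma theta_polystable_min d (V : rep R d) : theta_polystable th V ->
  exists2 A, GL A & moment_zero (act A V).
Proof.
move=> [I [e [W [f [g [Wst gf1 gf0 fg VW]]]]]].
have h i : exists B, GL B /\ moment_zero (act B (W i)).
  have /kn_min_ex[//|B Bu W0] := stable_kn_min w_gt0 (Wst i).
  by exists B.
have [B hB] := dependent_choice_fun h.
have Bu i x : B i x \in unitmx by have [h' _] := hB i; exact: h'.
pose G i x := (B i x)^T *m B i x.
pose H x := \sum_i (g i x)^T *m G i x *m g i x.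
have Hp : posdefs H.
  move=> x; split.
    rewrite /H raddf_sum; apply: eq_bigr => i _ /=.
    by rewrite !trmx_mul !trmxK mulmxA.
  move=> v v0; rewrite /H mulmx_sumr mulmx_suml summxE.
  have pos i : 0 <= (v^T *m ((g i x)^T *m G i x *m g i x) *m v) 0 0.
    have -> : v^T *m ((g i x)^T *m G i x *m g i x) *m v =
        (B i x *m g i x *m v)^T *m (B i x *m g i x *m v).
      by rewrite !trmx_mul !mulmxA.
    by rewrite mxE sumr_ge0 // => k _; rewrite mxE -expr2 sqr_ge0.
  rewrite lt_neqAle sumr_ge0 // andbT; apply: contra_neq v0 => /esym/eqP.
  rewrite psumr_eq0 // => /allP z; rewrite -[v]mul1mx -fg mulmx_suml big1 // => i _.
  have /eqP zi := z i (mem_index_enum _).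
  have [gv|gv] := eqVneq (g i x *m v) 0; first by rewrite -mulmxA gv mulmx0.
  have := proj2 (posdef_gram (Bu i x)) _ gv.
  by move: zi; rewrite /G trmx_mul !mulmxA => ->; rewrite ltxx.
have [A Au HA] := posdefs_gramP Hp.
exists A => //; pose u i x := A x *m f i x *m invmx (B i x).
have fHf i j x : (f i x)^T *m H x *m f j x = (g i x *m f i x)^T *m G i x *m (g i x *m f j x).
  rewrite /H mulmx_sumr mulmx_suml (@sum_kronecker _ _ _ _ i) => [|k ki].
    by rewrite !trmx_mul !mulmxA.
  rewrite !mulmxA -trmx_mul gf0 // trmx0 !mul0mx //.
have uuE i j x : (u i x)^T *m u j x =
    (invmx (B i x))^T *m ((f i x)^T *m H x *m f j x) *m invmx (B j x).
  by rewrite /u HA !trmx_mul !mulmxA.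
have uu1 i x : (u i x)^T *m u i x = 1%:M.
  rewrite uuE fHf gf1 trmx1 mul1mx mulmx1 /G mulmxA -trmx_mul mulmxV //.
  by rewrite trmx1 mul1mx mulmxV.
have uu0 i j x : i != j -> (u i x)^T *m u j x = 0.
  by move=> ij; rewrite uuE fHf (gf0 i j) // !mulmx0 mul0mx.
apply: (@moment_zero_orthogonal_sum _ _ I e (fun i => act (B i) (W i)) u) => //.
(* [Z] fixes the images of all A f_j, which together span the space. *)
- move=> x; set Z := \sum_i _.
  have ZA : Z *m A x = A x.
    rewrite -[Z *m A x]mulmx1 -[in RHS](mulmx1 (A x)) -fg !mulmx_sumr; apply: eq_bigr => j _.
    rewrite !mulmxA; congr (_ *m _).
    have Af : A x *m f j x = u j x *m B j x by rewrite /u mulmxKV.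
    rewrite -mulmxA Af mulmxA; congr (_ *m _).
    rewrite /Z mulmx_suml (@sum_kronecker _ _ _ _ j) => [|k kj].
      by rewrite -mulmxA uu1 mulmx1.
    by rewrite -mulmxA uu0 // mulmx0.
  by rewrite -[Z](mulmxK (Au x)) ZA mulmxV // Au.
- move=> i a; rewrite /u /act !mulmxA mulmxKV ?Au //.
  by rewrite -(mulmxA _ (V a)) VW !mulmxA mulmxKV.
by move=> i; have [] := hB i.
Qed.

End PolystableMinimum.

Section DirectSum.
Variables (R : realType) (Q : quiver).
Implicit Types d : dimvec Q.

(** The block columns and rows of an isomorphism are the inclusions and projections; the casts in
    [direct_sum] are eliminated here once and for all. *)
Lemma direct_sum_decomposition d (V : rep R d) k (e : 'I_k -> dimvec Q)
    (W : forall i, rep R (e i)) : rep_iso V (direct_sum W) <->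
  exists (f : forall i x, 'M[R]_(d x, e i x)) (g : forall i x, 'M[R]_(e i x, d x)),
  [/\ forall i x, g i x *m f i x = 1%:M,
      forall i j x, i != j -> g i x *m f j x = 0,
      forall x, \sum_i f i x *m g i x = 1%:M
    & forall i a, V a *m f i (tl a) = f i (hd a) *m W i a].
Proof.
have dsE (f : forall i x, 'M[R]_(d x, e i x)) a :
    \mxrow_i f i (hd a) *m direct_sum W a = \mxrow_i (f i (hd a) *m W i a).
  rewrite /direct_sum mul_mxrow_mxblock; apply: eq_mxrow => j.
  rewrite (@sum_kronecker _ _ _ _ _ j) => [|i ij]; first by rewrite eqxx conform_mx_id.
  by rewrite (negbTE ij) mulmx0.
have oneE x : \mxblock_(i, j) (if i == j then conform_mx 0 (1%:M : 'M[R]_(e i x)) else 0)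
    = 1%:M :> 'M[R]_(\sum_i e i x).
  exact: (mxdiagZ 1).
split=> [[F [G [GF FG FV]]]|[f [g [gf1 gf0 fg VW]]]].
  exists (fun i x => submxrow (G x) i), (fun i x => submxcol (F x) i).
  have gf i j x : submxcol (F x) i *m submxrow (G x) j =
      if i == j then conform_mx 0 (1%:M : 'M[R]_(e i x)) else 0.
    move: i j; apply/eq_mxblockP; rewrite -mul_mxcol_mxrow submxcolK submxrowK.
    by rewrite oneE; exact: FG.
  split=> [i x|i j x ij|x|].
  - by rewrite gf eqxx conform_mx_id.
  - by rewrite gf (negbTE ij).
  - by rewrite -mul_mxrow_mxcol submxcolK submxrowK; exact: GF.
  move=> i a; move: i; apply/eq_mxrowP.
  rewrite -mul_mxrow submxrowK -(dsE (fun i x => submxrow (G x) i)) submxrowK.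
  rewrite -[V a]mul1mx -(GF (hd a)) -(mulmxA (G _)) FV -!mulmxA.
  by rewrite (FG (tl a)) mulmx1.
exists (fun x => \mxcol_i g i x), (fun x => \mxrow_i f i x).
have GF x : \mxrow_i f i x *m \mxcol_i g i x = 1%:M.
  by rewrite mul_mxrow_mxcol; exact: fg.
have FG x : \mxcol_i g i x *m \mxrow_i f i x = 1%:M.
  rewrite mul_mxcol_mxrow -oneE; apply: eq_mxblock => i j.
  have [<-|ij] := eqVneq i j; first by rewrite conform_mx_id.
  by rewrite gf0.
split=> // a.
have VG : V a *m \mxrow_i f i (tl a) = \mxrow_i f i (hd a) *m direct_sum W a.
  by rewrite dsE mul_mxrow; apply: eq_mxrow => i; exact: VW.
rewrite -[LHS]mulmx1 -(GF (tl a)) !mulmxA -(mulmxA _ (V a)) VG !mulmxA.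
by rewrite (FG (hd a)) mul1mx.
Qed.

Lemma theta_polystableP th d (V : rep R d) : theta_polystable th V <->
  exists (k : nat) (e : 'I_k -> dimvec Q) (W : forall i, rep R (e i)),
    (forall i, theta_stable th (W i)) /\ rep_iso V (direct_sum W).
Proof.
split=> [[I [e [W [f [g [Wst gf1 gf0 fg VW]]]]]]|[k [e [W [Wst /direct_sum_decomposition]]]]].
  exists #|I|, (fun i => e (enum_val i)), (fun i => W (enum_val i)); split=> //.
  apply/direct_sum_decomposition.
  exists (fun i => f (enum_val i)), (fun i => g (enum_val i)); split=> //.
  - by move=> i j x ij; apply: gf0; apply: contra_neq ij; exact: enum_val_inj.
  - move=> x; rewrite -[RHS]fg [RHS](@reindex _ _ _ _ 'I_#|I| (@enum_val I I)) //.
    exact/onW_bij/enum_val_bij.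
move=> [f [g [gf1 gf0 fg VW]]]; exists 'I_k, e, W, f, g; split=> //.
Qed.

End DirectSum.

(** * Bipartite quivers *)

Section Projectors.
Variable R : realType.

(** [f] has a basis of [U] as columns and [h] reads the coordinates of the projection onto [U];
    since h f = 1, the product f h is a projector of trace dim U. *)
Lemma vspace_projector k (U : {vspace 'cV[R]_k}) : exists P : 'M[R]_k,
  [/\ P *m P = P, forall u, (u \in U) <-> P *m u = u & \tr P = (\dim U)%:R].
Proof.
pose b := vbasis U; have bU : basis_of U b := vbasisP U.
pose f : 'M[R]_(k, \dim U) := \matrix_(r, i) b`_i r 0.
pose h : 'M[R]_(\dim U, k) := \matrix_(i, s) coord b i (projv U (delta_mx s 0)).
have hE (u : 'cV[R]_k) i : (h *m u) i 0 = coord b i (projv U u).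
  rewrite mxE [in RHS](matrix_sum_delta u) !linear_sum /=; apply: eq_bigr => s _.
  by rewrite big_ord1 mxE mulrC !linearZ.
have fE (v : 'cV[R]_(\dim U)) : f *m v = \sum_i v i 0 *: b`_i.
  apply/colP => r; rewrite mxE summxE; apply: eq_bigr => i _.
  by rewrite !mxE mulrC.
have hf : h *m f = 1%:M.
  apply/matrixP => i j; have := hE (col j f) i.
  have -> : col j f = b`_j by apply/colP => r; rewrite !mxE.
  rewrite projv_id ?(coord_free _ _ (basis_free bU)); last first.
    by rewrite vbasis_mem // mem_nth // size_tuple.
  by move=> E; rewrite [RHS]mxE eq_sym -E !mxE; apply: eq_bigr => l _; rewrite !mxE.
exists (f *m h); split.
- by rewrite mulmxA -(mulmxA f) hf mulmx1.
- move=> u; split=> [uU|<-].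
    rewrite -mulmxA fE; under eq_bigr do rewrite hE projv_id //.
    by rewrite -coord_vbasis.
  rewrite -mulmxA fE; apply: memv_suml => i _; apply: memvZ.
  by rewrite vbasis_mem // mem_nth // size_tuple.
by rewrite mxtrace_mulC hf mxtrace1.
Qed.

Lemma mulmx_ext m n (A B : 'M[R]_(m, n)) : (forall u : 'cV_n, A *m u = B *m u) -> A = B.
Proof.
move=> h; apply/matrixP => i j; have /colP/(_ i) := h (delta_mx j 0).
by rewrite -!colE !mxE.
Qed.

Lemma projector_vspace k (P : 'M[R]_k) : P *m P = P -> exists U : {vspace 'cV[R]_k},
  (forall u, (u \in U) <-> P *m u = u) /\ (\dim U)%:R = \tr P.
Proof.
move=> PP; pose U : {vspace 'cV[R]_k} := limg (linfun (mulmx P : 'cV_k -> 'cV_k)).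
have UP u : (u \in U) <-> P *m u = u.
  split=> [/memv_imgP[v _ ->]|Pu]; first by rewrite lfunE /= mulmxA PP.
  by apply/memv_imgP; exists u; rewrite ?memvf // lfunE.
exists U; split => //; have [P' [PP' UP' <-]] := vspace_projector U.
(* The two projectors have the same image, so each fixes the other from the left and their traces
   agree. *)
have E1 : P *m P' = P'.
  by apply: mulmx_ext => u; rewrite -mulmxA; apply/UP/UP'; rewrite mulmxA PP'.
have E2 : P' *m P = P.
  by apply: mulmx_ext => u; rewrite -mulmxA; apply/UP'/UP; rewrite mulmxA PP.
by rewrite -E1 mxtrace_mulC E2.
Qed.

Variable Q : quiver.

Lemma subrep_idempotents (d : dimvec Q) (V : rep R d)
    (U : forall x : vertex Q, {vspace 'cV[R]_(d x)}) (P : forall x, 'M[R]_(d x)) :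
  (forall x, P x *m P x = P x) ->
  (forall x u, (u \in U x) <-> P x *m u = u) ->
  [/\ subrep V U <-> invariant_idempotents V P,
      forall x, (U x != 0%VS) = (P x != 0)
    & forall x, (U x != fullv) = (P x != 1%:M)].
Proof.
move=> PP UP; split.
- split=> [UV|[_ PV] a u /UP Pu]; last first.
    by apply/UP; rewrite -Pu !mulmxA PV.
  split=> // a; apply: mulmx_ext => u; rewrite -!mulmxA; apply/UP/UV/UP.
  by rewrite mulmxA PP.
- move=> x; congr negb; apply/eqP/eqP => [U0|P0].
    apply: mulmx_ext => u; rewrite mul0mx.
    have /UP : P x *m (P x *m u) = P x *m u by rewrite mulmxA PP.
    by rewrite U0 memv0 => /eqP.
  apply/vspaceP => u; rewrite memv0; apply/idP/eqP => [/UP <-|->]; last by rewrite mem0v.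
  by rewrite P0 mul0mx.
move=> x; congr negb; apply/eqP/eqP => [U1|P1].
  by apply: mulmx_ext => u; rewrite mul1mx; apply/UP; rewrite U1 memvf.
by apply/vspaceP => u; rewrite memvf; apply/UP; rewrite P1 mul1mx.
Qed.

End Projectors.

Section BipartiteStability.
Variables (R : realType) (n m : nat) (arr : 'I_n -> 'I_m -> finType).
Notation Q := (bipartite arr).
Variable p : 'I_m -> rat.
Hypothesis p_gt0 : forall j, 0 < p j.
Implicit Types d : dimvec Q.

Definition bp_theta (x : vertex Q) : R :=
  match x with inl _ => 1 | inr j => - ratr (p j) end.

Definition bp_weight (a : arrow Q) : R := ratr (p (tag a).2).

Lemma bp_weight_gt0 a : 0 < bp_weight a.
Proof. by rewrite ltr0q. Qed.

Lemma sum_bp_theta (F : vertex Q -> R) :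
  \sum_x bp_theta x * F x = \sum_i F (inl i) - \sum_j ratr (p j) * F (inr j).
Proof.
rewrite big_sumType /= -sumrN; congr (_ + _); apply: eq_bigr => i _.
  by rewrite mul1r.
by rewrite mulNr.
Qed.

Lemma sum_bp_theta_nat (c : vertex Q -> nat) :
  \sum_x bp_theta x * (c x)%:R = ratr (\sum_i (c (inl i))%:R -
    \sum_j p j * (c (inr j))%:R) :> R.
Proof.
rewrite (sum_bp_theta (fun x => (c x)%:R)) rmorphB !rmorph_sum /=; congr (_ - _).
  by apply: eq_bigr => i _; rewrite ratr_nat.
by apply: eq_bigr => j _; rewrite rmorphM /= ratr_nat.
Qed.

Lemma orthogonal_dimP d : orthogonal_dim p d <-> weighted_dim bp_theta d = 0.
Proof.
rewrite /weighted_dim sum_bp_theta_nat; split=> [h|/eqP].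
  by rewrite h subrr rmorph0.
by rewrite fmorph_eq0 subr_eq0 => /eqP.
Qed.

Lemma weighted_trace_vspace d (U : forall x : vertex Q, {vspace 'cV[R]_(d x)})
    (P : forall x, 'M[R]_(d x)) :
  (forall x, \tr (P x) = (\dim (U x))%:R) -> weighted_trace bp_theta P =
  ratr (\sum_i (\dim (U (inl i)))%:R - \sum_j p j * (\dim (U (inr j)))%:R).
Proof.
move=> tP; rewrite -(sum_bp_theta_nat (fun x => \dim (U x))).
by apply: eq_bigr => x _; rewrite tP.
Qed.

Lemma vspace_projectors d (U : forall x : vertex Q, {vspace 'cV[R]_(d x)}) :
  exists P : forall x, 'M[R]_(d x), [/\ forall x, P x *m P x = P x,
    forall x u, (u \in U x) <-> P x *m u = u & forall x, \tr (P x) = (\dim (U x))%:R].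
Proof.
have [P hP] := dependent_choice_fun (fun x => vspace_projector (U x)).
by exists P; split=> x; have [] := hP x.
Qed.

Lemma projector_vspaces d (P : forall x : vertex Q, 'M[R]_(d x)) :
  (forall x, P x *m P x = P x) -> exists U : forall x : vertex Q, {vspace 'cV[R]_(d x)},
    (forall x u, (u \in U x) <-> P x *m u = u) /\ (forall x, \tr (P x) = (\dim (U x))%:R).
Proof.
move=> PP; have [U hU] := dependent_choice_fun (fun x => projector_vspace (PP x)).
by exists U; split=> x; have [] := hU x.
Qed.

Lemma semistableP d (V : rep R d) : semistable p V <-> theta_semistable bp_theta V.
Proof.
split=> [[d0 ss]|[d0 ss]]; split; try exact/orthogonal_dimP.
  move=> P [PP PV]; have [U [UP dimU]] := projector_vspaces PP.
  rewrite (weighted_trace_vspace dimU) lerq0 subr_le0; apply: ss.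
  by have [sub _ _] := subrep_idempotents V PP UP; apply/sub.
move=> U UV; have [P [PP UP dimU]] := vspace_projectors U.
rewrite -subr_le0 -(lerq0 R) -(weighted_trace_vspace dimU); apply: ss.
by have [sub _ _] := subrep_idempotents V PP UP; apply/sub.
Qed.

Lemma stableP d (V : rep R d) : stable p V <-> theta_stable bp_theta V.
Proof.
split=> [[d0 ss]|[d0 ss]]; split; try exact/orthogonal_dimP.
  move=> P [PP PV] [x Px] [y Py]; have [U [UP dimU]] := projector_vspaces PP.
  have [sub U0 U1] := subrep_idempotents V PP UP.
  rewrite (weighted_trace_vspace dimU) ltrq0 subr_lt0; apply: ss; first exact/sub.
    by exists x; rewrite U0.
  by exists y; rewrite U1.
move=> U UV [x Ux] [y Uy]; have [P [PP UP dimU]] := vspace_projectors U.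
have [sub U0 U1] := subrep_idempotents V PP UP.
rewrite -subr_lt0 -(ltrq0 R) -(weighted_trace_vspace dimU); apply: ss; first exact/sub.
  by exists x; rewrite -U0.
by exists y; rewrite -U1.
Qed.

Lemma polystableP d (V : rep R d) : polystable p V <-> theta_polystable bp_theta V.
Proof.
split=> [[k [e [W [Wst iso]]]]|/theta_polystableP[k [e [W [Wst iso]]]]].
  by apply/theta_polystableP; exists k, e, W; split=> // i; apply/stableP.
by exists k, e, W; split=> // i; apply/stableP.
Qed.

Lemma sum_arrow (F : arrow Q -> R) :
  \sum_a F a = \sum_i \sum_j \sum_(a : arr i j) F (arrow_of a).
Proof.
rewrite pair_bigA /= (sig_big_dep xpredT (fun _ => xpredT)
  (fun ij (a : arr ij.1 ij.2) => F (arrow_of a))).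
by apply: eq_bigr => -[[i j] a].
Qed.

Definition source_form d (V : rep R d) (Y : forall j, 'M[R]_(d (inr j))) (i : 'I_n) :
    'M[R]_(d (inl i)) :=
  \sum_(j < m) ratr (p j) *: \sum_(a : arr i j) (entry V a)^T *m Y j *m entry V a.

Definition sink_gram d (V : rep R d) (j : 'I_m) : 'M[R]_(d (inr j)) :=
  \sum_(i < n) \sum_(a : arr i j) entry V a *m (entry V a)^T.

Lemma tr_source_form d (V : rep R d) Y i (Z : 'M[R]_(d (inl i))) :
  \tr (source_form V Y i *m Z) = \sum_j \sum_(a : arr i j)
    ratr (p j) * \tr ((entry V a)^T *m Y j *m entry V a *m Z).
Proof.
rewrite mulmx_suml raddf_sum /=; apply: eq_bigr => j _.
rewrite -scalemxAl linearZ /= mulmx_suml raddf_sum mulr_sumr.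
by apply: eq_bigr => a _.
Qed.

Lemma kn_bipartite d (V : rep R d) H :
  kn bp_weight bp_theta V H =
  \sum_i \tr (source_form V (fun j => H (inr j)) i *m invmx (H (inl i)))
  + (\sum_i ln (\det (H (inl i))) - \sum_j ratr (p j) * ln (\det (H (inr j)))).
Proof.
rewrite /kn (sum_bp_theta (fun x => ln (\det (H x)))); congr (_ + _).
rewrite sum_arrow; apply: eq_bigr => i _; rewrite tr_source_form.
by apply: eq_bigr => j _; apply: eq_bigr => a _.
Qed.

(** Here the choice of weights pays off: the sink and source components are the defects of the two
    geometric equations. *)
Lemma moment_bipartite d (V : rep R d) S :
  moment bp_weight bp_theta V S =
  \sum_j ratr (p j) * \tr (S (inr j) *m (sink_gram V j - 1%:M))
  - \sum_i \tr ((source_form V (fun=> 1%:M) i - 1%:M) *m S (inl i)).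
Proof.
rewrite /moment (sum_bp_theta (fun x => \tr (S x))) sum_arrow.
have -> : \sum_j ratr (p j) * \tr (S (inr j) *m (sink_gram V j - 1%:M)) =
    \sum_i \sum_j \sum_(a : arr i j) ratr (p j) *
      \tr ((entry V a)^T *m S (inr j) *m entry V a)
    - \sum_j ratr (p j) * \tr (S (inr j)).
  rewrite exchange_big -sumrB; apply: eq_bigr => j _ /=.
  rewrite mulmxBr mulmx1 linearB mulrBr /=; congr (_ - _).
  rewrite mulmx_sumr raddf_sum mulr_sumr; apply: eq_bigr => i _ /=.
  rewrite mulmx_sumr raddf_sum mulr_sumr; apply: eq_bigr => a _ /=.
  by rewrite mulmxA mxtrace_mulC mulmxA.
have -> : \sum_i \tr ((source_form V (fun=> 1%:M) i - 1%:M) *m S (inl i)) =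
    \sum_i \sum_j \sum_(a : arr i j) ratr (p j) *
      \tr ((entry V a)^T *m entry V a *m S (inl i)) - \sum_i \tr (S (inl i)).
  rewrite -sumrB; apply: eq_bigr => i _.
  rewrite mulmxBl mul1mx linearB /= tr_source_form; congr (_ - _).
  by apply: eq_bigr => j _; apply: eq_bigr => a _; rewrite mulmx1.
have -> : \sum_i \sum_j \sum_(a : arr i j) bp_weight (arrow_of a) *
     (\tr ((V (arrow_of a))^T *m S (hd (arrow_of a)) *m V (arrow_of a)) -
      \tr ((V (arrow_of a))^T *m V (arrow_of a) *m S (tl (arrow_of a)))) =
   \sum_i \sum_j \sum_(a : arr i j) ratr (p j) *
      \tr ((entry V a)^T *m S (inr j) *m entry V a)
   - \sum_i \sum_j \sum_(a : arr i j) ratr (p j) *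
      \tr ((entry V a)^T *m entry V a *m S (inl i)).
  rewrite -sumrB; apply: eq_bigr => i _; rewrite -sumrB; apply: eq_bigr => j _.
  by rewrite -sumrB; apply: eq_bigr => a _; rewrite -mulrBr.
ring.
Qed.

Lemma source_form_sym d (V : rep R d) Y i : (forall j, (Y j)^T = Y j) ->
  (source_form V Y i)^T = source_form V Y i.
Proof.
move=> Ysym; rewrite /source_form raddf_sum; apply: eq_bigr => j _ /=.
rewrite linearZ /= raddf_sum; congr (_ *: _); apply: eq_bigr => a _ /=.
by rewrite !trmx_mul trmxK Ysym mulmxA.
Qed.

Lemma sink_gram_sym d (V : rep R d) j : (sink_gram V j)^T = sink_gram V j.
Proof.
rewrite /sink_gram raddf_sum; apply: eq_bigr => i _ /=.
rewrite raddf_sum; apply: eq_bigr => a _ /=.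
by rewrite !trmx_mul trmxK.
Qed.

Lemma source_form1 d (V : rep R d) i : source_form V (fun=> 1%:M) i =
  \sum_(j < m) ratr (p j) *: \sum_(a : arr i j) (entry V a)^T *m entry V a.
Proof.
apply: eq_bigr => j _; congr (_ *: _); apply: eq_bigr => a _; by rewrite mulmx1.
Qed.

Lemma geometricP d (V : rep R d) :
  Defs.geometric p V <-> moment_zero bp_weight bp_theta V.
Proof.
split=> [[g1 g2] S _|V0].
  rewrite moment_bipartite [X in X - _]big1 ?[X in _ - X]big1 ?subrr // => i _.
    by rewrite source_form1 g1 subrr mul0mx mxtrace0.
  by rewrite /sink_gram g2 subrr mulmx0 mxtrace0 mulr0.
(* Testing the moment in the direction of the defects themselves yields a positive combination of
   their squared norms. *)
pose S (x : vertex Q) : 'M[R]_(d x) := match x with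
  | inl i => 1%:M - source_form V (fun=> 1%:M) i
  | inr j => sink_gram V j - 1%:M
  end.
have Ssym x : (S x)^T = S x.
  case: x => [i|j] /=; rewrite linearB /= trmx1 ?sink_gram_sym //.
  by rewrite source_form_sym // => j; rewrite trmx1.
have := V0 S Ssym; rewrite moment_bipartite.
have -> : \sum_j ratr (p j) * \tr (S (inr j) *m (sink_gram V j - 1%:M)) =
    \sum_j ratr (p j) * \tr ((S (inr j))^T *m S (inr j)).
  by apply: eq_bigr => j _; rewrite Ssym.
have -> : - (\sum_i \tr ((source_form V (fun=> 1%:M) i - 1%:M) *m S (inl i))) =
    \sum_i \tr ((S (inl i))^T *m S (inl i)).
  rewrite -sumrN; apply: eq_bigr => i _; rewrite Ssym -raddfN /= -mulNmx.
  by rewrite opprB.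
have q0 (j : 'I_m) : 0 < ratr (p j) :> R by rewrite ltr0q.
move/eqP; rewrite paddr_eq0; [|rewrite sumr_ge0 // => j _..]; last exact: tr_gram_ge0.
  move=> /andP[/eqP s1 /eqP s2]; split=> [i|j].
    move/eqP: s2; rewrite psumr_eq0 => [/allP/(_ i (mem_index_enum _))/eqP|k _];
      last exact: tr_gram_ge0.
    by move=> /tr_gram_eq0/eqP; rewrite subr_eq0 source_form1 => /eqP.
  move/eqP: s1; rewrite psumr_eq0 => [/allP/(_ j (mem_index_enum _))|k _]; last first.
    by rewrite mulr_ge0 ?tr_gram_ge0 // ltW.
  rewrite mulf_eq0 gt_eqF //= => /eqP/tr_gram_eq0/eqP.
  by rewrite subr_eq0 => /eqP.
by rewrite mulr_ge0 ?tr_gram_ge0 // ltW.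
Qed.

End BipartiteStability.

(** * The Brascamp-Lieb constant *)

Section Semidefinite.
Variable R : realType.

(** Source forms may be degenerate, which is the case of an infinite value in the supremum. *)
Definition psd k (M : 'M[R]_k) : Prop :=
  M^T = M /\ forall u : 'cV[R]_k, 0 <= (u^T *m M *m u) 0 0.

Lemma posdef_psd k (M : 'M[R]_k) : posdef M -> psd M.
Proof.
move=> [Msym Mpos]; split=> // u; have [->|u0] := eqVneq u 0.
  by rewrite mulmx0 mxE.
by apply: ltW; exact: Mpos.
Qed.

Lemma psd_spectral k (M : 'M[R]_k) : psd M -> exists (K : 'M[R]_k) (y : 'rV[R]_k),
  [/\ orthonormal K, M = K^T *m diag_mx y *m K & forall i, 0 <= y 0 i].
Proof.
move=> [Msym Mpos]; have [K [y [KK ME]]] := symmetric_spectral Msym.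
exists K, y; split=> // i; have := Mpos (K^T *m delta_mx i 0).
rewrite ME trmx_mul trmxK !mulmxA -(mulmxA _ K) KK mulmx1.
rewrite -(mulmxA _ K) KK mulmx1 quad_diag (bigD1 i) //= big1 ?addr0 => [|j ji].
  by rewrite !mxE !eqxx expr1n mulr1.
by rewrite !mxE (negbTE ji) expr0n mulr0.
Qed.

Lemma det_conj_diag k (K : 'M[R]_k) y : orthonormal K ->
  \det (K^T *m diag_mx y *m K) = \prod_i y 0 i.
Proof.
move=> KK; rewrite !det_mulmx det_tr mulrAC -{1}(det_tr K) -det_mulmx.
by rewrite orthonormal_trK // det1 mul1r det_diag.
Qed.

Lemma psd_det k (M : 'M[R]_k) : psd M ->
  0 <= \det M /\ (\det M != 0 -> posdef M).
Proof.
move=> /psd_spectral[K [y [KK -> y0]]]; rewrite det_conj_diag //; split.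
  by rewrite prodr_ge0.
move=> /prodf_neq0 yn0; apply: (@posdef_congr _ _ _ _ K K^T); last exact: orthonormal_trK.
by apply: posdef_diag => i; rewrite lt_neqAle eq_sym yn0 ?y0.
Qed.

Lemma psd_add_posdef k (M N : 'M[R]_k) : psd M -> posdef N -> posdef (M + N).
Proof.
move=> [Ms Mp] [Ns Np]; split; first by rewrite linearD /= Ms Ns.
move=> u u0; rewrite mulmxDr mulmxDl mxE ltr_wpDl ?Mp //; exact: Np.
Qed.

Lemma scalar_posdef k (e : R) : 0 < e -> posdef (e%:M : 'M[R]_k).
Proof. by move=> e0; rewrite -diag_const_mx; apply: posdef_diag => i; rewrite mxE. Qed.

Lemma det_shift_continuous k (M : 'M[R]_k) : continuous (fun e : R => \det (M + e%:M)).
Proof.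
have -> : (fun e : R => \det (M + e%:M)) = (fun e : R => \sum_(s : {perm 'I_k})
    (-1) ^+ s * \prod_i (M i (s i) + e *+ (i == s i))).
  apply/funext => e; apply: eq_bigr => s _; congr (_ * _).
  by apply: eq_bigr => i _; rewrite !mxE.
apply: continuous_sumr => s _; apply: continuous_mulr; first exact: cst_continuous.
apply: continuous_big; first exact: mul_continuous.
move=> i _; apply: continuous_addr; first exact: cst_continuous.
by case: (i == s i) => x; [exact: cvg_id|exact: cvg_cst].
Qed.

(** Writing M as (M + e) - e, the trace is k minus e times the trace of a positive definite
    inverse. *)
Lemma tr_mul_inv_shift_le k (M : 'M[R]_k) (e : R) : psd M -> 0 < e ->
  \tr (M *m invmx (M + e%:M)) <= k%:R.
Proof.
move=> Mpsd e0; have Np := psd_add_posdef Mpsd (scalar_posdef k e0).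
have [A Au AE] := posdef_gramP (posdef_inv Np).
rewrite -{1}(addrK e%:M M) mulmxBl mulmxV ?posdef_unit // linearB /= mxtrace1 gerBl.
by rewrite mul_scalar_mx linearZ /= AE mulr_ge0 ?tr_gram_ge0 // ltW.
Qed.

(** This is [trace_ge_ln_det] for A M A^T, where A^T A is the inverse of [X]. Equality holds at X =
    M, which makes source forms the optimal source matrices. *)
Lemma ln_det_le_trace k (M X : 'M[R]_k) : posdef M -> posdef X ->
  k%:R + ln (\det M) <= \tr (M *m invmx X) + ln (\det X).
Proof.
move=> Mp Xp; have [A Au AE] := posdef_gramP (posdef_inv Xp).
have AMAp : posdef (A *m M *m A^T).
  rewrite -{1}[A]trmxK; apply: (posdef_congr Mp (B := invmx A^T)).
  by rewrite mulVmx // unitmx_tr.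
have := trace_ge_ln_det AMAp; rewrite mxtrace_mulC mulmxA -AE mxtrace_mulC.
rewrite !det_mulmx det_tr mulrAC -{1}(det_tr A) -det_mulmx -AE det_inv.
rewrite lnM ?posrE ?invr_gt0 ?posdef_det_gt0 // lnV ?posrE ?posdef_det_gt0 //.
lra.
Qed.

End Semidefinite.

Section BrascampLieb.
Variables (R : realType) (n m : nat) (arr : 'I_n -> 'I_m -> finType).
Notation Q := (bipartite arr).
Variable p : 'I_m -> rat.
Hypothesis p_gt0 : forall j, 0 < p j.
Local Notation q := (fun j => ratr (p j) : R).
Local Notation kn := (kn (@bp_weight R n m arr p) (bp_theta R p)).
Local Notation kn_min := (kn_min (@bp_weight R n m arr p) (bp_theta R p)).
Local Notation logc := (log_char (bp_theta R p)).
Variable d : dimvec Q.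
Implicit Types (V : rep R d).

Lemma ratr_p_gt0 j : 0 < q j.
Proof. by rewrite ltr0q. Qed.

Definition source_dim : R := \sum_(i < n) (d (inl i))%:R.

Lemma source_form_psd V Y i : (forall j, posdef (Y j)) -> psd (source_form p V Y i).
Proof.
move=> Yp; split; first by apply: source_form_sym => j; have [] := Yp j.
move=> u; rewrite /source_form mulmx_sumr mulmx_suml summxE sumr_ge0 // => j _.
rewrite -scalemxAr -scalemxAl mxE mulr_ge0 //; first exact/ltW/ratr_p_gt0.
rewrite mulmx_sumr mulmx_suml summxE sumr_ge0 // => a _.
have := proj2 (posdef_psd (Yp j)) (entry V a *m u).
by rewrite trmx_mul !mulmxA.
Qed.

Lemma BL_denE V Y : BL_den p V Y = \prod_i \det (source_form p V Y i).
Proof. by []. Qed.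

Lemma BL_den_ge0 V Y : (forall j, posdef (Y j)) -> 0 <= BL_den p V Y.
Proof.
move=> Yp; rewrite BL_denE prodr_ge0 // => i _.
by have [] := psd_det (source_form_psd V i Yp).
Qed.

Lemma BL_den_posdef V Y i : (forall j, posdef (Y j)) -> BL_den p V Y != 0 ->
  posdef (source_form p V Y i).
Proof.
move=> Yp /prodf_neq0 h; have [_] := psd_det (source_form_psd V i Yp); apply.
exact: h.
Qed.

Lemma ln_prod_gt0 (I : finType) (F : I -> R) : (forall i, 0 < F i) ->
  \prod_i F i = expR (\sum_i ln (F i)).
Proof. by move=> F0; rewrite expR_sum; apply: eq_bigr => i _; rewrite lnK // posrE. Qed.

Lemma BL_numE (Y : forall j : 'I_m, 'M[R]_(d (inr j))) : (forall j, posdef (Y j)) ->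
  BL_num p Y = expR (\sum_j q j * ln (\det (Y j))).
Proof.
move=> Yp; rewrite expR_sum; apply: eq_bigr => j _.
by rewrite /powR gt_eqF // posdef_det_gt0.
Qed.

Definition join_forms (X : forall i : 'I_n, 'M[R]_(d (inl i)))
    (Y : forall j : 'I_m, 'M[R]_(d (inr j))) (x : vertex Q) : 'M[R]_(d x) :=
  match x with inl i => X i | inr j => Y j end.

Lemma join_forms_posdefs X Y : (forall i, posdef (X i)) -> (forall j, posdef (Y j)) ->
  posdefs (join_forms X Y).
Proof. by move=> Xp Yp [i|j]. Qed.

(** The form without quotient also absorbs the convention 1/0: the numerator is positive, so a zero
    denominator falsifies both sides. *)
Lemma BL_val_le V Y (b : R) : 0 < b -> (forall j, posdef (Y j)) ->
  (BL_val p V Y <= b%:E)%E <-> BL_num p Y <= b ^+ 2 * BL_den p V Y.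
Proof.
move=> b0 Yp; rewrite /BL_val; have num0 : 0 < BL_num p Y by rewrite BL_numE // expR_gt0.
have [->|den0] := eqVneq (BL_den p V Y) 0.
  by rewrite mulr0; split=> [|h]; [rewrite leye_eq|move: h; rewrite leNgt num0].
have {}den0 : 0 < BL_den p V Y by rewrite lt_neqAle eq_sym den0 BL_den_ge0.
rewrite lee_fin -[in X in X <-> _](ger0_norm (ltW b0)) -sqrtr_sqr ler_sqrt ?sqr_ge0 //.
by rewrite ler_pdivrMr.
Qed.

Lemma BL_le V (b : R) : 0 < b -> (BL p V <= b%:E)%E <->
  forall Y, (forall j, posdef (Y j)) -> BL_num p Y <= b ^+ 2 * BL_den p V Y.
Proof.
move=> b0; split=> [h Y Yp|h].
  apply/(BL_val_le V b0 Yp); apply: le_trans h; apply: ereal_sup_ubound.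
  by exists Y.
by apply: ge_ereal_sup => _ [Y Yp <-]; apply/BL_val_le => //; exact: h.
Qed.

Lemma kn_shift_le V Y (e : R) : (forall j, posdef (Y j)) -> 0 < e ->
  kn V (join_forms (fun i => source_form p V Y i + e%:M) Y) <=
  source_dim + \sum_i ln (\det (source_form p V Y i + e%:M)) - \sum_j q j * ln (\det (Y j)).
Proof.
move=> Yp e0; rewrite kn_bipartite /= -addrA lerD2r; apply: ler_sum => i _.
by apply: tr_mul_inv_shift_le => //; exact: source_form_psd.
Qed.

Lemma kn_ge_den V (H : forall x : vertex Q, 'M[R]_(d x)) : posdefs H ->
  BL_den p V (fun j => H (inr j)) != 0 ->
  source_dim + ln (BL_den p V (fun j => H (inr j))) - ln (BL_num p (fun j => H (inr j)))
    <= kn V H.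
Proof.
move=> Hp den0; have Yp j : posdef (H (inr j)) by exact: Hp.
have Mp i := BL_den_posdef i Yp den0.
rewrite kn_bipartite BL_numE // expRK BL_denE ln_prod_gt0; last first.
  by move=> i; exact: posdef_det_gt0.
rewrite expRK addrA lerD2r /source_dim -!big_split /=; apply: ler_sum => i _.
exact: ln_det_le_trace.
Qed.

Lemma kn_source_form V Y : (forall j, posdef (Y j)) -> BL_den p V Y != 0 ->
  kn V (join_forms (source_form p V Y) Y) =
  source_dim + ln (BL_den p V Y) - ln (BL_num p Y).
Proof.
move=> Yp den0; have Mp i := BL_den_posdef i Yp den0.
rewrite kn_bipartite BL_numE // expRK BL_denE ln_prod_gt0; last first.
  by move=> i; exact: posdef_det_gt0.
rewrite expRK addrA; congr (_ + _ - _); apply: eq_bigr => i _ /=.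
by rewrite mulmxV ?mxtrace1 // posdef_unit.
Qed.

(* For fixed sink matrices kn is minimal at the source forms; these may be degenerate,
   whence the shift by e. *)
Lemma BL_le_kn V (b : R) : 0 < b -> (BL p V <= b%:E)%E <->
  forall H, posdefs H -> source_dim - 2 * ln b <= kn V H.
Proof.
move=> b0; have b20 : 0 < b ^+ 2 by rewrite exprn_gt0.
have lnb2 : ln (b ^+ 2) = 2 * ln b by rewrite lnXn // mulr_natl.
apply: (iff_trans (BL_le V b0)); split=> [h H Hp|h Y Yp].
  have Yp j : posdef (H (inr j)) by exact: Hp.
  have hY := h _ Yp; have num0 : 0 < BL_num p (fun j => H (inr j)).
    by rewrite BL_numE // expR_gt0.
  have den0 : 0 < BL_den p V (fun j => H (inr j)).
    by rewrite -(pmulr_rgt0 _ b20); apply: lt_le_trans hY.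
  apply: le_trans (kn_ge_den Hp _); last by rewrite gt_eqF.
  move: hY; rewrite -ler_ln ?posrE ?mulr_gt0 // lnM ?posrE // lnb2; lra.
(* A strict violation at [Y] persists, by continuity of the determinants, for a small shift that
   makes the source forms positive definite. *)
rewrite leNgt; apply/negP => lt.
pose F (e : R) := b ^+ 2 * \prod_i \det (source_form p V Y i + e%:M).
have Fc : continuous F.
  apply: continuous_mulr; first exact: cst_continuous.
  apply: continuous_big; first exact: mul_continuous.
  by move=> i _; exact: det_shift_continuous.
have F0 : F 0 < BL_num p Y.
  rewrite /F (eq_bigr (fun i => \det (source_form p V Y i))) // => i _.
  by rewrite raddf0 addr0.
have near1 : \forall e \near 0^'+, F e < BL_num p Y.
  have cF : F e @[e --> 0^'+] --> F 0 by apply: cvg_at_right_filter; exact: Fc.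
  by apply: cvgr_lt cF _ _.
have near2 : \forall e \near 0^'+, (0 < e) /\ (F e < BL_num p Y).
  exact: (filterI (nbhs_right_gt _) near1).
have [e [e0 Fe]] := @filter_ex R (0^'+) _ _ near2.
have Mp i : posdef (source_form p V Y i + e%:M).
  apply: psd_add_posdef; [exact: source_form_psd|exact: scalar_posdef].
have := le_trans (h _ (join_forms_posdefs Mp Yp)) (kn_shift_le V Yp e0).
have P0 : 0 < \prod_i \det (source_form p V Y i + e%:M).
  by rewrite prodr_gt0 // => i _; exact: posdef_det_gt0.
have : ln (F e) < ln (BL_num p Y).
  by rewrite ltr_ln ?posrE ?mulr_gt0 // BL_numE // expR_gt0.
rewrite lnM ?posrE // lnb2 BL_numE // expRK ln_prod_gt0 ?expRK; last first.
  by move=> i; exact: posdef_det_gt0.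
lra.
Qed.

Lemma BL_gt0 V : (0 < BL p V)%E.
Proof.
have Yp j : posdef (1%:M : 'M[R]_(d (inr j))) by exact: posdef1.
apply: (@lt_le_trans _ _ (BL_val p V (fun=> 1%:M))); last first.
  by apply: ereal_sup_ubound; exists (fun=> 1%:M).
rewrite /BL_val; case: eqVneq => // den0; rewrite lte_fin sqrtr_gt0 divr_gt0 //.
  by rewrite BL_numE // expR_gt0.
by rewrite lt_neqAle eq_sym den0 BL_den_ge0.
Qed.

Lemma feasibleP V : feasible p V -> exists2 b : R, 0 < b & BL p V = b%:E.
Proof.
rewrite /feasible; have := BL_gt0 V; case: (BL p V) => [b| |] //.
by rewrite lte_fin => b0 _; exists b.
Qed.

Lemma feasible_bounded V : feasible p V <-> kn_bounded (@bp_weight R n m arr p) (bp_theta R p) V.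
Proof.
split=> [/feasibleP[b b0 bE]|[c hc]].
  exists (source_dim - 2 * ln b); apply/BL_le_kn => //; by rewrite bE.
have : (BL p V <= (expR ((source_dim - c) / 2))%:E)%E.
  apply/BL_le_kn; first exact: expR_gt0.
  by move=> H Hp; apply: le_trans (hc H Hp); rewrite expRK; lra.
by move=> h; apply: le_lt_trans h _; rewrite ltry.
Qed.

Lemma rep_norm_geometric V : Defs.geometric p V ->
  rep_norm (@bp_weight R n m arr p) V = source_dim.
Proof.
move=> [g _]; rewrite -(kn1 _ (bp_theta R p)) kn_bipartite.
rewrite [X in _ + (X - _)]big1 => [|i _]; last by rewrite det1 ln1.
rewrite [X in _ + (_ - X)]big1 => [|i _]; last by rewrite det1 ln1 mulr0.
rewrite subrr addr0; apply: eq_bigr => i _.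
by rewrite source_form1 g invmx1 mulmx1 mxtrace1.
Qed.

Lemma kn_gram_geometric V A : BLset p V A ->
  kn V (fun x => (A x)^T *m A x) = source_dim + logc A.
Proof. by move=> [Au g]; rewrite kn_gram // rep_norm_geometric. Qed.

Lemma BLset_min V A : GL A -> BLset p V A <-> kn_min V (fun x => (A x)^T *m A x).
Proof.
move=> Au; split=> [[_ /geometricP V0]|h].
  by apply/kn_min_gram => //; [exact: bp_weight_gt0|exact: V0].
by split=> //; apply/geometricP => //; apply/kn_min_gram => //; exact: bp_weight_gt0.
Qed.

Lemma source_form_gram V (A : forall x : vertex Q, 'M[R]_(d x)) i : GL A ->
  source_form p V (fun j => (A (inr j))^T *m A (inr j)) i =
  (A (inl i))^T *m source_form p (act A V) (fun=> 1%:M) i *m A (inl i).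
Proof.
move=> Au; rewrite /source_form mulmx_sumr mulmx_suml; apply: eq_bigr => j _.
rewrite -scalemxAr -scalemxAl mulmx_sumr mulmx_suml; congr (_ *: _).
apply: eq_bigr => a _; rewrite mulmx1 /entry /act !trmx_mul trmx_inv !mulmxA.
by rewrite mulmxV ?unitmx_tr ?Au // mul1mx mulmxKV // Au.
Qed.

(** Minimality of the Gram family gives the upper bound. It is attained at the sink parts, because
    the first geometric equation identifies their source forms with the source parts. *)
Lemma BLset_extremiser V (A : forall x : vertex Q, 'M[R]_(d x)) : BLset p V A ->
  BL p V = (expR (- logc A / 2))%:E /\
  gaussian_extremiser p V (fun j => (A (inr j))^T *m A (inr j)).
Proof.
move=> AV; have [Au [g1 g2]] := AV.
set Y := fun j => _; have Yp j : posdef (Y j) by apply: posdef_gram; exact: Au.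
have b0 := expR_gt0 (- logc A / 2).
have BLle : (BL p V <= (expR (- logc A / 2))%:E)%E.
  apply/BL_le_kn => // H Hp; rewrite expRK.
  have [_ hmin] := proj1 (BLset_min V Au) AV.
  apply: le_trans (hmin H Hp); rewrite (kn_gram_geometric AV); lra.
have AT i : source_form p V Y i = (A (inl i))^T *m A (inl i).
  by rewrite /Y source_form_gram // source_form1 g1 mulmx1.
have Ap i : posdef ((A (inl i))^T *m A (inl i)) by apply: posdef_gram; exact: Au.
have denE : BL_den p V Y = expR (\sum_i ln (\det (A (inl i)) ^+ 2)).
  rewrite BL_denE expR_sum; apply: eq_bigr => i _.
  rewrite AT det_mulmx det_tr -expr2 lnK // posrE exprn_even_gt0 //.
  by rewrite -unitfE -unitmxE; exact: Au.
have valE : BL_val p V Y = (expR (- logc A / 2))%:E.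
  rewrite /BL_val denE gt_eqF ?expR_gt0 // BL_numE // -expRB; congr EFin.
  have -> : \sum_j q j * ln (\det (Y j)) - \sum_i ln (\det (A (inl i)) ^+ 2) =
      - logc A.
    rewrite /log_char sum_bp_theta opprB; congr (_ - _); apply: eq_bigr => j _.
    by rewrite /Y det_mulmx det_tr expr2.
  rewrite [in LHS](splitr (- logc A)) expRD -expr2 sqrtr_sqr ger0_norm ?expR_ge0 //.
have BLE : BL p V = (expR (- logc A / 2))%:E.
  apply/eqP; rewrite eq_le BLle -valE /=; apply: ereal_sup_ubound; by exists Y.
by split=> //; split; rewrite ?valE ?BLE // /feasible BLE ltry.
Qed.

(** Completed by its own source forms, an extremiser reaches the lower bound of [BL_le_kn]; it is
    thus a minimiser, and any Gram factor of it lies in [BLset]. *)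
Lemma extremiser_BLset V Y : gaussian_extremiser p V Y ->
  exists2 A, BLset p V A & forall j, Y j = (A (inr j))^T *m A (inr j).
Proof.
move=> [/feasibleP[b b0 bE] Yp]; rewrite bE /BL_val.
have [//|den0 [bval]] := eqVneq (BL_den p V Y) 0.
have den_gt0 : 0 < BL_den p V Y by rewrite lt_neqAle eq_sym den0 BL_den_ge0.
have num0 : 0 < BL_num p Y by rewrite BL_numE // expR_gt0.
have lnE : ln (BL_num p Y) = 2 * ln b + ln (BL_den p V Y).
  have : BL_num p Y = b ^+ 2 * BL_den p V Y.
    by rewrite -bval sqr_sqrtr ?divfK ?gt_eqF // divr_ge0 ?ltW.
  by move=> ->; rewrite lnM ?posrE ?exprn_gt0 // lnXn // mulr_natl.
have Mp i := BL_den_posdef i Yp den0.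
have Hp := join_forms_posdefs Mp Yp.
have [A Au HA] := posdefs_gramP Hp.
exists A; last by move=> j; have := congr1 (fun H => H (inr j)) HA.
apply/BLset_min => //; rewrite -HA; split=> // H' Hp'.
rewrite kn_source_form // lnE.
have /(BL_le_kn V b0)/(_ H' Hp') : (BL p V <= b%:E)%E by rewrite bE.
by apply: le_trans; lra.
Qed.

Lemma extremiserP V Y : feasible p V -> gaussian_extremiser p V Y <->
  exists2 A, BLset p V A & forall j, Y j = (A (inr j))^T *m A (inr j).
Proof.
move=> Vf; split=> [/extremiser_BLset//|[A AV YA]].
have -> : Y = fun j => (A (inr j))^T *m A (inr j) by apply/functional_extensionality_dep.
by have [] := BLset_extremiser AV.
Qed.

End BrascampLieb.

(** * The Euclidean topology of representations in entrywise terms *)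

Section Closure.
Variables (R : realType) (Q : quiver) (d : dimvec Q).

Local Notation rep_space :=
  (prod_topology (fun a : arrow Q => 'M[R]_(d (hd a), d (tl a)))).

Lemma rep_entry_continuous a r s : continuous (fun W : rep_space => W a r s : R).
Proof.
move=> W; apply: (@continuous_comp _ _ _ (fun W : rep_space => W a)
  (fun M : 'M[R]_(d (hd a), d (tl a)) => M r s)).
  exact: (@proj_continuous _ (fun a : arrow Q => 'M[R]_(d (hd a), d (tl a)))).
exact: coord_continuous.
Qed.

Lemma rep_close_nbhs (V : rep R d) (e : R) : 0 < e ->
  @nbhs _ rep_space V (rep_close e V).
Proof.
move=> e0; have FF : Filter (@nbhs _ rep_space V) by exact: nbhs_filter.
have := @filter_forall _ (matrix_entry d) (fun z (W : rep_space) =>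
  `|W (tag z) (tagged z).1 (tagged z).2 - V (tag z) (tagged z).1 (tagged z).2| < e) _ FF.
move=> /(_ _)/wrap[z|].
  have := @rep_entry_continuous (tag z) (tagged z).1 (tagged z).2 V.
  move=> /cvgr_dist_lt/(_ e e0); apply: filterS => W.
  by rewrite distrC.
apply: filterS => W h a r s.
exact: (h (Tagged (fun a => ('I_(d (hd a)) * 'I_(d (tl a)))%type) (r, s))).
Qed.

Lemma kn_rep_continuous w th (H : forall x : vertex Q, 'M[R]_(d x)) :
  continuous (fun W : rep_space => kn w th (W : rep R d) H).
Proof.
apply: continuous_addr; last exact: cst_continuous.
apply: continuous_sumr => a _; apply: continuous_mulr; first exact: cst_continuous.
apply: (@eq_continuousr _ _ (fun W : rep_space => \sum_i \sum_j (\sum_k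
    (\sum_l W a l i * H (hd a) l k) * W a k j) * invmx (H (tl a)) j i)) => [|W]; last first.
  apply: eq_bigr => i _; rewrite mxE; apply: eq_bigr => j _; congr (_ * _).
  rewrite mxE; apply: eq_bigr => k _; congr (_ * _).
  by rewrite mxE; apply: eq_bigr => l _; rewrite mxE.
apply: continuous_sumr => i _; apply: continuous_sumr => j _.
apply: continuous_mulr; last exact: cst_continuous.
apply: continuous_sumr => k _; apply: continuous_mulr; last exact: rep_entry_continuous.
apply: continuous_sumr => l _; apply: continuous_mulr; last exact: cst_continuous.
exact: rep_entry_continuous.
Qed.

(** The filter of entrywise closeness converges to [V] in each factor, hence in the product
    topology, which is a supremum of the topologies induced by the factors. *)
Lemma nbhs_rep_close (V : rep R d)
    (B : set (prod_topology (fun a : arrow Q => 'M[R]_(d (hd a), d (tl a))))) :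
  @nbhs _ (prod_topology (fun a : arrow Q => 'M[R]_(d (hd a), d (tl a)))) V B ->
  exists2 e : R, 0 < e & forall W, rep_close e V W -> B W.
Proof.
pose T := prod_topology (fun a : arrow Q => 'M[R]_(d (hd a), d (tl a))).
pose F : set_system T := filter_from [set e : R | 0 < e] (fun e => rep_close e V).
have FF : Filter F.
  apply: filter_from_filter; first by exists 1 => /=.
  move=> e1 e2 /= e10 e20; exists (Num.min e1 e2) => [/=|W h]; first by rewrite lt_min e10.
  by split=> a r s; have := h a r s; rewrite lt_min => /andP[].
suff : F --> (V : T) by move=> h /h[e e0 he]; exists e => // W; exact: he.
apply/cvg_sup => a; apply/cvg_image.
  by apply/seteqP; split=> // M _; exists (dfwith V a M) => //; exact: projK.
move=> C /= VC; exists (proj a @^-1` C).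
  have /nbhs_ballP[e /= e0 he] := VC.
  exists e => // W WV; apply: he; rewrite /ball /= /mx_ball; split=> // r s.
  by rewrite /ball /= distrC; exact: WV.
apply: image_preimage; apply/seteqP; split=> // M _.
by exists (dfwith V a M) => //; exact: projK.
Qed.

Lemma kn_close_le w th (V : rep R d) H (e : R) : 0 < e ->
  exists2 delta : R, 0 < delta & forall W, rep_close delta V W ->
    kn w th W H < kn w th V H + e.
Proof.
move=> e0; apply: nbhs_rep_close.
have := @kn_rep_continuous w th H V.
by move=> /cvgr_lt; apply; rewrite ltrDl.
Qed.

Lemma rep_closureP (S : set (rep R d)) (V : rep R d) : rep_closure S V <->
  forall e : R, 0 < e -> exists2 W, S W & rep_close e V W.
Proof.
split=> [SV e e0|h B /nbhs_rep_close[e e0 eB]].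
  by have [W [SW VW]] := SV _ (rep_close_nbhs V e0); exists W.
by have [W SW VW] := h e e0; exists W; split=> //; exact: eB.
Qed.

End Closure.

(** * The integral character and its logarithm *)

Section Chi.
Variables (R : realType) (n m : nat) (arr : 'I_n -> 'I_m -> finType).
Notation Q := (bipartite arr).
Variable p : 'I_m -> rat.

Definition bp_weight_int (x : vertex Q) : int :=
  match x with inl _ => (lcden p)%:Z | inr j => - numq ((lcden p)%:R * p j) end.

Lemma lcden_gt0 : (0 < lcden p)%N.
Proof.
rewrite /lcden; apply: (big_ind (fun k => 0 < k)%N) => // [k l k0 l0|j _].
  by rewrite lcmn_gt0 k0.
by rewrite absz_gt0 denq_eq0.
Qed.

(** The least common denominator is a multiple of each denominator, so the product is an integer and
    [numq] in [chi] loses nothing. *)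
Lemma lcden_mul_int j : (numq ((lcden p)%:R * p j))%:~R = (lcden p)%:R * p j.
Proof.
have : (`|denq (p j)| %| lcden p)%N by exact: (biglcmn_sup j).
move=> /dvdnP[k ->]; rewrite natrM -mulrA.
have -> : (`|denq (p j)|%N)%:R * p j = (numq (p j))%:~R.
  rewrite -[(`|_|%N)%:R]/((Posz `|denq (p j)|%N)%:~R) absz_denq.
  by rewrite mulrC -numqE.
by rewrite -[k%:R]/(k%:Z%:~R) -intrM numq_int.
Qed.

Lemma bp_weight_intE x : (bp_weight_int x)%:~R = (lcden p)%:R * bp_theta R p x :> R.
Proof.
case: x => [i|j] /=; first by rewrite mulr1.
rewrite rmorphN mulrN; congr (- _).
by rewrite -[LHS]ratr_int lcden_mul_int rmorphM /= ratr_nat.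
Qed.

Variable d : dimvec Q.
Implicit Types (A : forall x : vertex Q, 'M[R]_(d x)).

Lemma chiE A : chi p A = character bp_weight_int A.
Proof. by rewrite /character big_sumType. Qed.

Lemma normr_exprz (x : R) (k : int) : x != 0 -> `|x ^ k| = expR (k%:~R * ln `|x|).
Proof.
move=> x0; have nx : 0 < `|x| by rewrite normr_gt0.
case: k => k.
  by rewrite -exprnP normrX expRM_natl lnK.
by rewrite NegzE -exprnN normfV normrX rmorphN mulNr expRN expRM_natl lnK.
Qed.

Lemma log_char_chi A : GL A ->
  0 < `|chi p A| /\ (lcden p)%:R * log_char (bp_theta R p) A = 2 * ln `|chi p A|.
Proof.
move=> Au; have A0 x : \det (A x) != 0 by rewrite -unitfE -unitmxE; exact: Au.
have -> : `|chi p A| = expR (\sum_x (bp_weight_int x)%:~R * ln `|\det (A x)|).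
  rewrite chiE normr_prod expR_sum; apply: eq_bigr => x _.
  exact: normr_exprz.
split; first exact: expR_gt0.
rewrite expRK !mulr_sumr; apply: eq_bigr => x _; rewrite bp_weight_intE.
rewrite -[_ ^+ 2]real_normK ?num_real // lnXn ?normr_gt0 // -mulr_natl; ring.
Qed.

Lemma chi_powR A : GL A ->
  expR (- log_char (bp_theta R p) A / 2) = `|chi p A| `^ (- (lcden p)%:R^-1).
Proof.
move=> Au; have [c0 cE] := log_char_chi Au.
rewrite /powR gt_eqF //; congr expR; have l0 : (lcden p)%:R != 0 :> R.
  by rewrite pnatr_eq0 -lt0n lcden_gt0.
have -> : ln `|chi p A| = (lcden p)%:R * log_char (bp_theta R p) A / 2.
  by rewrite cE; field.
by field.
Qed.

End Chi.

Section MainLemmas.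
Variables (R : realType) (n m : nat) (arr : 'I_n -> 'I_m -> finType).
Notation Q := (bipartite arr).
Variable p : 'I_m -> rat.
Hypothesis p_gt0 : forall j, 0 < p j.
Local Notation bw := (@bp_weight R n m arr p).
Local Notation bth := (@bp_theta R n m arr p).
Local Notation kn := (kn bw bth).
Implicit Types d : dimvec Q.
Let bw_gt0 := @bp_weight_gt0 R n m arr p p_gt0.

Lemma BLset_polystable d (V : rep R d) : orthogonal_dim p d ->
  (BLset p V !=set0 <-> polystable p V).
Proof.
move=> /(orthogonal_dimP R) d0; split=> [[A AV]|
  /polystableP/(theta_polystable_min bw_gt0)[A Au V0]].
  apply/polystableP/(kn_min_polystable bw_gt0 d0).
  have [Au _] := AV; exists (fun x => (A x)^T *m A x).
  exact/(BLset_min p_gt0 V Au).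
by exists A; split=> //; apply/(geometricP p_gt0).
Qed.

Lemma source_dim_block d1 d2 :
  source_dim R (dim_sum d1 d2 : dimvec Q) = source_dim R d1 + source_dim R d2.
Proof. by rewrite /source_dim -big_split; apply: eq_bigr => i _; rewrite natrD. Qed.

(** The upper bound adds the bounds of the blocks in the completed square. The lower bound shrinks
    the first block, which removes the cross term in the limit at no cost. *)
Lemma BL_block d1 d2 (V1 : rep R d1) X (V2 : rep R d2) :
  weighted_dim bth d1 = 0 -> BL p (block_rep V1 X V2) = (BL p V1 * BL p V2)%E.
Proof.
move=> d10; set V := block_rep V1 X V2.
have upper b1 b2 : 0 < b1 -> 0 < b2 -> (BL p V1 <= b1%:E)%E -> (BL p V2 <= b2%:E)%E ->
    (BL p V <= (b1 * b2)%:E)%E.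
  move=> b10 b20 /(BL_le_kn p_gt0 V1 b10) h1 /(BL_le_kn p_gt0 V2 b20) h2.
  apply/(BL_le_kn p_gt0); first exact: mulr_gt0.
  move=> H /posdefs_schur[K [H1 [H2 [p1 p2 ->]]]].
  rewrite kn_block_unipotent // source_dim_block lnM ?posrE //.
  have := h1 _ p1; have := h2 _ p2.
  have := cross_term_ge0 bw_gt0 (fun a => X a + K (hd a) *m V2 a - V1 a *m K (tl a)) p1 p2.
  lra.
have lower b H1 H2 : 0 < b -> (BL p V <= b%:E)%E -> posdefs H1 -> posdefs H2 ->
    source_dim R d1 + source_dim R d2 - 2 * ln b <= kn V1 H1 + kn V2 H2.
  move=> b0 /(BL_le_kn p_gt0 V b0) h p1 p2; apply/ler_addgt0Pr => e e0.
  pose C := cross_term bw X H1 H2; have C0 : 0 <= C by exact: cross_term_ge0.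
  pose t := e / (C + 1); have t0 : 0 < t by rewrite divr_gt0 // ltr_wpDl.
  have := h _ (posdefs_block (posdefs_scale t0 p1) p2).
  rewrite kn_block_scale // d10 mulr0 addr0 source_dim_block => hh.
  apply: (le_trans hh); rewrite lerD2l /t mulrAC ler_pdivrMr ?ltr_wpDl //.
  by rewrite ler_pM2l // lerDl.
(* If both factors were finite, [upper] would bound the product; so one factor is infinite, and
   positivity of the other excludes 0 times infinity. *)
have [|Vinf] := ltP (BL p V) +oo%E; last first.
  have -> : BL p V = +oo%E by apply/eqP; rewrite -leye_eq.
  have [/(feasibleP p_gt0)[b1 b10 E1]|i1] := ltP (BL p V1) +oo%E; last first.
    have -> : BL p V1 = +oo%E by apply/eqP; rewrite -leye_eq.
    by rewrite gt0_mulye // BL_gt0.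
  have [/(feasibleP p_gt0)[b2 b20 E2]|i2] := ltP (BL p V2) +oo%E; last first.
    have -> : BL p V2 = +oo%E by apply/eqP; rewrite -leye_eq.
    by rewrite gt0_muley // BL_gt0.
  have := upper b1 b2 b10 b20; rewrite E1 E2 !lexx => /(_ isT isT) h.
  by move: (le_trans Vinf h); rewrite leye_eq.
move=> /(feasibleP p_gt0)[b b0 bE].
have Vb : (BL p V <= b%:E)%E by rewrite bE.
have one1 : posdefs (fun x => 1%:M : 'M[R]_(d1 x)) := @posdefs1 _ _ d1.
have one2 : posdefs (fun x => 1%:M : 'M[R]_(d2 x)) := @posdefs1 _ _ d2.
have f1 : feasible p V1.
  apply/(feasible_bounded p_gt0); eexists => H Hp.
  have := lower b _ _ b0 Vb Hp one2; rewrite -lerBlDr; exact.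
have f2 : feasible p V2.
  apply/(feasible_bounded p_gt0); eexists => H Hp.
  have := lower b _ _ b0 Vb one1 Hp; rewrite -lerBlDl; exact.
have [b1 b10 E1] := feasibleP p_gt0 f1; have [b2 b20 E2] := feasibleP p_gt0 f2.
rewrite E1 E2 -EFinM; apply/eqP; rewrite eq_le upper ?E1 ?E2 //= bE lee_fin.
(* The joint bound is separated one variable at a time: for fixed [H1] it bounds the constant of
   [V2], and then [H1] varies. *)
have key2 H1 : posdefs H1 -> source_dim R d1 - 2 * ln (b / b2) <= kn V1 H1.
  move=> p1; pose c := expR ((kn V1 H1 - source_dim R d1) / 2 + ln b).
  have : (BL p V2 <= c%:E)%E.
    apply/(BL_le_kn p_gt0); first exact: expR_gt0.
    move=> H2 p2; have := lower b _ _ b0 Vb p1 p2; rewrite expRK; lra.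
  rewrite E2 lee_fin -ler_ln ?posrE ?expR_gt0 // expRK.
  rewrite ln_div ?posrE //; lra.
have : (BL p V1 <= (b / b2)%:E)%E.
  by apply/(BL_le_kn p_gt0) => //; rewrite divr_gt0.
by rewrite E1 lee_fin ler_pdivlMr.
Qed.

End MainLemmas.

Section Degenerations.
Variables (R : realType) (n m : nat) (arr : 'I_n -> 'I_m -> finType).
Notation Q := (bipartite arr).
Variable p : 'I_m -> rat.
Hypothesis p_gt0 : forall j, 0 < p j.
Local Notation bw := (@bp_weight R n m arr p).
Local Notation bth := (@bp_theta R n m arr p).
Local Notation kn := (kn bw bth).
Local Notation kn_min := (kn_min bw bth).
Local Notation logc := (log_char bth).
Variable d : dimvec Q.
Hypothesis d_orth : orthogonal_dim p d.
Implicit Types V W : rep R d.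
Let bw_gt0 := @bp_weight_gt0 R n m arr p p_gt0.
Let d0 : weighted_dim bth d = 0 := proj1 (orthogonal_dimP R p d) d_orth.

Lemma feasible_semistable V : feasible p V <-> theta_semistable bth V.
Proof.
split=> [/(feasible_bounded p_gt0)|/(theta_semistable_bounded bw_gt0)].
  exact: (kn_bounded_semistable bw_gt0 d0).
by move/(feasible_bounded p_gt0).
Qed.

Lemma log_charM (A B : forall x : vertex Q, 'M[R]_(d x)) : GL A -> GL B ->
  logc (fun x => A x *m B x) = logc A + logc B.
Proof.
move=> Au Bu; rewrite -big_split; apply: eq_bigr => x _ /=; rewrite -mulrDr.
have sq (C : forall x : vertex Q, 'M[R]_(d x)) : GL C -> 0 < \det (C x) ^+ 2.
  by move=> Cu; rewrite exprn_even_gt0 // -unitfE -unitmxE; exact: Cu.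
by rewrite det_mulmx exprMn lnM ?posrE ?sq.
Qed.

Lemma log_char_GLp (A : forall x : vertex Q, 'M[R]_(d x)) : GLp p d A -> logc A = 0.
Proof.
move=> [Au chi1]; have [_] := log_char_chi p Au.
rewrite chi1 normr1 ln1 mulr0 => /eqP; rewrite mulf_eq0 pnatr_eq0.
by rewrite -leqn0 leqNgt lcden_gt0 => /eqP.
Qed.

Lemma polystable_degeneration V : feasible p V -> exists V', polystable p V' /\
  rep_closure [set act A V | A in GLp p d] V'.
Proof.
move=> /feasible_semistable Vss.
have l0 : 0 < (lcden p)%:R :> R by rewrite ltr0n lcden_gt0.
have [V' [Vmin close]] := semistable_degeneration bw_gt0 (bp_weight_intE R p) Vss.
exists V'; split; first exact/polystableP/(kn_min_polystable bw_gt0).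
apply/rep_closureP => e e0; have [A [Au A1 AV]] := close e e0.
by exists (act A V) => //; exists A => //; split=> //; rewrite chiE.
Qed.

(** Lower semicontinuity is available only at a geometric datum, and [V'] need not be one; the
    points A.V approaching [V'] are therefore first moved by [A']. *)
Lemma BL_closure V V' (A' : forall x : vertex Q, 'M[R]_(d x)) : feasible p V ->
  rep_closure [set act A V | A in GLp p d] V' -> BLset p V' A' -> BL p V = BL p V'.
Proof.
move=> /(feasibleP p_gt0)[b b0 bE] /rep_closureP VV' AV'.
have [BL'E _] := BLset_extremiser p_gt0 AV'.
have [Au' g'] := AV'.
apply/eqP; rewrite eq_le; apply/andP; split; last first.
  rewrite bE; apply/(BL_le_kn p_gt0) => // H Hp; apply/ler_addgt0Pr => e e0.
  have [delta delta0 hd] := kn_close_le bw bth V' H e0.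
  have [_ [A AG <-] AV] := VV' _ delta0.
  apply: le_trans (ltW (hd _ AV)); have Au := proj1 AG.
  have := kn_congr bw bth V Au Hp; rewrite log_char_GLp // addr0 => <-.
  have /(BL_le_kn p_gt0 V b0) : (BL p V <= b%:E)%E by rewrite bE.
  by apply; exact: posdefs_congr.
rewrite BL'E; apply/(BL_le_kn p_gt0); first exact: expR_gt0.
move=> H Hp; rewrite expRK; pose D := source_dim R d : R.
have D0 : 0 <= D by rewrite sumr_ge0.
have key t : 0 < t -> D - D * t + logc A' <= kn V H.
  (* The tolerance 1 - exp(-t) turns the factor 1 + ln(1 - e) of the semicontinuity bound into 1 -
     t. *)
  move=> t0; have e0 : 0 < 1 - expR (- t) by rewrite subr_gt0 expR_lt1 oppr_lt0.
  have e1 : 1 - expR (- t) < 1 by rewrite gtrBl expR_gt0.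
  have Y0 : moment_zero bw bth (act A' V') by apply/(geometricP p_gt0).
  have [delta delta0 hd] := kn_lower_semicontinuous bw_gt0 Y0 e0 e1.
  have [C C0 hC] := act_close A'.
  have [_ [A AG <-] /hC] := VV' _ (divr_gt0 delta0 C0).
  rewrite mulrCA divff ?gt_eqF // mulr1 => close; have Au := proj1 AG.
  have [G Gp HG] := congr_posdefs (GL_mul Au' Au) Hp.
  have := hd _ close G Gp; rewrite act_comp // rep_norm_geometric //.
  rewrite HG kn_congr //; last exact: GL_mul.
  rewrite log_charM // (log_char_GLp AG) addr0 subKr expRK mulrDr mulr1 mulrN.
  by rewrite lerD2r.
rewrite (_ : _ - _ = D + logc A'); last by rewrite /D; field.
apply/ler_addgt0Pr => e e0; have t0 : 0 < e / (D + 1) by rewrite divr_gt0 // ltr_wpDl.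
have := key _ t0; have : D * (e / (D + 1)) <= e.
  by rewrite mulrA ler_pdivrMr ?ltr_wpDl // mulrC ler_pM2l // lerDl.
lra.
Qed.

End Degenerations.

(** * Uniqueness of extremisers and stability *)

Section Uniqueness.
Variables (R : realType) (n m : nat) (arr : 'I_n -> 'I_m -> finType).
Notation Q := (bipartite arr).
Variable p : 'I_m -> rat.
Hypothesis p_gt0 : forall j, 0 < p j.
Local Notation bw := (@bp_weight R n m arr p).
Local Notation bth := (@bp_theta R n m arr p).
Local Notation kn := (kn bw bth).
Local Notation kn_min := (kn_min bw bth).
Implicit Types d : dimvec Q.
Let bw_gt0 := @bp_weight_gt0 R n m arr p p_gt0.

(** Sources have weight 1, so a nonzero dimension vector supported on sources has positive weighted
    dimension. Extremisers see only the sinks, where both blocks of a splitting must therefore be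
    visible. *)
Lemma weighted_dim0_sink (c : dimvec Q) : weighted_dim bth c = 0 ->
  (exists x, 0 < c x)%N -> exists j, (0 < c (inr j))%N.
Proof.
move=> c0 [[i|j] cx]; last by exists j.
apply: contrapT => none; move/eqP: c0.
rewrite /weighted_dim (sum_bp_theta _ (fun x => (c x)%:R)).
rewrite [X in _ - X]big1 => [|j _]; last first.
  case: (posnP (c (inr j))) => [->|cj]; first by rewrite mulr0.
  by case: none; exists j.
rewrite subr0 -natr_sum pnatr_eq0 sum_nat_eq0 => /forallP/(_ i) /=.
by rewrite -leqn0 leqNgt cx.
Qed.

Lemma posdef_scale_eq k (H : 'M[R]_k) (a b : R) : (0 < k)%N -> posdef H ->
  a *: H = b *: H -> a = b.
Proof.
move=> k0 [_ Hpos] /eqP; rewrite -subr_eq0 -scalerBl scaler_eq0 subr_eq0.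
case/orP => [/eqP//|/eqP H0]; have := Hpos (delta_mx (Ordinal k0) 0).
rewrite H0 mulmx0 mul0mx mxE ltxx => h; have : false; last by [].
apply: h; apply/eqP => /colP/(_ (Ordinal k0)).
by rewrite !mxE !eqxx => /eqP; rewrite oner_eq0.
Qed.

(** A gaussian extremiser records only the sink matrices, so this is what uniqueness of extremisers
    says about minimisers. *)
Definition sink_unique d (V : rep R d) : Prop :=
  forall H H', kn_min V H -> kn_min V H' ->
    exists2 c : R, 0 < c & forall j, H' (inr j) = c *: H (inr j).

(** In the block triangular case, doubling the first block of a minimiser gives another minimiser.
    Its ratio to the first would be 2 at a sink of the first block and 1 at a sink of the second,
    which contradicts uniqueness. *)
Lemma sink_unique_stable d (V : rep R d) : theta_semistable bth V ->
  sink_unique V -> (exists H, kn_min V H) -> theta_stable bth V.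
Proof.
apply: (semistable_induction (Pr := fun d V => sink_unique V ->
  (exists H, kn_min V H) -> theta_stable bth V)).
- by [].
- move=> {}d A {}V Au IH Vu Vmin; rewrite -(actK V Au).
  apply: theta_stable_act; first exact: GL_inv.
  apply: IH; last exact: kn_min_act.
  move=> G G' Gmin Gmin'.
  have [c c0 cE] := Vu _ _ (kn_min_congr Au Gmin) (kn_min_congr Au Gmin').
  exists c => // j; have := cE j.
  move=> /(congr1 (fun M => invmx (A (inr j))^T *m M *m invmx (A (inr j)))).
  rewrite -scalemxAr -scalemxAl !mulmxA mulVmx ?unitmx_tr ?Au // !mul1mx.
  by rewrite !mulmxK ?Au.
move=> d1 d2 V1 X V2 d10 d20 d1_gt0 d2_gt0 Vss _ _ Vu [H Hmin].
have [K [H1 [H2 [[p1 min1] [p2 min2] HE X0]]]] := kn_min_block bw_gt0 d10 Hmin.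
pose H' x := (unipotents K x)^T *m block_diags (fun x => 2 *: H1 x) H2 x *m unipotents K x.
have two : 0 < 2 :> R by [].
have Hp' : posdefs H'.
  apply: posdefs_congr; first exact: GL_unipotents.
  by apply: posdefs_block => //; exact: posdefs_scale.
have X'E : (fun a => X a + K (hd a) *m V2 a - V1 a *m K (tl a)) = (fun=> 0).
  exact/functional_extensionality_dep.
have knE : kn (block_rep V1 X V2) H' = kn (block_rep V1 X V2) H.
  rewrite HE /H' !kn_congr //; [|exact: GL_unipotents|exact: posdefs_block
    |exact: GL_unipotents|by apply: posdefs_block => //; exact: posdefs_scale].
  rewrite act_unipotents X'E kn_block_scale // kn_block // d10.
  rewrite (_ : cross_term _ _ _ _ = 0); first by ring.
  by rewrite /cross_term big1 // => a _; rewrite trmx0 !mul0mx mxtrace0 mulr0.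
have Hmin' : kn_min (block_rep V1 X V2) H'.
  by split=> // G Gp; rewrite knE; exact: (proj2 Hmin).
have [c c0 cE] := Vu _ _ Hmin Hmin'.
have blocks j : 2 *: H1 (inr j) = c *: H1 (inr j) /\ H2 (inr j) = c *: H2 (inr j).
  have := cE j; rewrite HE /H'; have Uu := @GL_unipotents _ _ _ _ K (inr j).
  move=> /(congr1 (fun M => invmx (unipotents K (inr j))^T *m M *m invmx (unipotents K (inr j)))).
  rewrite -scalemxAr -scalemxAl !mulmxA mulVmx ?unitmx_tr // !mul1mx !mulmxK //.
  by rewrite /block_diags scale_block_mx => /eq_block_mx[h1 _ _ h2].
have [j dj] := weighted_dim0_sink d10 d1_gt0.
have [j' dj'] := weighted_dim0_sink d20 d2_gt0.
have c2 := posdef_scale_eq dj (p1 _) (proj1 (blocks j)).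
have := proj2 (blocks j'); rewrite -[LHS]scale1r => /(posdef_scale_eq dj' (p2 _)) c1.
by move: c2; rewrite -c1 => /eqP; rewrite (eqr_nat R 2 1).
Qed.

Lemma kn_min_extremiser d (V : rep R d) H : kn_min V H ->
  gaussian_extremiser p V (fun j => H (inr j)).
Proof.
move=> Hmin; have [A Au HA] := posdefs_gramP (proj1 Hmin).
rewrite HA; apply: (proj2 (BLset_extremiser p_gt0 _)).
by apply/(BLset_min p_gt0) => //; rewrite -HA.
Qed.

Lemma extremiser_kn_min d (V : rep R d) Y : gaussian_extremiser p V Y ->
  exists2 H, kn_min V H & Y = fun j => H (inr j).
Proof.
move=> /(extremiser_BLset p_gt0)[A AV YE]; exists (fun x => (A x)^T *m A x).
  by apply/(BLset_min p_gt0) => //; case: AV.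
exact/functional_extensionality_dep.
Qed.

End Uniqueness.

Theorem theorem22 (R : realType) (n m : nat) (arr : 'I_n -> 'I_m -> finType)
    (Qconn : quiver_connected (bipartite arr))
    (d : dimvec (bipartite arr)) (p : 'I_m -> rat)
    (p_gt0 : forall j, 0 < p j) (pd : orthogonal_dim p d) :
  (* 1 *)
  (forall V : rep R d, (BL p V < +oo)%E <-> semistable p V) /\
  (* 2 *)
  (forall V : rep R d, feasible p V -> (BLset p V !=set0 <-> polystable p V)) /\
  (* 3 *)
  (forall V : rep R d, feasible p V ->
    (exists V' : rep R d, polystable p V' /\
       rep_closure [set act A V | A in GLp p d] V') /\
    (forall V' : rep R d, polystable p V' ->
       rep_closure [set act A V | A in GLp p d] V' ->
       BL p V = BL p V' /\
       forall A, BLset p V' A ->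
         BL p V' = (`|chi p A| `^ (- (lcden p)%:R^-1))%:E)) /\
  (* 4 *)
  (forall (d1 d2 : dimvec (bipartite arr)) (e : forall x, (d1 x + d2 x)%N = d x)
      (V : rep R d) (V1 : rep R d1) (V2 : rep R d2)
      (X : forall a : arrow (bipartite arr), 'M[R]_(d1 (hd a), d2 (tl a))),
    (forall a, V a = castmx (e (hd a), e (tl a))
                       (block_mx (V1 a) (X a) 0 (V2 a))) ->
    orthogonal_dim p d1 ->
    BL p V = (BL p V1 * BL p V2)%E) /\
  (* 5 *)
  (forall V : rep R d, feasible p V ->
    (gaussian_extremisable p V <-> polystable p V) /\
    (gaussian_extremisable p V ->
     forall Y : (forall j : 'I_m, 'M[R]_(d (inr j))),
       gaussian_extremiser p V Y <->
       exists2 A, BLset p V A &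
         forall j, Y j = (A (inr j))^T *m A (inr j))) /\
  (* 6 *)
  (forall V : rep R d, feasible p V ->
     unique_gaussian_extremisers p V -> stable p V) /\
  (forall V : rep R d, stable p V -> End_scalar V ->
     unique_gaussian_extremisers p V).
Proof.
have bw_gt0 := @bp_weight_gt0 R n m arr p p_gt0.
have BLset_poly := fun V : rep R d => BLset_polystable p_gt0 V pd.
split=> [V|].
  by apply: (iff_trans (feasible_semistable p_gt0 pd V)); apply: iff_sym; exact: semistableP.
split=> [V _|]; first exact: BLset_poly.
split=> [V Vf|].
  split=> [|V' V'poly VV']; first exact: polystable_degeneration.
  have /BLset_poly[A' AV'] := V'poly.
  split=> [|A AV]; first exact: BL_closure VV' AV'.
  have [-> _] := BLset_extremiser p_gt0 AV; congr EFin.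
  by apply: chi_powR; case: AV.
split=> [d1 d2 e V V1 V2 X VE d1_orth|].
  have E : dim_sum d1 d2 = d by apply/funext.
  subst d; have -> : V = block_rep V1 X V2.
    by apply/functional_extensionality_dep => a; rewrite VE castmx_id.
  by apply: BL_block => //; apply/orthogonal_dimP.
split=> [V Vf|].
  split=> [|_ Y]; last exact: extremiserP.
  split=> [[Y /(extremiser_BLset p_gt0)[A AV _]]|/BLset_poly[A AV]].
    by apply/BLset_poly; exists A.
  by eexists; exact: (proj2 (BLset_extremiser p_gt0 AV)).
split=> [V Vf [[Y Yext] Yuniq]|V /stableP Vst VEnd].
  apply/stableP/(sink_unique_stable p_gt0).
  - exact/feasible_semistable.
  - move=> H H' /(kn_min_extremiser p_gt0) h /(kn_min_extremiser p_gt0) h'.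
    exact: Yuniq h h'.
  by have [H Hmin _] := extremiser_kn_min p_gt0 Yext; exists H.
split.
  have [H /(kn_min_extremiser p_gt0) h] := stable_kn_min bw_gt0 Vst.
  by exists (fun j => H (inr j)).
move=> Y Y' /(extremiser_kn_min p_gt0)[H Hmin ->] /(extremiser_kn_min p_gt0)[H' Hmin' ->].
by have [c c0 cE] := kn_min_unique bw_gt0 VEnd Hmin Hmin'; exists c.
Qed.
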